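(* Given a graph $G$ on $n$ vertices and $n+k-1$ edges with non-negative edge costs, where $k \ge 1$, the diameter of $G$ can be computed in $O(nk\log n)$ time.
   Context: The diameter of an edge-weighted graph $G$ is $\mathrm{diam}(G)=\max_{u,v\in V(G)} d_G(u,v)$, where $d_G(u,v)$ is the shortest-path distance between $u$ and $v$ with respect to the edge costs. The edge costs are not required to satisfy the triangle inequality. *)

(* Defs.v *)
From HB Require Import structures.
From mathcomp Require Import all_boot all_order all_algebra.
From mathcomp Require Import constructive_ereal.
Set Implicit Arguments.
Unset Strict Implicit.
Unset Printing Implicit Defensive.
Import Order.TTheory GRing.Theory Num.Theory.
Local Open Scope ring_scope.

(** * Weighted graphs, distances, diameter *)

(** Finite simple undirected graphs.  Nothing relates the cost of an edge to
    the costs of other edges (no triangle inequality), and the values of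
    [cost] outside [adj] are irrelevant. *)
Record wgraph (R : realFieldType) (n : nat) := WGraph {
  adj : rel 'I_n;
  adj_sym : symmetric adj;
  adj_irr : irreflexive adj;
  cost : 'I_n -> 'I_n -> R;
  cost_sym : forall u v, adj u v -> cost u v = cost v u;
  cost_ge0 : forall u v, adj u v -> 0 <= cost u v
}.

Section Graph.
Variables (R : realFieldType) (n : nat) (G : wgraph R n).

Definition edges : {set {set 'I_n}} :=
  [set [set p.1; p.2] | p : 'I_n * 'I_n & adj G p.1 p.2].

(** [u :: p] is a simple path of [G] from [u] to [v]. *)
Definition simple_path (u v : 'I_n) (p : seq 'I_n) : bool :=
  [&& path (adj G) u p, last u p == v & uniq (u :: p)].

Fixpoint path_cost (u : 'I_n) (p : seq 'I_n) : R :=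
  if p is v :: q then cost G u v + path_cost v q else 0.

(** The minimum ranges over all simple paths, since these have at most [n]
    vertices; it is [+oo] when [v] is not reachable from [u]. *)
Definition dist (u v : 'I_n) : \bar R :=
  \big[Order.min/+oo%E]_(p : {bseq n of 'I_n} | simple_path u v p)
    (path_cost u p)%:E.

Definition diam : \bar R :=
  \big[Order.max/-oo%E]_(u < n) \big[Order.max/-oo%E]_(v < n) dist u v.

(** [s] lists every edge exactly once, in an arbitrary order and with an
    arbitrary orientation of each edge. *)
Definition edge_list (s : seq ('I_n * 'I_n)) : Prop :=
  perm_eq [seq [set p.1; p.2] | p <- s] (enum edges).

End Graph.

(** * Model of computation *)

(** A random access machine with unit cost operations, presented as a
    structured language.  Integers live in words of [w] bits.  Costs live in
    separate real cells, on which the only operations are copying, addition,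
    subtraction and comparison (there is no multiplication, rounding, or
    conversion to integers, so no packing of information into reals).
    Variables and arrays are named by fixed numerals of the program text; only
    array indices are computed at run time.  Arrays are unbounded, so that the
    memory is that of a RAM with the arrays interleaved. *)

Inductive iexpr :=
| IConst of nat
| IVar of nat
| IGet of nat & iexpr
| IAdd of iexpr & iexpr
| ISub of iexpr & iexpr
| IMul of iexpr & iexpr
| IDiv of iexpr & iexpr.

Inductive rexpr :=
| RZero
| RVar of nat
| RGet of nat & iexpr
| RAdd of rexpr & rexpr
| RSub of rexpr & rexpr.

Inductive bexpr :=
| BLeI of iexpr & iexpr
| BLeR of rexpr & rexpr
| BNot of bexpr
| BAnd of bexpr & bexpr.

Inductive cmd :=
| Skip
| ISet of nat & iexpr
| IPut of nat & iexpr & iexpr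
| RSet of nat & rexpr
| RPut of nat & iexpr & rexpr
| Seq of cmd & cmd
| If of bexpr & cmd & cmd
| While of bexpr & cmd.

Fixpoint isize (e : iexpr) : nat :=
  match e with
  | IConst _ | IVar _ => 1
  | IGet _ e => (isize e).+1
  | IAdd e f | ISub e f | IMul e f | IDiv e f => (isize e + isize f).+1
  end%N.

Fixpoint rsize (e : rexpr) : nat :=
  match e with
  | RZero | RVar _ => 1
  | RGet _ e => (isize e).+1
  | RAdd e f | RSub e f => (rsize e + rsize f).+1
  end%N.

Fixpoint bsize (b : bexpr) : nat :=
  match b with
  | BLeI e f => (isize e + isize f).+1
  | BLeR e f => (rsize e + rsize f).+1
  | BNot b => (bsize b).+1
  | BAnd b c => (bsize b + bsize c).+1
  end%N.

Record state (R : Type) := State {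
  ivar : nat -> nat;
  iarr : nat -> nat -> nat;
  rvar : nat -> R;
  rarr : nat -> nat -> R
}.

Definition upd (T : Type) (f : nat -> T) (x : nat) (v : T) : nat -> T :=
  fun y => if y == x then v else f y.

Section Semantics.
Variables (R : realFieldType) (w : nat).
Implicit Types st : state R.

(** Subtraction is truncated, and division by zero gives zero. *)
Fixpoint ieval st (e : iexpr) : nat :=
  match e with
  | IConst c => c
  | IVar x => ivar st x
  | IGet a e => iarr st a (ieval st e)
  | IAdd e f => ieval st e + ieval st f
  | ISub e f => ieval st e - ieval st f
  | IMul e f => ieval st e * ieval st f
  | IDiv e f => ieval st e %/ ieval st f
  end%N.

Fixpoint reval st (e : rexpr) : R :=
  match e with
  | RZero => 0
  | RVar x => rvar st x
  | RGet a e => rarr st a (ieval st e)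
  | RAdd e f => reval st e + reval st f
  | RSub e f => reval st e - reval st f
  end.

Fixpoint beval st (b : bexpr) : bool :=
  match b with
  | BLeI e f => (ieval st e <= ieval st f)%N
  | BLeR e f => reval st e <= reval st f
  | BNot b => ~~ beval st b
  | BAnd b c => beval st b && beval st c
  end.

(** [exec c st t st']: started in [st], [c] halts in [st'] after [t] unit cost
    steps; every evaluated node of an expression counts.  The machine is stuck
    when an integer to be stored, or the index of a cell to be written, does
    not fit in a word of [w] bits (an intermediate value of an expression has
    at most as many words as the expression has nodes, up to constants of the
    program). *)
Inductive exec : cmd -> state R -> nat -> state R -> Prop :=
| exec_skip st :
    exec Skip st 1 st
| exec_iset st x e :
    (ieval st e < 2 ^ w)%N ->
    exec (ISet x e) st (isize e).+1
      (State (upd (ivar st) x (ieval st e)) (iarr st) (rvar st) (rarr st))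
| exec_iput st a i e :
    (ieval st i < 2 ^ w)%N -> (ieval st e < 2 ^ w)%N ->
    exec (IPut a i e) st (isize i + isize e).+1
      (State (ivar st)
         (upd (iarr st) a (upd (iarr st a) (ieval st i) (ieval st e)))
         (rvar st) (rarr st))
| exec_rset st x e :
    exec (RSet x e) st (rsize e).+1
      (State (ivar st) (iarr st) (upd (rvar st) x (reval st e)) (rarr st))
| exec_rput st a i e :
    (ieval st i < 2 ^ w)%N ->
    exec (RPut a i e) st (isize i + rsize e).+1
      (State (ivar st) (iarr st) (rvar st)
         (upd (rarr st) a (upd (rarr st a) (ieval st i) (reval st e))))
| exec_seq c1 c2 st st1 st2 t1 t2 :
    exec c1 st t1 st1 -> exec c2 st1 t2 st2 ->
    exec (Seq c1 c2) st (t1 + t2) st2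
| exec_if b c1 c2 st st1 t :
    exec (if beval st b then c1 else c2) st t st1 ->
    exec (If b c1 c2) st ((bsize b).+1 + t) st1
| exec_while_stop b c st :
    ~~ beval st b ->
    exec (While b c) st (bsize b).+1 st
| exec_while_loop b c st st1 st2 t1 t2 :
    beval st b ->
    exec c st t1 st1 -> exec (While b c) st1 t2 st2 ->
    exec (While b c) st ((bsize b).+1 + t1 + t2) st2.

(** The machine is deterministic, so a run from a given state is unique. *)
Lemma exec_det c st t1 st1 t2 st2 :
  exec c st t1 st1 -> exec c st t2 st2 -> t1 = t2 /\ st1 = st2.
Proof.
move=> H; elim: H t2 st2 => {c st t1 st1}; intros;
  match goal with
  | H : exec (Skip) _ _ _ |- _ => inversion H
  | H : exec (ISet _ _) _ _ _ |- _ => inversion H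
  | H : exec (IPut _ _ _) _ _ _ |- _ => inversion H
  | H : exec (RSet _ _) _ _ _ |- _ => inversion H
  | H : exec (RPut _ _ _) _ _ _ |- _ => inversion H
  | H : exec (Seq _ _) _ ?t ?s |- ?l = ?t /\ _ => inversion H
  | H : exec (If _ _ _) _ ?t ?s |- _ = ?t /\ _ => inversion H
  | H : exec (While _ _) _ ?t ?s |- _ = ?t /\ _ => inversion H
  end; subst; try (by []);
  try (match goal with
       | H1 : is_true (~~ beval ?s ?b), H2 : is_true (beval ?s ?b) |- _ =>
           by rewrite H2 in H1
       end);
  repeat match goal with
  | IH : (forall t2 st2, exec ?c ?s t2 st2 -> _), H : exec ?c ?s _ _ |- _ =>
      let E := fresh "E" in
      have E := IH _ _ H; clear IH; destruct E; subst
  end; by [].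
Qed.

End Semantics.

(** Input convention: variables 0 and 1 hold the numbers of vertices and of
    edges, integer arrays 0 and 1 the endpoints of the listed edges, and real
    array 0 their costs; every other cell is zero. *)
Definition init_state (R : realFieldType) (n : nat) (G : wgraph R n)
    (s : seq ('I_n * 'I_n)) : state R :=
  State
    (fun x => nth 0%N [:: n; size s] x)
    (fun a i => nth 0%N
       (nth [::] [:: [seq nat_of_ord p.1 | p <- s];
                     [seq nat_of_ord p.2 | p <- s]] a) i)
    (fun _ => 0)
    (fun a i => nth 0 (nth [::] [:: [seq cost G p.1 p.2 | p <- s]] a) i).

(** Output convention: real variable 0, unless integer variable 0 is nonzero,
    which signals the value [+oo]. *)
Definition output (R : realFieldType) (st : state R) : \bar R :=
  if ivar st 0 == 0%N then (rvar st 0)%:E else +oo%E.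

(* Main.v *)
Require Import Defs.
From HB Require Import structures.
From mathcomp Require Import all_boot all_order all_algebra.
From mathcomp Require Import constructive_ereal zify lra.
Set Implicit Arguments.
Unset Strict Implicit.
Unset Printing Implicit Defensive.
Import Order.TTheory GRing.Theory Num.Theory.
Local Open Scope ring_scope.

(** Distances are invariant under pruning a leaf, once the depth of what was
    pruned is recorded at its neighbour and the longest path through that
    neighbour is recorded globally.  Pruning leaves a core of minimum degree 2
    with as many edges as vertices plus [k - 1], so the vertices of degree at
    least 3 (together with one arbitrary vertex, in case there are none) number
    at most [2 k] and cut the core into at most [6 k] directed arcs.  Dijkstra's
    algorithm is run from each of these portals.  The distance from [u] to the
    vertex at position [x] on an arc of length [L] is the minimum of [al + x] and
    [be + L - x], where [al] and [be] are the distances from [u] to the ends of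
    the arc; if [u] itself lies on the arc, [al] is minus the position of [u],
    which is exact beyond [u] and harmless before it.  The first term is the
    smaller one on a prefix of the arc, which is found by bisection, so prefix
    and suffix maxima of position plus depth answer the query for [u] and the
    arc in time O(log n).  The vertex [u] has to be left out of the prefix, so
    the two largest values of each prefix are kept. *)

(** * Total correctness with time credits *)

(** The number of portals is bounded both by [2 * k] and by [n]. A run of Dijkstra's algorithm costs
    O((n + k) log n), so when k exceeds n the first bound alone would allow a term of order k^2 log
    n; the smaller of the two bounds keeps the product at O(nk log n). The constants 2 and 6 come
    from the excess of the degrees over 2, whose sum over the core is 2(k - 1). The diameter is
    handled through its upper bounds. Each candidate fed to the accumulator is shown to lie below
    every upper bound of the distances, and each pair of vertices is shown to be dominated by some
    candidate. So a candidate need not be the weight of an actual pair, which leaves room for the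
    value 0 where a prefix or a suffix is empty. The two halves of the argument use different facts
    about an arc: soundness needs that the smaller of the two terms is at most the distance, and
    this holds at every inner vertex; domination needs that both terms are at least the distance,
    and this holds only beyond [u]. Pairs on a common arc are therefore covered from their earlier
    vertex. A run from one vertex detects disconnected graphs before anything else is done. *)

Lemma upd_same (T : Type) (f : nat -> T) x v : upd f x v x = v.
Proof. by rewrite /upd eqxx. Qed.

Lemma upd_neq (T : Type) (f : nat -> T) x v y :
  (y == x) = false -> upd f x v y = f y.
Proof. by rewrite /upd => ->. Qed.

Section Framework.
Variables (R : realFieldType) (w : nat).
Implicit Types (st : state R) (Q : state R -> nat -> Prop).
Local Open Scope nat_scope.

(** [r] counts time credits; those left over are passed on to [Q]. *)
Definition wp c st r Q :=
  exists t st' r', [/\ exec w c st t st', r = r' + t & Q st' r'].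

Lemma wp_weaken c st r Q Q' :
  (forall st' r', Q st' r' -> Q' st' r') -> wp c st r Q -> wp c st r Q'.
Proof. by move=> QQ' [t [st' [r' [? ? ?]]]]; exists t, st', r'; split=> //; apply: QQ'. Qed.

Lemma wp_skip st r Q :
  0 < r -> (forall r', r = r' + 1 -> Q st r') -> wp Skip st r Q.
Proof.
by move=> r_gt0 H; exists 1, st, (r - 1); split; [constructor|lia|apply: H; lia].
Qed.

Lemma wp_iset x e st r Q :
  ieval st e < 2 ^ w -> isize e < r ->
  (forall r', r = r' + (isize e).+1 ->
   Q (State (upd (ivar st) x (ieval st e)) (iarr st) (rvar st) (rarr st)) r') ->
  wp (ISet x e) st r Q.
Proof.
by move=> ? ? H; do 2 eexists; exists (r - (isize e).+1);
  split; [constructor | lia | apply: H; lia].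
Qed.

Lemma wp_iput a i e st r Q :
  ieval st i < 2 ^ w -> ieval st e < 2 ^ w -> isize i + isize e < r ->
  (forall r', r = r' + (isize i + isize e).+1 ->
   Q (State (ivar st)
       (upd (iarr st) a (upd (iarr st a) (ieval st i) (ieval st e)))
       (rvar st) (rarr st)) r') ->
  wp (IPut a i e) st r Q.
Proof.
by move=> ? ? ? H; do 2 eexists; exists (r - (isize i + isize e).+1);
  split; [constructor | lia | apply: H; lia].
Qed.

Lemma wp_rset x e st r Q :
  rsize e < r ->
  (forall r', r = r' + (rsize e).+1 ->
   Q (State (ivar st) (iarr st) (upd (rvar st) x (reval st e)) (rarr st)) r') ->
  wp (RSet x e) st r Q.
Proof.
by move=> ? H; do 2 eexists; exists (r - (rsize e).+1);
  split; [constructor | lia | apply: H; lia].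
Qed.

Lemma wp_rput a i e st r Q :
  ieval st i < 2 ^ w -> isize i + rsize e < r ->
  (forall r', r = r' + (isize i + rsize e).+1 ->
   Q (State (ivar st) (iarr st) (rvar st)
       (upd (rarr st) a (upd (rarr st a) (ieval st i) (reval st e)))) r') ->
  wp (RPut a i e) st r Q.
Proof.
by move=> ? ? H; do 2 eexists; exists (r - (isize i + rsize e).+1);
  split; [constructor | lia | apply: H; lia].
Qed.

Lemma wp_seq c1 c2 st r Q :
  wp c1 st r (fun st1 r1 => wp c2 st1 r1 Q) -> wp (Seq c1 c2) st r Q.
Proof.
move=> [t1 [st1 [r1 [H1 -> [t2 [st2 [r2 [H2 -> H]]]]]]]].
by exists (t1 + t2), st2, r2; split; [exact: exec_seq H1 H2 | lia | ].
Qed.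

Lemma wp_if b c1 c2 st r Q :
  bsize b < r ->
  (beval st b -> forall r', r = r' + (bsize b).+1 -> wp c1 st r' Q) ->
  (~~ beval st b -> forall r', r = r' + (bsize b).+1 -> wp c2 st r' Q) ->
  wp (If b c1 c2) st r Q.
Proof.
move=> lt_r H1 H2; have Er : r = r - (bsize b).+1 + (bsize b).+1 by lia.
have [t [st' [r' [H Er' ?]]]] :
    wp (if beval st b then c1 else c2) st (r - (bsize b).+1) Q.
  by case: ifP => E; [apply: H1 | apply: H2; rewrite ?E].
exists ((bsize b).+1 + t), st', r'.
by split; [exact: exec_if | lia | ].
Qed.

(** Induction on the credits: each round pays at least for its guard, so no separate variant is
    needed, and a single invariant yields both termination and the time bound. *)
Lemma wp_while (I : state R -> nat -> Prop) b c st r Q :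
  (forall st r, I st r -> bsize b < r) ->
  (forall st r r', I st r -> beval st b -> r = r' + (bsize b).+1 -> wp c st r' I) ->
  (forall st r r', I st r -> ~~ beval st b -> r = r' + (bsize b).+1 -> Q st r') ->
  I st r -> wp (While b c) st r Q.
Proof.
move=> HI Hb HQ; elim: r {-2}r (leqnn r) st => [|N IH] r le_rN st Ist.
  by have := HI _ _ Ist; lia.
have lt_r := HI _ _ Ist; have Er : r = r - (bsize b).+1 + (bsize b).+1 by lia.
have [E|E] := boolP (beval st b); last first.
  by exists (bsize b).+1, st, (r - (bsize b).+1);
    split; [constructor | | exact: HQ Ist E Er].
have [t1 [st1 [r1 [H1 Er1 I1]]]] := Hb _ _ _ Ist E Er.
have [|t2 [st2 [r2 [H2 Er2 Q2]]]] := IH r1 _ st1 I1; first by lia.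
exists ((bsize b).+1 + t1 + t2), st2, r2.
by split; [exact: exec_while_loop H1 H2 | lia | ].
Qed.

Fixpoint ivars c : seq nat :=
  match c with
  | ISet x _ => [:: x]
  | Seq c1 c2 | If _ c1 c2 => ivars c1 ++ ivars c2
  | While _ c => ivars c
  | _ => [::]
  end.

Fixpoint iarrs c : seq nat :=
  match c with
  | IPut a _ _ => [:: a]
  | Seq c1 c2 | If _ c1 c2 => iarrs c1 ++ iarrs c2
  | While _ c => iarrs c
  | _ => [::]
  end.

Fixpoint rvars c : seq nat :=
  match c with
  | RSet x _ => [:: x]
  | Seq c1 c2 | If _ c1 c2 => rvars c1 ++ rvars c2
  | While _ c => rvars c
  | _ => [::]
  end.

Fixpoint rarrs c : seq nat :=
  match c with
  | RPut a _ _ => [:: a]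
  | Seq c1 c2 | If _ c1 c2 => rarrs c1 ++ rarrs c2
  | While _ c => rarrs c
  | _ => [::]
  end.

(** Write sets are read off the syntax, so a specification mentions only what a command may change;
    the rest survives a call by a computed membership test. *)
Record frame c st st' : Prop := Frame {
  frame_iv : forall x, x \notin ivars c -> ivar st' x = ivar st x;
  frame_ia : forall a, a \notin iarrs c -> iarr st' a = iarr st a;
  frame_rv : forall x, x \notin rvars c -> rvar st' x = rvar st x;
  frame_ra : forall a, a \notin rarrs c -> rarr st' a = rarr st a
}.

Lemma exec_frame c st t st' : exec w c st t st' -> frame c st st'.
Proof.
elim=> {c st t st'}.
- by [].
- by move=> st x e _; split=> //= y; rewrite inE /upd => /negbTE ->.
- by move=> st a i e _ _; split=> //= b; rewrite inE /upd => /negbTE ->.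
- by move=> st x e; split=> //= y; rewrite inE /upd => /negbTE ->.
- by move=> st a i e _; split=> //= b; rewrite inE /upd => /negbTE ->.
- move=> c1 c2 st st1 st2 t1 t2 _ [a1 b1 d1 e1] _ [a2 b2 d2 e2].
  by split=> /= x; rewrite mem_cat negb_or => /andP[? ?];
    rewrite ?a2 ?b2 ?d2 ?e2 // ?a1 ?b1 ?d1 ?e1.
- move=> b c1 c2 st st1 t _.
  by case: ifP => _ [a1 b1 d1 e1]; split=> /= x;
    rewrite mem_cat negb_or => /andP[? ?]; rewrite ?a1 ?b1 ?d1 ?e1.
- by [].
- move=> b c st st1 st2 t1 t2 _ _ [a1 b1 d1 e1] _ [a2 b2 d2 e2].
  by split=> /= x ?; rewrite ?a2 ?b2 ?d2 ?e2 // ?a1 ?b1 ?d1 ?e1.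
Qed.

Lemma wp_frame c st r Q :
  wp c st r (fun st' r' => frame c st st' -> Q st' r') -> wp c st r Q.
Proof.
move=> [t [st' [r' [H le_t HQ]]]]; exists t, st', r'; split=> //.
exact: HQ (exec_frame H).
Qed.

Definition For x y c :=
  Seq (ISet x (IConst 0))
    (While (BNot (BLeI (IVar y) (IVar x)))
       (Seq c (ISet x (IAdd (IVar x) (IConst 1))))).

Definition set_ivar st x v :=
  State (upd (ivar st) x v) (iarr st) (rvar st) (rarr st).

(** [I] has to be insensitive to the counter [x]; the overhead of the loop is
    set apart from the credits that [I] speaks of. *)
Lemma wp_for (I : nat -> state R -> nat -> Prop) b x y c st r Q :
  ivar st y = b -> x != y -> x \notin ivars c -> y \notin ivars c ->
  b < 2 ^ w -> 9 * b + 7 <= r ->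
  (forall i st r, i < b -> ivar st x = i -> ivar st y = b -> I i st r ->
     wp c st r (fun st' r' => I i.+1 (set_ivar st' x i.+1) r')) ->
  (forall st' r', ivar st' x = b -> frame (For x y c) st st' ->
     I b st' r' -> Q st' r') ->
  I 0 (set_ivar st x 0) (r - (9 * b + 7)) -> wp (For x y c) st r Q.
Proof.
move=> y_b neq_xy x_c y_c b_w le_r Hc HQ I0; apply: wp_frame.
apply: wp_seq; apply: wp_iset => /= [||r1 Er1]; [by rewrite expn_gt0 | by lia |].
apply: (wp_while (I := fun st r => ivar st y = b /\ exists2 r', r = r' + 9 * (b - ivar st x) + 5 & ivar st x <= b /\ I (ivar st x) st r')).
- by move=> st' r' [_ [r0 -> _]] /=; lia.
- move=> st' r2 r' [y_b' [r0 -> [x_b' I']]] /=.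
  rewrite y_b' -ltnNge => lt_xb Er; apply: wp_seq; apply: wp_frame.
  have [t [st2 [r3 [H Er3 H2]]]] := Hc _ _ _ lt_xb erefl y_b' I'.
  exists t, st2, (r3 + 9 * (b - (ivar st' x).+1) + 5 + 4); split=> //; first by lia.
  move=> [fI _ _ _]; have Ex := fI x x_c; have Ey := fI y y_c.
  apply: wp_iset => /= [||r4 Er4]; [by lia | by lia |].
  rewrite upd_neq ?upd_same; last by rewrite eq_sym (negbTE neq_xy).
  split; first by rewrite Ey.
  exists r3; first by lia.
  by split; first lia; move: H2; rewrite /set_ivar Ex addn1.
- move=> st' r2 r' [y_b' [r0 -> [x_b' I']]] /=.
  rewrite y_b' -ltnNge -leqNgt => le_bx Er F.
  have Ex : ivar st' x = b by lia.
  apply: HQ => //; rewrite Ex in I'; rewrite (_ : r' = r0) //; lia.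
- rewrite /= upd_neq ?upd_same; last by rewrite eq_sym (negbTE neq_xy).
  split=> //; exists (r - (9 * b + 7)); first by lia.
  by split; first lia.
Qed.

End Framework.

Declare Scope cmd_scope.
Delimit Scope cmd_scope with cmd.
Notation "c ;; d" := (Seq c d) (at level 90, right associativity) : cmd_scope.

(** [lia] on the hypotheses about natural numbers only: the others slow it
    down without helping it. *)
Ltac clear_unless_nat :=
  repeat match goal with
  | H : ?T |- _ =>
      lazymatch T with
      | ?A -> _ => lazymatch A with context [leq _ _] => fail | _ => clear H end
      | forall x, _ => clear H
      | context [leq _ _] => fail
      | @eq bool _ _ => fail
      | @eq ?A _ _ => tryif unify A nat then fail else clear H
      | context [@eq nat _ _] => fail
      | context [@eq_op _ _ _] => fail
      | ~ _ => fail
      | _ => clear H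
      end
  end.
Ltac nat_lia := intros; clear_unless_nat; lia.

(** Resolves reads of [upd] at numerals, i.e. of program variables and names
    of arrays, leaving the updates at computed indices alone. *)
Ltac is_numeral n := lazymatch n with O => idtac | S ?m => is_numeral m end.
Ltac upd_simpl :=
  repeat match goal with
  | |- context [@upd ?T ?f ?x ?v ?y] =>
      is_numeral x; is_numeral y;
      let b := eval compute in (Nat.eqb y x) in
      lazymatch b with
      | true => change (@upd T f x v y) with v
      | false => change (@upd T f x v y) with (f y)
      end
  end.
Ltac cmd_simpl := cbn -[upd eq_op addn subn muln divn expn leq eqn Order.le GRing.add GRing.opp]; upd_simpl.
Ltac cmd_assign :=
  lazymatch goal with
  | |- wp _ (ISet _ _) _ _ _ => apply: wp_iset
  | |- wp _ (IPut _ _ _) _ _ _ => apply: wp_iput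
  | |- wp _ (RSet _ _) _ _ _ => apply: wp_rset
  | |- wp _ (RPut _ _ _) _ _ _ => apply: wp_rput
  | |- wp _ Skip _ _ _ => apply: wp_skip
  end.
Ltac cmd_seq :=
  repeat lazymatch goal with
  | |- wp _ ?c _ _ _ =>
      let c' := eval hnf in c in
      lazymatch c' with Seq _ _ => apply: wp_seq end
  end.
Ltac cmd_step := cmd_seq; cmd_assign; cmd_simpl;
  try (lazymatch goal with |- is_true _ => nat_lia end);
  try (let r := fresh "rc" in let Er := fresh "Erc" in move=> r Er).

(** * Memory layout and tournament trees *)

(** Names of integer variables [v*], integer arrays [a*], real variables [x*]
    and real arrays [r*].  The less obvious ones: [vB] is the offset of the row
    of the current source in the distance table [rDT]; [aT] and [rTK] are the
    owners and the keys of a tournament tree with leaves [n .. 2n-1], where the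
    owner [0] means none and [v + 1] means the vertex [v]; [aEs v] is the sum of
    the numbers of the edges at [v] that are still alive, so that the other edge
    at a vertex of degree 2 is got by a subtraction; [rH v] is the depth of the
    trees pruned at [v]; [aQ], [aPos] and [rX] hold the vertices of the current
    arc, their indices and their positions, and [rTop], [aArg], [rSnd] and
    [rSuf] its prefix and suffix maxima. *)
Notation vN := 0%N (only parsing).
Notation vM := 1%N (only parsing).
Notation vS := 2%N (only parsing).
Notation vB := 3%N (only parsing).
Notation vI := 4%N (only parsing).
Notation vG := 5%N (only parsing).
Notation vV := 6%N (only parsing).
Notation vY := 7%N (only parsing).
Notation vE := 8%N (only parsing).
Notation vJ := 9%N (only parsing).
Notation vL := 10%N (only parsing).
Notation vU := 11%N (only parsing).
Notation vW := 12%N (only parsing).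
Notation vP := 13%N (only parsing).
Notation vK := 14%N (only parsing).
Notation vLen := 15%N (only parsing).
Notation vLo := 16%N (only parsing).
Notation vHi := 17%N (only parsing).
Notation vMid := 18%N (only parsing).
Notation vIn := 19%N (only parsing).
Notation vZ := 21%N (only parsing).
Notation aEA := 0%N (only parsing).
Notation aEB := 1%N (only parsing).
Notation aHead := 2%N (only parsing).
Notation aNext := 3%N (only parsing).
Notation aSeen := 4%N (only parsing).
Notation aT := 5%N (only parsing).
Notation aDeg := 6%N (only parsing).
Notation aEs := 7%N (only parsing).
Notation aDead := 8%N (only parsing).
Notation aPor := 9%N (only parsing).
Notation aQ := 10%N (only parsing).
Notation aPos := 11%N (only parsing).
Notation aArg := 12%N (only parsing).
Notation xD := 0%N (only parsing).
Notation xL := 1%N (only parsing).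
Notation xM := 2%N (only parsing).
Notation xA := 3%N (only parsing).
Notation xB := 4%N (only parsing).
Notation xX := 5%N (only parsing).
Notation rC := 0%N (only parsing).
Notation rDT := 1%N (only parsing).
Notation rTK := 2%N (only parsing).
Notation rH := 3%N (only parsing).
Notation rX := 4%N (only parsing).
Notation rTop := 5%N (only parsing).
Notation rSnd := 6%N (only parsing).
Notation rSuf := 7%N (only parsing).

Definition two_i := IMul (IConst 2) (IVar vI).
Definition two_i1 := IAdd two_i (IConst 1).

Definition fix_up :=
  (ISet vI (IDiv (IVar vI) (IConst 2)) ;;
   While (BLeI (IConst 1) (IVar vI))
     (If (BAnd (BLeI (IConst 1) (IGet aT two_i1))
            (BNot (BAnd (BLeI (IConst 1) (IGet aT two_i))
                     (BLeR (RGet rTK two_i) (RGet rTK two_i1)))))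
        (IPut aT (IVar vI) (IGet aT two_i1) ;;
         RPut rTK (IVar vI) (RGet rTK two_i1))
        (IPut aT (IVar vI) (IGet aT two_i) ;;
         RPut rTK (IVar vI) (RGet rTK two_i)) ;;
      ISet vI (IDiv (IVar vI) (IConst 2))))%cmd.

Section Tournament.
Variables (R : realFieldType) (w n : nat).
Implicit Types (st : state R) (Q : state R -> nat -> Prop).
Implicit Types (T : nat -> nat) (K : nat -> R).
Local Open Scope nat_scope.

(** The key of a node without owner is meaningless, hence the guards on [T c] and [T d]; the last
    clause also forces an owner upwards as soon as one child has one. *)
Definition node_ok T K j :=
  exists2 c, c \in [:: 2 * j; 2 * j + 1] &
    [/\ T j = T c, 0 < T c -> K j = K c &
        forall d, d \in [:: 2 * j; 2 * j + 1] -> 0 < T d ->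
          0 < T c /\ (K c <= K d)%R].

(** Every inner node but possibly [x] holds the better of its children. *)
Definition tournament T K x :=
  (forall j, j < 2 * n -> T j <= n) /\
  (forall j, 0 < j < n -> j != x -> node_ok T K j).

(** Climb from [i] to the root by halving: an owner persists, and the key can only decrease. *)
Lemma tournament_le T K i :
  tournament T K 0 -> 0 < i < 2 * n -> 0 < T i -> 0 < T 1 /\ (K 1 <= K i)%R.
Proof.
move=> [_ ok]; elim: i {-2}i (leqnn i) => [|N IH] i le_iN /andP[i_gt0 lt_i] Ti.
  by nat_lia.
have [i1|i_neq1] := eqVneq i 1; first by rewrite i1 in Ti *.
have [||c _ [eT eK mx]] := ok (i %/ 2) _; [by nat_lia | by nat_lia |].
have [|//|T2 K2] := mx i; first by rewrite !inE; nat_lia.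
have [||| T1 K1] := IH (i %/ 2); [by nat_lia | by nat_lia | by rewrite eT |].
by split=> //; apply: le_trans K1 _; rewrite eK.
Qed.

(** Descend along the children that were copied; indices grow, so a leaf is reached. This traces the
    root back to an actual vertex. *)
Lemma tournament_leaf T K j :
  tournament T K 0 -> 0 < j < 2 * n ->
  exists2 i, n <= i < 2 * n & T j = T i /\ (0 < T i -> K j = K i).
Proof.
move=> [_ ok]; move: {2}(2 * n - j) (leqnn (2 * n - j)) => N.
elim: N j => [|N IH] j leN j_bd; first by nat_lia.
have [le_nj|lt_jn] := leqP n j; first by exists j => //; nat_lia.
have [||c c_in [eT eK _]] := ok j _; [by nat_lia | by nat_lia |].
have [||i i_bd [eT' eK']] := IH c; try by move: c_in; rewrite !inE; nat_lia.
by exists i => //; rewrite eT eT'; split=> // Ti; rewrite eK ?eK' ?eT'.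
Qed.

(** Only the parent reads the cell [i], so repairing [i] moves the single defect to [i %/ 2]. From
    the root it moves to 0, which is not a node. *)
Lemma tournament_copy T K i c :
  0 < i < n -> c \in [:: 2 * i; 2 * i + 1] ->
  (forall d, d \in [:: 2 * i; 2 * i + 1] -> 0 < T d ->
    0 < T c /\ (K c <= K d)%R) ->
  tournament T K i -> tournament (upd T i (T c)) (upd K i (K c)) (i %/ 2).
Proof.
move=> i_bd c_in best [leT ok]; split=> [j lt_j|j j_bd j_par].
  rewrite /upd; case: ifP => _; apply: leT => //.
  by move: c_in; rewrite !inE; nat_lia.
have [->|neq_ji] := eqVneq j i.
  have ne d : d \in [:: 2 * i; 2 * i + 1] -> (d == i) = false.
    by rewrite !inE; nat_lia.
  exists c => //; rewrite /upd eqxx (ne c c_in); split=> // d d_in.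
  by rewrite (ne d d_in); apply: best.
have [c' c'_in [eT eK mx]] := ok j j_bd neq_ji.
have ne d : d \in [:: 2 * j; 2 * j + 1] -> (d == i) = false.
  by rewrite !inE; nat_lia.
exists c' => //; rewrite /upd (negbTE neq_ji) (ne c' c'_in); split=> // d d_in.
by rewrite (ne d d_in); apply: mx.
Qed.

Hypothesis n_ge2 : (2 <= n).
Hypothesis fits : (2 * n < 2 ^ w).

Lemma wp_fix_up q st r Q :
  0 < ivar st vI < 2 * n -> ivar st vI < 2 ^ q ->
  tournament (iarr st aT) (rarr st rTK) (ivar st vI %/ 2) ->
  100 * q.+1 <= r ->
  (forall st' r', frame fix_up st st' ->
     tournament (iarr st' aT) (rarr st' rTK) 0 ->
     (forall j, n <= j -> iarr st' aT j = iarr st aT j) ->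
     (forall j, n <= j -> rarr st' rTK j = rarr st rTK j) ->
     r <= r' + 100 * q.+1 -> Q st' r') ->
  wp w fix_up st r Q.
Proof.
move=> i_bd i_q tok le_r HQ; apply: wp_frame.
cmd_step.
(* [p] bounds the number of levels still to climb; halving the index lowers it by one, and each
   level is paid with 100 credits. *)
apply: (wp_while (I := fun st' r' => [/\ ivar st' vI < n,
   tournament (iarr st' aT) (rarr st' rTK) (ivar st' vI),
     (forall j, n <= j -> iarr st' aT j = iarr st aT j) /\
     (forall j, n <= j -> rarr st' rTK j = rarr st rTK j) &
   exists p, ivar st' vI < 2 ^ p /\ r + 100 * p + 10 <= r' + 100 * q.+1])).
- by move=> st' r' [_ _ _ [p [_]]] /=; nat_lia.
- move=> st' rb r' [lt_n tok' [fT fK] [p [lt_p le_r']]] /= i_gt0 Erb.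
  have leT := tok'.1.
  case: p lt_p le_r' => [|p] lt_p le_r'; first by nat_lia.
  rewrite expnS in lt_p.
  have out j : n <= j -> (j == ivar st' vI) = false by nat_lia.
  apply: wp_seq; apply: wp_if => [|/= cond r1 Er1|/= cond r1 Er1].
  + by rewrite /=; nat_lia.
  + cmd_step; first by have := leT (2 * ivar st' 4 + 1); nat_lia.
    cmd_step.
    cmd_step.
    split; cmd_simpl; first by nat_lia.
    * apply: tournament_copy; rewrite ?inE ?eqxx ?orbT ?i_gt0 // => d.
      have /andP[T1 /nandP nle] := cond; rewrite !inE => /orP[]/eqP-> // T0.
      split=> //; case: nle => [|nle]; first by rewrite T0.
      by rewrite ltW // ltNge.
    * by split=> j le_nj; rewrite upd_neq ?fT ?fK // out.
    * by exists p; nat_lia.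
  + cmd_step; first by have := leT (2 * ivar st' 4); nat_lia.
    cmd_step.
    cmd_step.
    split; cmd_simpl; first by nat_lia.
    * apply: tournament_copy; rewrite ?inE ?eqxx ?orbT ?i_gt0 // => d.
      move: cond; rewrite negb_and negbK => /orP[T0|/andP[T0 le01]].
        rewrite !inE => /orP[]/eqP-> //.
        by rewrite (negbTE T0).
      by rewrite !inE => /orP[]/eqP->.
    * by split=> j le_nj; rewrite upd_neq ?fT ?fK // out.
    * by exists p; nat_lia.
- move=> st' rb r' [lt_n tok' [fT fK] [p [lt_p le_r']]] /= i_eq0 Erb F.
  apply: HQ => //; last by nat_lia.
  by rewrite (_ : ivar st' 4 = 0) in tok'; last nat_lia.
- split=> /=; upd_simpl => //; first by nat_lia.
  by exists q; nat_lia.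
Qed.
End Tournament.

(** * Walks and half-edges *)

Record net (R : realFieldType) := Net {
  nv : nat;
  ne : nat;
  ea : nat -> nat;
  eb : nat -> nat;
  len : nat -> R;
  ea_lt : forall e, (e < ne)%N -> (ea e < nv)%N;
  eb_lt : forall e, (e < ne)%N -> (eb e < nv)%N;
  ends_neq : forall e, (e < ne)%N -> ea e <> eb e;
  len_ge0 : forall e, (e < ne)%N -> 0 <= len e
}.

Section Walks.
Variables (R : realFieldType) (N : net R).
Implicit Types (A : nat -> bool) (u v e : nat) (c : R).

Definition inc e v := (ea N e == v) || (eb N e == v).
Definition opp e v := (ea N e + eb N e - v)%N.

Lemma inc_lt e v : (e < ne N)%N -> inc e v -> (v < nv N)%N.
Proof. by move=> lt_e /orP[]/eqP<-; rewrite ?ea_lt ?eb_lt. Qed.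

Lemma inc_opp e v : inc e v -> inc e (opp e v).
Proof. by rewrite /inc /opp; nat_lia. Qed.

Lemma oppK e v : inc e v -> opp e (opp e v) = v.
Proof. by rewrite /inc /opp; nat_lia. Qed.

Lemma opp_neq e v : (e < ne N)%N -> inc e v -> opp e v <> v.
Proof. by move=> /ends_neq; rewrite /inc /opp; nat_lia. Qed.

Lemma inc_eq e u v : inc e u -> inc e v -> u = v \/ v = opp e u.
Proof. by rewrite /inc /opp; nat_lia. Qed.

(** Walks may repeat vertices, so they concatenate and reverse freely; lengths being nonnegative,
    they give the same distances as simple paths. [A] constrains every vertex, which lets one notion
    serve the whole net and its cores. *)
Inductive walk A : nat -> nat -> R -> Prop :=
| walk_nil u : A u -> walk A u u 0
| walk_cons u e v c : A u -> (e < ne N)%N -> inc e u ->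
    walk A (opp e u) v c -> walk A u v (len N e + c).

Lemma walk_ends A u v c : walk A u v c -> A u /\ A v.
Proof. by elim=> {u v c} // u e v c Au _ _ _ []. Qed.

Lemma walk_ge0 A u v c : walk A u v c -> 0 <= c.
Proof. by elim=> {u v c} // u e v c Au lt_e _ _ c0; rewrite addr_ge0 ?len_ge0. Qed.

Lemma walk_sub A (B : nat -> bool) u v c : (forall v, A v -> B v) -> walk A u v c -> walk B u v c.
Proof.
move=> AB; elim=> {u v c} [u|u e v c] Au; first exact: walk_nil (AB _ Au).
by move=> lt_e inc_e _; apply: walk_cons => //; apply: AB.
Qed.

Lemma walk_cat A u v x c d : walk A u v c -> walk A v x d -> walk A u x (c + d).
Proof.
move=> H1 H2; elim: H1 H2 => {u v c} [u _|u e v c Au lt_e inc_e _ IH] H2.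
  by rewrite add0r.
by rewrite -addrA; apply: walk_cons => //; apply: IH.
Qed.

Lemma walk_edge A e u : A u -> A (opp e u) -> (e < ne N)%N -> inc e u ->
  walk A u (opp e u) (len N e).
Proof.
move=> Au Ao lt_e inc_e; rewrite -[len N e]addr0.
by apply: walk_cons => //; apply: walk_nil.
Qed.

Lemma walk_rcons A u v e c : walk A u v c -> (e < ne N)%N -> inc e v ->
  A (opp e v) -> walk A u (opp e v) (c + len N e).
Proof.
move=> H lt_e inc_e Ao; apply: (walk_cat H); apply: walk_edge => //.
by case: (walk_ends H).
Qed.

Lemma walk_sym A u v c : walk A u v c -> walk A v u c.
Proof.
elim=> {u v c} [u Au|u e v c Au lt_e inc_e H IH]; first exact: walk_nil.
have [Ao _] := walk_ends H; rewrite addrC -[X in walk A v X](oppK inc_e).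
by apply: walk_rcons; rewrite ?oppK ?inc_opp.
Qed.

(** The half-edges are numbered [1 .. 2 * ne], the two halves of the edge [e]
    being [2 * e + 1], based at [ea e], and [2 * e + 2], based at [eb e]. *)
Definition hsrc g := if odd g then ea N (g.-1 %/ 2) else eb N (g.-1 %/ 2).

(** The head of the list of [v] once the half-edges [1 .. g] have been inserted, 0 marking the end.
    Insertion happens at the head, so a list runs through decreasing numbers and the successor of
    [g] is again of this form. *)
Fixpoint last_half v g :=
  if g is g'.+1 then if hsrc g == v then g else last_half v g' else 0%N.

Lemma last_halfS v g :
  last_half v g.+1 = if hsrc g.+1 == v then g.+1 else last_half v g.
Proof. by []. Qed.

Definition nhalf v g := (\sum_(1 <= h < g.+1 | hsrc h == v) 1)%N.

Lemma last_half_le v g : (last_half v g <= g)%N.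
Proof. by elim: g => //= g IH; case: ifP => // _; nat_lia. Qed.

Lemma last_half_src v g : (0 < last_half v g)%N -> hsrc (last_half v g) = v.
Proof. by elim: g => [|g IH] //=; case: ifP => // /eqP. Qed.

Lemma last_half_max v g h :
  (last_half v g < h <= g)%N -> hsrc h <> v.
Proof.
elim: g => [|g IH] /=; first by nat_lia.
case: ifP => [_|ne_g]; first by nat_lia.
have [->|ne_h] := eqVneq h g.+1; first by move=> _ E; rewrite E eqxx in ne_g.
by move=> H; apply: IH; nat_lia.
Qed.

Lemma hsrc_inc g : (0 < g)%N -> inc (g.-1 %/ 2) (hsrc g).
Proof. by move=> _; rewrite /hsrc /inc; case: ifP; rewrite eqxx ?orbT. Qed.

Lemma inc_hsrc e v : (e < ne N)%N -> inc e v ->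
  exists2 g, (0 < g <= 2 * ne N)%N & hsrc g = v /\ (g.-1 %/ 2 = e)%N.
Proof.
have h1 : ((2 * e + 1).-1 %/ 2 = e)%N by nat_lia.
have h2 : ((2 * e + 2).-1 %/ 2 = e)%N by nat_lia.
move=> lt_e /orP[]/eqP<-; [exists (2 * e + 1)%N | exists (2 * e + 2)%N]; try nat_lia.
- by rewrite /hsrc h1 oddD oddM.
- by rewrite /hsrc h2 oddD oddM.
Qed.

Lemma nhalf_last v g : (0 < last_half v g)%N ->
  nhalf v g = (nhalf v (last_half v g).-1).+1.
Proof.
elim: g => [|g IH] //=; case: ifP => ne_g.
  by rewrite /nhalf big_mkcond big_nat_recr //= ne_g addn1 -big_mkcond.
move=> /IH <-; rewrite /nhalf big_mkcond big_nat_recr //= ne_g addn0.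
by rewrite -big_mkcond.
Qed.

(** Each half-edge has exactly one source; exchanging the sums gives the total length of the lists,
    hence the total cost of scanning them. *)
Lemma sum_nhalf : (\sum_(v < nv N) nhalf v (2 * ne N) = 2 * ne N)%N.
Proof.
rewrite (eq_bigr (fun v : 'I_(nv N) =>
  \sum_(1 <= h < (2 * ne N).+1) (hsrc h == v :> nat : nat))%N); last first.
  by move=> v _; rewrite /nhalf big_mkcond /=; apply: eq_bigr => h _; case: eqP.
rewrite exchange_big /= (eq_big_nat _ _ (F2 := fun=> 1%N)); last first.
  move=> h h_bd; have lt_h : (hsrc h < nv N)%N.
    by apply: (@inc_lt (h.-1 %/ 2)%N); [nat_lia | apply: hsrc_inc; nat_lia].
  rewrite (bigD1 (Ordinal lt_h)) //= eqxx big1 // => v ne_v.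
  by rewrite eq_sym; move: ne_v; rewrite -val_eqE /= => /negbTE ->.
by rewrite sum_nat_const_nat; nat_lia.
Qed.

End Walks.

Arguments last_half : simpl never.

(** * Adjacency lists and degrees *)

Definition add_half g v :=
  (IPut aNext g (IGet aHead v) ;;
   IPut aHead v g ;;
   IPut aDeg v (IAdd (IGet aDeg v) (IConst 1)) ;;
   IPut aEs v (IAdd (IGet aEs v) (IVar vE)))%cmd.

Definition build :=
  For vE vM
    (add_half (IAdd (IMul (IConst 2) (IVar vE)) (IConst 1)) (IGet aEA (IVar vE)) ;;
     add_half (IAdd (IMul (IConst 2) (IVar vE)) (IConst 2)) (IGet aEB (IVar vE)))%cmd.

Section Degrees.
Variables (R : realFieldType) (N : net R).
Local Open Scope nat_scope.
Implicit Types (A : nat -> bool) (u v e k : nat).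

Definition live A e v := [&& inc N e v, A (ea N e) & A (eb N e)].
Definition deg_upto A v k := \sum_(0 <= e < k | live A e v) 1.
Definition ids_upto A v k := \sum_(0 <= e < k | live A e v) e.
Definition deg A v := deg_upto A v (ne N).
Definition ids A v := ids_upto A v (ne N).
Definition verts v := v < nv N.

Lemma deg_uptoS A v k : deg_upto A v k.+1 = deg_upto A v k + live A k v.
Proof.
by rewrite /deg_upto big_mkcond big_nat_recr //= -big_mkcond; case: (live A k v).
Qed.

Lemma ids_uptoS A v k :
  ids_upto A v k.+1 = ids_upto A v k + (if live A k v then k else 0).
Proof. by rewrite /ids_upto big_mkcond big_nat_recr //= -big_mkcond. Qed.

Lemma live_verts e v : e < ne N -> live verts e v = inc N e v.
Proof. by move=> lt_e; rewrite /live /verts ea_lt ?eb_lt ?andbT. Qed.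

Lemma ids_upto_le A v k : ids_upto A v k <= k * k.
Proof.
elim: k => [|k IH]; first by rewrite /ids_upto big_nil.
by rewrite ids_uptoS; case: ifP => _; nia.
Qed.

Lemma deg_upto_le A v k : deg_upto A v k <= k.
Proof.
elim: k => [|k IH]; first by rewrite /deg_upto big_nil.
by rewrite deg_uptoS; case: live; nat_lia.
Qed.

Lemma hsrc_odd e : hsrc N (2 * e).+1 = ea N e.
Proof. by rewrite /hsrc /= mul2n odd_double /= -mul2n mulKn. Qed.

Lemma hsrc_even e : hsrc N (2 * e).+2 = eb N e.
Proof.
by rewrite /hsrc /= mul2n odd_double /= -mul2n (_ : _ %/ _ = e) //; nat_lia.
Qed.

End Degrees.

(** [fits_nn] covers the indices of the distance table, [fits_m] the numbers of the half-edges, and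
    [fits_mm] the sums of edge numbers held in [aEs]. *)
Record fits (R : realFieldType) (N : net R) (w : nat) : Prop := Fits {
  nv_ge2 : (2 <= nv N)%N;
  fits_n : (2 * nv N < 2 ^ w)%N;
  fits_nn : (nv N * nv N < 2 ^ w)%N;
  fits_m : (2 * ne N + 2 < 2 ^ w)%N;
  fits_mm : (ne N * ne N + 2 < 2 ^ w)%N
}.

Record input (R : realFieldType) (N : net R) (st : state R) : Prop := Input {
  inp_n : ivar st vN = nv N;
  inp_m : ivar st vM = ne N;
  inp_ea : iarr st aEA = ea N;
  inp_eb : iarr st aEB = eb N;
  inp_len : rarr st rC = len N
}.

Section Build.
Variables (R : realFieldType) (N : net R) (w : nat).
Hypothesis fit : fits N w.
Implicit Types (st : state R) (Q : state R -> nat -> Prop).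
Local Open Scope nat_scope.

Lemma input_frame c st st' :
  (vN \notin ivars c) && (vM \notin ivars c) ->
  (aEA \notin iarrs c) && (aEB \notin iarrs c) -> rC \notin rarrs c ->
  frame c st st' -> input N st -> input N st'.
Proof.
move=> /andP[n0 n1] /andP[n2 n3] n4 [f1 f2 _ f4] [h0 h1 h2 h3 h4].
by split; rewrite ?f1 ?f2 ?f4.
Qed.

Record adjacency st : Prop := Adjacency {
  adj_head : forall v, iarr st aHead v = last_half N v (2 * ne N);
  adj_next : forall g, 0 < g <= 2 * ne N ->
    iarr st aNext g = last_half N (hsrc N g) g.-1
}.

Lemma wp_build st r Q :
  input N st ->
  (forall a, a \in [:: aHead; aNext; aDeg; aEs] -> forall i, iarr st a i = 0) ->
  200 * (ne N).+1 <= r ->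
  (forall st' r', frame build st st' -> adjacency st' ->
     (forall v, iarr st' aDeg v = deg N (verts N) v) ->
     (forall v, iarr st' aEs v = ids N (verts N) v) ->
     r <= r' + 200 * (ne N).+1 -> Q st' r') ->
  wp w build st r Q.
Proof.
move=> inp zero le_r HQ; have [i0 i1 i2 i3 i4] := inp; have [_ _ _ fm fmm] := fit.
apply: (wp_for (b := ne N) (I := fun e st' r' =>
  [/\ [/\ iarr st' aEA = ea N & iarr st' aEB = eb N],
      (forall v, iarr st' aHead v = last_half N v (2 * e)),
      (forall g, 0 < g <= 2 * e -> iarr st' aNext g = last_half N (hsrc N g) g.-1),
      (forall v, iarr st' aDeg v = deg_upto N (verts N) v e) /\
      (forall v, iarr st' aEs v = ids_upto N (verts N) v e) &
      r <= r' + 190 * e + 9 * ne N + 10])) => //.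
- by nat_lia.
- by nat_lia.
- move=> e st' r' lt_e Ee Em [[E2 E3] hd nx [dg es] le_r'].
  have neab := ends_neq lt_e.
  have [hbd_a hbd_b] := (last_half_le N (ea N e) (2 * e), last_half_le N (eb N e) (2 * e)).
  have [ebd_a ebd_b] := (ids_upto_le N (verts N) (ea N e) e, ids_upto_le N (verts N) (eb N e) e).
  have [dbd_a dbd_b] := (deg_upto_le N (verts N) (ea N e) e, deg_upto_le N (verts N) (eb N e) e).
  have [ha hb] := (ea_lt lt_e, eb_lt lt_e); have fn := fits_n fit.
  have mbd : e * e + 2 * e < 2 ^ w by nia.
  (* The ends differ, so the vertex cells written for the first half-edge are not those read for the
     second. *)
  have nba : (eb N e == ea N e) = false by nat_lia.
  have [h1 h2] := (hd (ea N e), hd (eb N e)).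
  have [d1 d2] := (dg (ea N e), dg (eb N e)).
  have [s1 s2] := (es (ea N e), es (eb N e)).
  do 8 (cmd_step; rewrite ?E2 ?E3 ?Ee ?(upd_neq _ _ nba); try (by nat_lia)).
  split; rewrite /set_ivar; cmd_simpl => //.
  + move=> v; rewrite (_ : 2 * e.+1 = (2 * e).+2); last by nat_lia.
    by rewrite !last_halfS hsrc_odd hsrc_even /upd hd !(eq_sym v) addn1 addn2.
  + move=> g g_bd; rewrite /upd.
    case: eqP => [->|ne2].
      by rewrite addn2 hsrc_even /= last_halfS hsrc_odd eq_sym nba.
    case: eqP => [->|ne1]; first by rewrite addn1 hsrc_odd /=.
    by apply: nx; lia.
  + split=> v; rewrite ?deg_uptoS ?ids_uptoS /upd ?dg ?es;
      rewrite live_verts // /inc !(eq_sym v) ?dg ?es;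
    have [?|?] := eqVneq (ea N e) v; have [?|?] := eqVneq (eb N e) v;
      try subst v; rewrite /= ?addn0 //; lia.
  + nat_lia.
- move=> st' r' Ee F [[E2 E3] hd nx [dg es] le_r'].
  by apply: HQ => //; nat_lia.
- split=> //.
  + by move=> v; rewrite /= zero.
  + by move=> g; nat_lia.
  + by split=> v; rewrite /= zero // /deg_upto /ids_upto big_nil.
  + by nat_lia.
Qed.
End Build.

(** * Dijkstra's algorithm *)

(** Inserting a vertex and decreasing its key are one operation, because the leaf [n + v] is
    reserved for [v]. *)
Definition push :=
  (RPut rDT (IAdd (IVar vB) (IVar vY)) (RVar xL) ;;
   IPut aSeen (IVar vY) (IConst 1) ;;
   IPut aT (IAdd (IVar vN) (IVar vY)) (IAdd (IVar vY) (IConst 1)) ;;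
   RPut rTK (IAdd (IVar vN) (IVar vY)) (RVar xL) ;;
   ISet vI (IAdd (IVar vN) (IVar vY)) ;;
   fix_up)%cmd.

Definition relax :=
  (ISet vE (IDiv (ISub (IVar vG) (IConst 1)) (IConst 2)) ;;
   ISet vY (ISub (IAdd (IGet aEA (IVar vE)) (IGet aEB (IVar vE))) (IVar vV)) ;;
   RSet xL (RAdd (RGet rDT (IAdd (IVar vB) (IVar vV))) (RGet rC (IVar vE))) ;;
   If (BAnd (BLeI (IConst 1) (IGet aSeen (IVar vY)))
         (BLeR (RGet rDT (IAdd (IVar vB) (IVar vY))) (RVar xL)))
     Skip push ;;
   ISet vG (IGet aNext (IVar vG)))%cmd.

Definition pop :=
  (ISet vV (ISub (IGet aT (IConst 1)) (IConst 1)) ;;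
   IPut aT (IAdd (IVar vN) (IVar vV)) (IConst 0) ;;
   ISet vI (IAdd (IVar vN) (IVar vV)) ;;
   fix_up)%cmd.

Definition dijkstra :=
  (ISet vB (IMul (IVar vS) (IVar vN)) ;;
   For vJ vN (IPut aSeen (IVar vJ) (IConst 0)) ;;
   ISet vL (IMul (IConst 2) (IVar vN)) ;;
   For vJ vL (IPut aT (IVar vJ) (IConst 0)) ;;
   ISet vY (IVar vS) ;;
   RSet xL RZero ;;
   push ;;
   While (BLeI (IConst 1) (IGet aT (IConst 1)))
     (pop ;;
      ISet vG (IGet aHead (IVar vV)) ;;
      While (BLeI (IConst 1) (IVar vG)) relax))%cmd.

Section Dijkstra.
Variables (R : realFieldType) (N : net R) (w lam : nat).
Hypothesis fit : fits N w.
Hypothesis lt_lam : (nv N < 2 ^ lam)%N.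
Implicit Types (st : state R) (Q : state R -> nat -> Prop).
Local Open Scope nat_scope.
Local Notation n := (nv N).

Lemma wp_push st r Q :
  ivar st vN = n -> ivar st vY < n -> ivar st vB + n < 2 ^ w ->
  tournament n (iarr st aT) (rarr st rTK) 0 -> 100 * lam + 300 <= r ->
  (forall st' r', frame push st st' ->
     tournament n (iarr st' aT) (rarr st' rTK) 0 ->
     (forall v, iarr st' aT (n + v) =
        if v == ivar st vY then (ivar st vY).+1 else iarr st aT (n + v)) ->
     (forall v, rarr st' rTK (n + v) =
        if v == ivar st vY then rvar st xL else rarr st rTK (n + v)) ->
     (forall v, iarr st' aSeen v = if v == ivar st vY then 1 else iarr st aSeen v) ->
     (forall k, rarr st' rDT k =
        if k == ivar st vB + ivar st vY then rvar st xL else rarr st rDT k) ->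
     r <= r' + 100 * lam + 300 -> Q st' r') ->
  wp w push st r Q.
Proof.
move=> En lt_y lt_B [leT ok] le_r HQ; have [n2 fn _ _ _] := fit.
apply: wp_frame; do 5 (cmd_step; rewrite ?En; try by nat_lia).
apply: (wp_fix_up n2 fn (q := lam.+1)); cmd_simpl; rewrite ?En.
- by nat_lia.
- by rewrite expnS; nat_lia.
- split=> [j lt_j|j j_bd j_par]; first by rewrite /upd; case: ifP; rewrite ?leT //; nat_lia.
  have [|c c_in [eT eK mx]] := ok j j_bd; first by nat_lia.
  have ne d : d \in [:: 2 * j; 2 * j + 1] -> (d == n + ivar st vY) = false.
    by rewrite !inE; nat_lia.
  exists c => //; rewrite /upd (ne c c_in) (_ : (j == _) = false); last by nat_lia.
  by split=> // d d_in; rewrite (ne d d_in); apply: mx.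
- by nat_lia.
- move=> st' r5 F tok fT fK le_r'; move: (F) => [fi fia frv fra] F'.
  apply: HQ => //.
  + by move=> v; rewrite fT ?leq_addr //; cmd_simpl; rewrite /upd eqn_add2l addn1.
  + by move=> v; rewrite fK ?leq_addr //; cmd_simpl; rewrite /upd eqn_add2l.
  + by move=> v; rewrite fia.
  + by move=> k; rewrite fra.
  + by nat_lia.
Qed.

Implicit Types (dn ex : nat -> bool) (row : nat -> R).

Record static s st : Prop := Static {
  st_input : input N st;
  st_adj : adjacency N st;
  st_s : ivar st vS = s;
  st_b : ivar st vB = s * n
}.

Definition lab s st v := rarr st rDT (s * n + v).
Arguments lab : simpl never.

(** [dn] is the set of settled vertices; [ex] exempts the half-edges that
    have not been relaxed yet. *)
Record dinv s (dn ex : nat -> bool) (row : nat -> R) st : Prop := Dinv {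
  di_tree : tournament n (iarr st aT) (rarr st rTK) 0;
  di_leaf : forall v, v < n -> 0 < iarr st aT (n + v) ->
    [/\ iarr st aT (n + v) = v.+1, rarr st rTK (n + v) = lab s st v &
        0 < iarr st aSeen v];
  di_dn : forall v, v < n ->
    dn v = (0 < iarr st aSeen v) && (iarr st aT (n + v) == 0);
  di_walk : forall v, v < n -> 0 < iarr st aSeen v ->
    walk N (verts N) s v (lab s st v);
  di_src : 0 < iarr st aSeen s /\ (lab s st s <= 0)%R;
  di_row : forall k, k < s * n \/ s * n + n <= k -> rarr st rDT k = row k;
  di_closed : forall h, 0 < h <= 2 * ne N -> dn (hsrc N h) -> ~~ ex h ->
    0 < iarr st aSeen (opp N (h.-1 %/ 2) (hsrc N h)) /\
    (lab s st (opp N (h.-1 %/ 2) (hsrc N h))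
       <= lab s st (hsrc N h) + len N (h.-1 %/ 2))%R;
  di_order : forall v x, v < n -> x < n -> dn v -> 0 < iarr st aT (n + x) ->
    (lab s st v <= lab s st x)%R
}.

(** The half-edges of [v] still to be relaxed when the scan stands at [g]: lists run downwards. *)
Definition pending v g h := (hsrc N h == v) && (h <= g).

Lemma hsrc_lt h : 0 < h <= 2 * ne N -> hsrc N h < n.
Proof. by move=> h_bd; apply: (@inc_lt _ N (h.-1 %/ 2)); [nat_lia | apply: hsrc_inc; nat_lia]. Qed.

Lemma wp_relax s dn v0 g row st r Q :
  s < n -> static s st -> ivar st vV = v0 -> ivar st vG = g ->
  0 < g <= 2 * ne N -> hsrc N g = v0 -> dn v0 ->
  dinv s dn (pending v0 g) row st ->
  (forall v, v < n -> dn v -> (lab s st v <= lab s st v0)%R) ->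
  100 * lam + 500 <= r ->
  (forall st' r', frame relax st st' ->
     ivar st' vG = last_half N v0 g.-1 ->
     dinv s dn (pending v0 (last_half N v0 g.-1)) row st' ->
     (forall v, v < n -> dn v -> (lab s st' v <= lab s st' v0)%R) ->
     r <= r' + 100 * lam + 500 -> Q st' r') ->
  wp w relax st r Q.
Proof.
move=> lt_s [inp adj Es Eb] Ev Eg g_bd src_g dn0 inv le0 le_r HQ.
have [n2 fn fnn fm _] := fit; have [i0 i1 i2 i3 i4] := inp.
have [tree leaf dnE wk [src0 src1] rowE cl ord] := inv.
have lt_v0 : v0 < n by rewrite -src_g hsrc_lt.
set e := g.-1 %/ 2; set y := opp N e v0.
have lt_e : e < ne N by rewrite /e; nat_lia.
have inc_e : inc N e v0 by rewrite -src_g hsrc_inc //; nat_lia.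
have lt_y : y < n by apply: (@inc_lt _ N e) => //; apply: inc_opp.
have neq_y : y <> v0 by apply: opp_neq.
have sn : s * n + n <= n * n by nia.
apply: wp_frame; cmd_step; rewrite ?Eg; try by nat_lia.
rewrite (_ : (g - 1) %/ 2 = e); last by rewrite subn1.
cmd_step; rewrite ?i2 ?i3 ?Ev -/(opp N e v0) -/y; try by nat_lia.
cmd_step; rewrite ?i4 ?Eb ?Ev.
set nd := (_ + _)%R.
(* No half-edge of [v0] lies strictly between [g] and its successor in the list, so advancing the
   pointer releases [g] alone. *)
have pend h : 0 < h <= 2 * ne N -> ~~ pending v0 (last_half N v0 g.-1) h ->
    ~~ pending v0 g h \/ h = g.
  move=> h_bd; rewrite /pending; have [src_h|//] := eqVneq (hsrc N h) v0; last by left.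
  have [?|ne_h] := eqVneq h g; first by right.
  by move=> lt_h; left; have := @last_half_max _ N v0 g.-1 h; lia.
have nextE : iarr st aNext g = last_half N v0 g.-1.
  by rewrite (adj_next adj) ?src_g.
have lt_next := last_half_le N v0 g.-1.
cmd_seq; apply: wp_if.
- by cmd_simpl; nat_lia.
- cmd_simpl; rewrite Eb => /andP[seen_y le_y] r3 Er3.
  cmd_step.
  cmd_step; rewrite ?Eg ?nextE; try by nat_lia.
  move=> F; apply: HQ => //; last by nat_lia.
  split=> // h h_bd dn_h /(pend h h_bd)[|Eh]; first exact: cl.
  by rewrite Eh src_g.
- cmd_simpl; rewrite Eb => cond r3 Er3.
  have {}cond : 0 < iarr st aSeen y -> (nd < lab s st y)%R.
    by move=> seen_y; move: cond; rewrite seen_y /= -ltNge.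
  (* A settled vertex has a label at most that of [v0], and costs are nonnegative, so it cannot be
     strictly improved. Hence no vertex is settled twice. *)
  have ndn_y : ~~ dn y.
    apply/negP => dn_y; have := dn_y; rewrite dnE // => /andP[/cond lt_nd _].
    have := le0 y lt_y dn_y; have := len_ge0 lt_e; rewrite /nd -/(lab s st v0).
    by move: lt_nd; rewrite /nd -/(lab s st v0); lra.
  apply: wp_push; cmd_simpl; rewrite ?Eb //; try by nat_lia.
  move=> st3 r4 F3 tree' T' K' seen' D' le_r4.
  have [f3i f3a _ _] := F3.
  cmd_step; rewrite f3i // f3a //; cmd_simpl; rewrite Eg nextE; try by nat_lia.
  set st4 := State _ _ _ _; move=> F.
  have labE v : lab s st4 v = if v == y then nd else lab s st v.
    by rewrite /lab /= D' eqn_add2l.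
  have dn_neq v : dn v -> (v == y) = false.
    by move=> dn_v; apply/eqP => E; rewrite -E dn_v in ndn_y.
  have dn_nd v : v < n -> dn v -> (lab s st v <= nd)%R.
    move=> lt_v dn_v; have := le0 v lt_v dn_v; have := len_ge0 lt_e.
    by rewrite /nd -/(lab s st v0); lra.
  apply: HQ => //; last by nat_lia.
  + split.
    * by [].
    * move=> v lt_v; rewrite /= T' K' seen' labE; case: eqP => [->|_] //.
      by move=> /leaf H; apply: H.
    * move=> v lt_v; rewrite /= T' seen'; case: eqP => [->|_]; last exact: dnE.
      exact: negbTE.
    * move=> v lt_v; rewrite /= seen' labE; case: eqP => [-> _|_ seen_v].
        apply: walk_rcons => //; apply: wk => //.
        by have := dn0; rewrite dnE // => /andP[].
      exact: wk.
    * rewrite /= seen' labE; case: eqP => [Es'|_] //.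
      by split=> //; apply: le_trans src1; move: cond; rewrite -Es' => /(_ src0)/ltW.
    * by move=> k k_out; rewrite /= D' (_ : (k == _) = false) ?rowE //; nat_lia.
    * move=> h h_bd dn_h /(pend h h_bd) ex_h.
      rewrite !labE (dn_neq _ dn_h) /= seen'.
      case: ex_h => [ex_h|->]; last by rewrite src_g -/e -/y eqxx.
      have [seen_o le_o] := cl h h_bd dn_h ex_h.
      case: eqP => [Ey|//]; split=> //; apply: le_trans le_o.
      by move: cond; rewrite -Ey => /(_ seen_o)/ltW.
    * move=> v x lt_v lt_x dn_v; rewrite /= T' !labE (dn_neq _ dn_v).
      by case: eqP => [_ _|_]; [apply: dn_nd | apply: ord].
  + by move=> v lt_v dn_v; rewrite !labE !dn_neq //; apply: le0.
Qed.
Lemma wp_scan s dn v0 row st r Q :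
  s < n -> static s st -> ivar st vV = v0 -> v0 < n -> dn v0 ->
  ivar st vG = last_half N v0 (2 * ne N) ->
  dinv s dn (pending v0 (last_half N v0 (2 * ne N))) row st ->
  (forall v, v < n -> dn v -> (lab s st v <= lab s st v0)%R) ->
  (100 * lam + 510) * (nhalf N v0 (2 * ne N)).+1 <= r ->
  (forall st' r', static s st' -> dinv s dn (fun=> false) row st' ->
     r <= r' + (100 * lam + 510) * (nhalf N v0 (2 * ne N)).+1 -> Q st' r') ->
  wp w (While (BLeI (IConst 1) (IVar vG)) relax) st r Q.
Proof.
move=> lt_s sta Ev lt_v0 dn0 Eg inv le0 le_r HQ; set W := 100 * lam + 510 in le_r HQ.
apply: (wp_while (I := fun st' r' => [/\ static s st', ivar st' vV = v0,
  (forall v, v < n -> dn v -> (lab s st' v <= lab s st' v0)%R) &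
  exists G, [/\ G <= 2 * ne N, ivar st' vG = last_half N v0 G,
    dinv s dn (pending v0 (last_half N v0 G)) row st' &
    r + W * (nhalf N v0 G).+1 <= r' + W * (nhalf N v0 (2 * ne N)).+1]])).
- by move=> st' r' [_ _ _ [G [_ _ _]]] /=; nia.
- move=> st' r1 r2 [sta' Ev' le0' [G [le_G Eg' inv' le_r']]] /=.
  rewrite Eg' => g_gt0 Er; apply: wp_frame.
  have := nhalf_last g_gt0; have := last_half_src g_gt0.
  have := last_half_le N v0 G; set g := last_half N v0 G in g_gt0 inv' Eg' *.
  move=> le_gG src_g nh.
  apply: (wp_relax (dn := dn) (g := g) lt_s sta' Ev' Eg' _ src_g dn0 inv') => //.
  + by nat_lia.
  + by nia.
  move=> st2 r3 F Eg2 inv2 le2 le_r3 _; split=> //.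
  + have [fi fa _ fr] := F; case: sta' => inp adj Es Eb.
    split; [exact: (input_frame _ _ _ F) | | by rewrite fi | by rewrite fi].
    by split=> *; rewrite fa //; case: adj => H1 H2; rewrite ?H1 ?H2.
  + by case: F => [fi _ _ _]; rewrite fi.
  + exists g.-1; split=> //; first by nat_lia.
    by rewrite nh in le_r'; nia.
- move=> st' r1 r2 [sta' Ev' le0' [G [le_G Eg' inv' le_r']]] /=.
  rewrite Eg' -leqNgt leqn0 => /eqP G0 Er.
  apply: HQ => //; last by nia.
  case: inv' => H1 H2 H3 H4 H5 H6 cl H8; split=> // h h_bd dn_h _.
  by apply: cl => //; rewrite /pending G0; nat_lia.
- by split=> //; exists (2 * ne N).
Qed.
Lemma static_frame c s st st' :
  frame c st st' -> static s st ->
  all [predC mem (ivars c)] [:: vN; vM; vS; vB] ->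
  all [predC mem (iarrs c)] [:: aEA; aEB; aHead; aNext] -> rC \notin rarrs c ->
  static s st'.
Proof.
move=> F [inp [hd nx] Es Eb].
move=> /= /and5P[c0 c1 c2 c3 _] /and5P[c4 c5 c6 c7 _] c8.
have [fi fa _ fr] := F; split; last by rewrite fi.
- by apply: (input_frame _ _ _ F) => //; rewrite ?c0 ?c1 ?c4 ?c5.
- by split=> *; rewrite fa // ?hd ?nx.
- by rewrite fi.
Qed.

Lemma wp_pop s dn row st r Q :
  s < n -> static s st -> dinv s dn (fun=> false) row st -> 0 < iarr st aT 1 ->
  100 * lam + 400 <= r ->
  (forall v0 st' r', static s st' -> v0 < n -> ~~ dn v0 -> ivar st' vV = v0 ->
     dinv s (fun v => dn v || (v == v0)) (pending v0 (last_half N v0 (2 * ne N)))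
       row st' ->
     (forall v, v < n -> dn v || (v == v0) -> (lab s st' v <= lab s st' v0)%R) ->
     r <= r' + 100 * lam + 400 -> Q st' r') ->
  wp w pop st r Q.
Proof.
move=> lt_s sta inv T1 le_r HQ; have [inp adj Es Eb] := sta.
have [n2 fn fnn fm _] := fit; have [i0 i1 i2 i3 i4] := inp.
have [tree leaf dnE wk [src0 src1] rowE cl ord] := inv.
have [|i i_bd [eT eK]] := tournament_leaf tree (_ : 0 < 1 < 2 * n); first by nat_lia.
pose v := i - n; have Ei : i = n + v by rewrite /v; nat_lia.
have lt_v : v < n by nat_lia.
have Tv : 0 < iarr st aT (n + v) by rewrite -Ei -eT.
have [Tv' Kv seen_v] := leaf v lt_v Tv.
have Ev : iarr st aT 1 = v.+1 by rewrite eT Ei.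
have min_v x : x < n -> 0 < iarr st aT (n + x) -> (lab s st v <= lab s st x)%R.
  move=> lt_x Tx; have [_ Kx _] := leaf x lt_x Tx; rewrite -Kv -Kx -Ei -eK -?eT //.
  by apply: (tournament_le tree _ Tx).2; nat_lia.
apply: wp_frame; cmd_step.
rewrite Ev subn1; do 2 (cmd_step; rewrite ?i0; try by nat_lia).
apply: (wp_fix_up n2 fn (q := lam.+1)); cmd_simpl; rewrite ?i0.
- by nat_lia.
- by rewrite expnS; nat_lia.
- have [leT ok] := tree.
  split=> [j lt_j|j j_bd j_par]; first by rewrite /upd; case: ifP; rewrite ?leT.
  have [|c c_in [eT' eK' mx]] := ok j j_bd; first by nat_lia.
  have ne d : d \in [:: 2 * j; 2 * j + 1] -> (d == n + v) = false.
    by rewrite !inE; nat_lia.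
  exists c => //; rewrite /upd (ne c c_in) (_ : (j == _) = false); last by nat_lia.
  by split=> // d d_in; rewrite (ne d d_in); apply: mx.
- by nat_lia.
move=> st' r' F' tree' fT fK le_r' F.
have [fi fa _ fr] := F'.
have labE x : lab s st' x = lab s st x by rewrite /lab fr.
have TE x : iarr st' aT (n + x) = if x == v then 0 else iarr st aT (n + x).
  by rewrite fT ?leq_addr //; cmd_simpl; rewrite /upd eqn_add2l.
have ndn_v : ~~ dn v by rewrite dnE // seen_v Tv'.
apply: (HQ v) => //; last by nat_lia.
- exact: (static_frame F).
- by rewrite fi.
- split=> //.
  + move=> x lt_x; rewrite TE; case: eqP => // _ Tx.
    by have [? Kx ?] := leaf x lt_x Tx; rewrite fK ?leq_addr // labE fa.
  + move=> x lt_x; rewrite fa // TE dnE //; cmd_simpl.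
    have [->|_] := eqVneq x v.
      by rewrite orbT seen_v.
    by rewrite orbF.
  + by move=> x lt_x; rewrite fa // labE; apply: wk.
  + by rewrite fa // labE.
  + by move=> k /rowE <-; rewrite fr.
  + move=> h h_bd /orP[dn_h|/eqP src_h].
      by move=> _; rewrite fa // !labE; apply: cl.
    rewrite /pending src_h eqxx -ltnNge /= => lt_h.
    by case: (@last_half_max _ N v (2 * ne N) h) => //; nat_lia.
  + move=> x y lt_x lt_y dn_x; rewrite TE !labE; case: eqP => // _ Ty.
    by case/orP: dn_x => [dn_x|/eqP->]; [apply: ord | apply: min_v].
- move=> x lt_x; rewrite !labE => /orP[dn_x|/eqP-> //].
  exact: ord.
Qed.
(** Each unsettled vertex holds the price of its extraction, of its whole list, and of the failing
    test that ends the list. *)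
Definition pot (dn : nat -> bool) :=
  \sum_(v < n | ~~ dn v) (100 * lam + 510) * (nhalf N v (2 * ne N)).+2.

Lemma pot_settle dn v0 : v0 < n -> ~~ dn v0 ->
  pot dn = (100 * lam + 510) * (nhalf N v0 (2 * ne N)).+2
             + pot (fun v => dn v || (v == v0)).
Proof.
move=> lt_v ndn; rewrite /pot (bigD1 (Ordinal lt_v)) //=; congr (_ + _).
by apply: eq_bigl => v; rewrite negb_or -val_eqE.
Qed.

Lemma pot0 : pot (fun=> false) = (100 * lam + 510) * (2 * n + 2 * ne N).
Proof.
rewrite /pot -big_distrr /=; congr (_ * _).
rewrite -[in RHS](sum_nhalf N) [2 * n]mulnC -[X in X * 2]card_ord -sum_nat_const.
by rewrite -big_split /=; apply: eq_bigr => v _; rewrite add2n.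
Qed.

Record distances s st : Prop := Distances {
  dist_unreached : forall v, v < n -> iarr st aSeen v = 0 ->
    forall c, ~ walk N (verts N) s v c;
  dist_walk : forall v, v < n -> 0 < iarr st aSeen v ->
    walk N (verts N) s v (lab s st v);
  dist_min : forall v c, walk N (verts N) s v c -> (lab s st v <= c)%R
}.

(** With an empty queue every vertex seen is settled and no half-edge is exempt, so a label grows
    across an edge by at most its length. Adding this up along a walk yields reachability and
    minimality together. *)
Lemma dinv_distances s dn row st :
  s < n -> dinv s dn (fun=> false) row st -> iarr st aT 1 = 0 -> distances s st.
Proof.
move=> lt_s [tree leaf dnE wk [src0 src1] _ cl _] T1.
have {}dnE v : v < n -> dn v = (0 < iarr st aSeen v).
  move=> lt_v; rewrite dnE // (_ : _ == 0) ?andbT //; apply/negbNE.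
  rewrite -lt0n; apply/negP => Tv.
  by case: (tournament_le tree _ Tv); rewrite ?T1 //; nat_lia.
have reach u v c : walk N (verts N) u v c -> dn u ->
    dn v /\ (lab s st v <= lab s st u + c)%R.
  elim=> {u v c} [u _ dn_u|u e v c Au lt_e inc_e H IH dn_u].
    by rewrite addr0.
  have [g g_bd [src_g Eg]] := inc_hsrc lt_e inc_e.
  have := cl g g_bd; rewrite src_g Eg => /(_ dn_u isT) [seen_o le_o].
  have [|dn_v le_v] := IH; first by rewrite dnE //; case: (walk_ends H).
  by split=> //; lra.
have dn_s : dn s by rewrite dnE.
split=> // [v lt_v seen_v c|v c] /reach /(_ dn_s) [dn_v le_v]; last by lra.
by rewrite dnE // seen_v in dn_v.
Qed.

Lemma wp_settle s row st r Q :
  s < n -> static s st -> dinv s (fun=> false) (fun=> false) row st ->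
  (100 * lam + 510) * (2 * n + 2 * ne N).+1 + 10 <= r ->
  (forall st' r', static s st' -> distances s st' ->
     (forall k, k < s * n \/ s * n + n <= k -> rarr st' rDT k = row k) ->
     r <= r' + (100 * lam + 510) * (2 * n + 2 * ne N).+1 + 10 -> Q st' r') ->
  wp w (While (BLeI (IConst 1) (IGet aT (IConst 1)))
     (pop ;; ISet vG (IGet aHead (IVar vV)) ;;
      While (BLeI (IConst 1) (IVar vG)) relax))%cmd st r Q.
Proof.
move=> lt_s sta inv le_r HQ.
apply: (wp_while (I := fun st' r' => static s st' /\
  exists dn, dinv s dn (fun=> false) row st' /\
   r + pot dn <= r' + (100 * lam + 510) * (2 * n + 2 * ne N))).
- by move=> st' r' [_ [dn [_ ?]]] /=; nat_lia.
- move=> st' r1 r2 [sta' [dn [inv' le_r']]] /= T1 Er.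
  apply: wp_seq; apply: (wp_pop lt_s sta' inv' T1); first by nat_lia.
  move=> v0 st2 r3 sta2 lt_v0 ndn Ev inv2 le2 le_r3.
  rewrite (pot_settle lt_v0 ndn) in le_r'.
  have [inp [hd nx] Es Eb] := sta2; have [n2 fn fnn fm _] := fit.
  have := last_half_le N v0 (2 * ne N) => le_m.
  cmd_step; rewrite ?Ev ?hd; try by nia.
  apply: (wp_scan (dn := fun v => dn v || (v == v0)) (v0 := v0) (row := row) lt_s) => //.
  + by case: inp; split; [split | split | |].
  + by rewrite eqxx orbT.
  + by case: inv2.
  + by nia.
  move=> st4 r4 sta4 inv4 le_r4; split=> //.
  by exists (fun v => dn v || (v == v0)); split=> //; nia.
- move=> st' r1 r2 [sta' [dn [inv' le_r']]] /=.
  rewrite -leqNgt leqn0 => /eqP T1 Er.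
  apply: HQ => //; [exact: dinv_distances inv' T1 | exact: di_row inv' | nat_lia].
- by split=> //; exists (fun=> false); split=> //; rewrite pot0.
Qed.

Lemma wp_dijkstra s st r Q :
  s < n -> input N st -> adjacency N st -> ivar st vS = s ->
  (100 * lam + 600) * (2 * n + 2 * ne N + 4) + 100 * n <= r ->
  (forall st' r', frame dijkstra st st' -> distances s st' -> ivar st' vB = s * n ->
     (forall k, k < s * n \/ s * n + n <= k -> rarr st' rDT k = rarr st rDT k) ->
     r <= r' + (100 * lam + 600) * (2 * n + 2 * ne N + 4) + 100 * n -> Q st' r') ->
  wp w dijkstra st r Q.
Proof.
move=> lt_s inp adj Es le_r HQ; have [n2 fn fnn fm _] := fit.
have [i0 i1 i2 i3 i4] := inp.
have sn : s * n + n <= n * n by nia.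
have C_ge : (100 * lam + 510) * (2 * n + 2 * ne N).+1 + 100 * lam + 400 + 500 <=
    (100 * lam + 600) * (2 * n + 2 * ne N + 4) by nia.
set C := _ * (_ + 4) in C_ge le_r HQ.
set D := _ * _.+1 in C_ge.
apply: wp_frame; cmd_step; rewrite Es i0; try by nat_lia.
set st1 := State _ _ _ _.
have sta1 : static s st1.
  by case: adj => h1 h2; split; [split | split | |].
apply: wp_seq; apply: (wp_for (b := n) (I := fun i st' r' =>
  (forall v, v < i -> iarr st' aSeen v = 0) /\ rc <= r' + 3 * i + (9 * n + 7))) => //.
- by nat_lia.
- by nat_lia.
- move=> i st' r' lt_i Ei En [seen0 le_r']; cmd_step; rewrite Ei; try by nat_lia.
  split; last by rewrite /set_ivar; nat_lia.
  move=> v lt_v; rewrite /set_ivar; cmd_simpl; rewrite /upd.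
  by case: eqP => // ne_v; apply: seen0; lia.
- move=> st2 r2 Ej F2 [seen0 le_r2].
  have sta2 := static_frame F2 sta1 isT isT isT.
  have [fi2 fa2 fv2 fr2] := F2.
  have E2 := inp_n (st_input sta2).
  cmd_step; rewrite ?E2; try by nat_lia.
  set st3 := State _ _ _ _.
  have sta3 : static s st3.
    by case: sta2 => [[? ? ? ? ?] [? ?] ? ?]; split; [split | split | |].
  apply: wp_seq; apply: (wp_for (b := 2 * n) (I := fun i st' r' =>
    (forall v, v < i -> iarr st' aT v = 0) /\
    rc0 <= r' + 3 * i + (18 * n + 7))) => //; try by nat_lia.
  + move=> i st' r' lt_i Ei En [T0 le_r']; cmd_step; rewrite Ei; try by nat_lia.
    split; last by rewrite /set_ivar; nat_lia.
    move=> v lt_v; rewrite /set_ivar; cmd_simpl; rewrite /upd.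
    by case: eqP => // ne_v; apply: T0; lia.
  move=> st4 r4 Ej4 F4 [T0 le_r4].
  have sta4 := static_frame F4 sta3 isT isT isT.
  have [inp4 adj4 Es4 Eb4] := sta4; have [fi4 fa4 _ fr4] := F4.
  cmd_step; rewrite ?Es4; try by nat_lia.
  cmd_step.
  have T_0 v : v < n -> iarr st4 aT (n + v) = 0 by move=> lt_v; rewrite T0 //; nat_lia.
  have seen_0 v : v < n -> iarr st4 aSeen v = 0.
    by move=> lt_v; rewrite fa4 //= seen0.
  apply: wp_seq; apply: wp_push; cmd_simpl; rewrite ?Eb4 ?(inp_n inp4) //; try by nat_lia.
    split=> [j lt_j|j j_bd _]; first by rewrite T0.
    exists (2 * j); first by rewrite inE eqxx.
    split=> [||d]; try by rewrite !T0 //; nat_lia.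
    by rewrite !inE => d_bd; rewrite T0 //; nat_lia.
  move=> st5 r5 F5 tree T5 K5 seen5 DT5 le_r5.
  have sta5 : static s st5.
    apply: (static_frame F5) => //.
    by case: sta4 => [[? ? ? ? ?] [? ?] ? ?]; split; [split | split | |].
  have labE : lab s st5 s = 0%R by rewrite /lab DT5 eqxx.
  apply: (wp_settle (row := rarr st rDT) lt_s sta5); last 2 first.
  - by rewrite -/D; nat_lia.
  - move=> st6 r6 sta6 dist6 row6 le_r6 F.
    by apply: HQ => //; [exact: st_b sta6 | move: le_r6; rewrite -/D; nat_lia].
  split=> //.
  - move=> v lt_v; rewrite T5 K5 seen5 /lab DT5 eqn_add2l.
    by have [->|_] := eqVneq v s; rewrite /= ?T_0.
  - move=> v lt_v; rewrite T5 seen5.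
    by case: (eqVneq v s) => _; rewrite /= ?seen_0.
  - move=> v lt_v; rewrite seen5.
    have [->|_] := eqVneq v s; last by rewrite seen_0.
    by rewrite labE => _; apply: walk_nil.
  - by rewrite seen5 eqxx labE.
  - move=> k k_out; rewrite DT5 (_ : (k == _) = false); last by nat_lia.
    by rewrite fr4 //= fr2.
+ by split; [| nat_lia].
+ by split; [| nat_lia].
Qed.

End Dijkstra.

(** * Pruning the leaves *)

Definition maximize x e := If (BLeR e (RVar x)) Skip (RSet x e).

Lemma wp_maximize (R : realFieldType) (w : nat) x e (st : state R) r Q :
  (2 * rsize e + 10 <= r)%N ->
  (forall rv r', rv x = Num.max (rvar st x) (reval st e) ->
     (forall y, y != x -> rv y = rvar st y) -> (r <= r' + (2 * rsize e + 10))%N ->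
     Q (State (ivar st) (iarr st) rv (rarr st)) r') ->
  wp w (maximize x e) st r Q.
Proof.
move=> le_r HQ; apply: wp_if => [|/= le_e r1 Er|/= nle_e r1 Er]; first by rewrite /=; nat_lia.
  apply: wp_skip => [|r2 Er2]; first by nat_lia.
  by case: st le_e HQ => iv ia rv ra /= le_e HQ; apply: HQ; [rewrite max_l | | nat_lia].
apply: wp_rset => [|r2 Er2]; first by nat_lia.
apply: HQ; last by nat_lia.
  by rewrite upd_same max_r // ltW // ltNge.
by move=> y ne_y; rewrite upd_neq // (negbTE ne_y).
Qed.

Definition leaf_test :=
  BAnd (BLeI (IConst 1) (IGet aDeg (IVar vW)))
    (BLeI (IGet aDeg (IVar vW)) (IConst 1)).

(** At degree 1 the sum in [aEs] is the number of the only edge left. The candidate for the diameter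
    uses the depth of the neighbour before it is raised, so that the two halves of the path lie in
    different branches. *)
Definition prune_leaf :=
  (ISet vE (IGet aEs (IVar vW)) ;;
   ISet vY (ISub (IAdd (IGet aEA (IVar vE)) (IGet aEB (IVar vE))) (IVar vW)) ;;
   RSet xL (RAdd (RGet rH (IVar vW)) (RGet rC (IVar vE))) ;;
   maximize xD (RAdd (RGet rH (IVar vY)) (RVar xL)) ;;
   RSet xM (RGet rH (IVar vY)) ;;
   maximize xM (RVar xL) ;;
   RPut rH (IVar vY) (RVar xM) ;;
   IPut aDead (IVar vW) (IConst 1) ;;
   IPut aDeg (IVar vW) (IConst 0) ;;
   IPut aDeg (IVar vY) (ISub (IGet aDeg (IVar vY)) (IConst 1)) ;;
   IPut aEs (IVar vY) (ISub (IGet aEs (IVar vY)) (IVar vE)) ;;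
   ISet vW (IVar vY))%cmd.

(** Only the neighbour of a removed leaf can become a new leaf; following it in [vW] replaces a
    queue, and one pass over the vertices suffices. *)
Definition prune :=
  For vU vN (ISet vW (IVar vU) ;; While leaf_test prune_leaf)%cmd.

(** * The metric of the net, its cores, and the removal of a leaf *)

Section Metric.
Variables (R : realFieldType) (N : net R) (d : nat -> nat -> R).
Implicit Types (A : nat -> bool) (u v e : nat) (c x : R).
Local Notation n := (nv N).
Local Notation m := (ne N).

Record metric : Prop := Metric {
  metric_walk : forall u v, (u < n)%N -> (v < n)%N -> walk N (verts N) u v (d u v);
  metric_le : forall u v c, walk N (verts N) u v c -> d u v <= c
}.
Hypothesis dM : metric.

Lemma metric_ge0 u v : (u < n)%N -> (v < n)%N -> 0 <= d u v.
Proof. by move=> lt_u lt_v; apply: walk_ge0 (metric_walk dM lt_u lt_v). Qed.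

Lemma metricxx u : (u < n)%N -> d u u = 0.
Proof.
move=> lt_u; apply/eqP; rewrite eq_le metric_ge0 // andbT.
by apply: (metric_le dM); apply: walk_nil.
Qed.

Lemma metric_sym u v : (u < n)%N -> (v < n)%N -> d u v = d v u.
Proof.
move=> lt_u lt_v; apply/eqP; rewrite eq_le.
by rewrite !(metric_le dM) //; apply: walk_sym; apply: (metric_walk dM).
Qed.

Lemma metric_triangle u v w : (u < n)%N -> (v < n)%N -> (w < n)%N ->
  d u w <= d u v + d v w.
Proof.
move=> lt_u lt_v lt_w; apply: (metric_le dM).
by apply: (walk_cat (metric_walk dM lt_u lt_v)); apply: (metric_walk dM).
Qed.

(** [d] stays the metric of the whole net however much is pruned; a core qualifies when its own
    walks realise it. In particular the core is connected. *)
Definition geodesic A :=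
  (forall v, A v -> (v < n)%N) /\
  (forall u v, A u -> A v -> exists2 c, walk N A u v c & c <= d u v).

Definition live_edges A v := [seq e <- iota 0 m | live N A e v].

Lemma degE A v : deg N A v = size (live_edges A v).
Proof. by rewrite /deg /deg_upto /index_iota subn0 sum1_count size_filter. Qed.

Lemma idsE A v : ids N A v = sumn (live_edges A v).
Proof. by rewrite /ids /ids_upto sumnE big_filter /index_iota subn0. Qed.

Lemma mem_live_edges A v e :
  (e \in live_edges A v) = ((e < m)%N && live N A e v).
Proof. by rewrite mem_filter mem_iota andbC. Qed.

Lemma live_opp A e v : live N A e v -> [/\ inc N e v, A v & A (opp N e v)].
Proof.
move=> /and3P[inc_e Aa Ab]; split=> //.
  by case/orP: (inc_e) => /eqP<-.
by case/orP: (inc_opp inc_e) => /eqP<-.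
Qed.

Lemma live_intro A e v : inc N e v -> A v -> A (opp N e v) -> live N A e v.
Proof.
move=> inc_e Av Ao; rewrite /live inc_e /=; apply/andP.
have ha : inc N e (ea N e) by rewrite /inc eqxx.
have hb : inc N e (eb N e) by rewrite /inc eqxx orbT.
by case: (inc_eq inc_e ha) => [|->]; case: (inc_eq inc_e hb) => [|->] //; 
  move=> <- // <-.
Qed.

Lemma deg1P A v : deg N A v = 1%N ->
  [/\ (ids N A v < m)%N, live N A (ids N A v) v &
      forall e, (e < m)%N -> live N A e v -> e = ids N A v].
Proof.
rewrite degE idsE; have mem := mem_live_edges A v.
case: (live_edges A v) mem => [|e [|]] //= mem _; rewrite addn0.
have := mem e; rewrite mem_head => /esym/andP[? ?]; split=> // e' lt_e' live_e'.
by have := mem e'; rewrite lt_e' live_e' inE => /eqP.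
Qed.

Lemma deg2P A v e : deg N A v = 2%N -> (e < m)%N -> live N A e v ->
  let f := (ids N A v - e)%N in
  [/\ f <> e, (f < m)%N, live N A f v &
      forall g, (g < m)%N -> live N A g v -> g = e \/ g = f].
Proof.
rewrite degE idsE => + lt_e live_e; have mem := mem_live_edges A v.
have : uniq (live_edges A v) by rewrite filter_uniq ?iota_uniq.
case: (live_edges A v) mem => [|a [|b [|]]] //= mem; rewrite inE andbT => neq_ab _.
have := mem e; rewrite lt_e live_e !inE => e_ab.
have := mem a; rewrite mem_head => /esym/andP[lt_a live_a].
have := mem b; rewrite !inE eqxx orbT => /esym/andP[lt_b live_b].
have [|] : e = a /\ (a + (b + 0) - e = b)%N \/ e = b /\ (a + (b + 0) - e = a)%N.
- by nat_lia.
- move=> [-> ->]; split=> // [|g lt_g live_g]; first by nat_lia.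
  by have := mem g; rewrite lt_g live_g !inE => /orP[]/eqP->; [left | right].
- move=> [-> ->]; split=> // [|g lt_g live_g]; first by nat_lia.
  by have := mem g; rewrite lt_g live_g !inE => /orP[]/eqP->; [right | left].
Qed.

Definition nalive A := (\sum_(0 <= v < n | A v) 1)%N.
Definition nlive A := (\sum_(0 <= e < m | A (ea N e) && A (eb N e)) 1)%N.

Lemma sum_remove (P P' : pred nat) (F : nat -> nat) (k i : nat) :
  (i < k)%N -> P i -> (forall j, (j < k)%N -> P' j = P j && (j != i)) ->
  (\sum_(0 <= j < k | P j) F j = F i + \sum_(0 <= j < k | P' j) F j)%N.
Proof.
move=> lt_i Pi P'E; rewrite big_mkcond (bigD1_seq i) /= ?iota_uniq ?mem_index_iota //.
rewrite Pi; congr (_ + _)%N; rewrite -big_mkcondr /=.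
rewrite big_nat_cond [RHS]big_nat_cond; apply: eq_bigl => j.
by case: (ltnP j k) => //= /P'E ->; rewrite andbC.
Qed.

Section RemoveLeaf.
Variables (A : nat -> bool) (l : nat).
Hypothesis deg_l : deg N A l = 1%N.
Local Notation e := (ids N A l).
Local Notation p := (opp N (ids N A l) l).
Definition remove v := A v && (v != l).

Lemma leaf_lt : (e < m)%N. Proof. by case: (deg1P deg_l). Qed.

Lemma leaf_inc : [/\ inc N e l, A l, A p & p <> l].
Proof.
have [lt_e live_e _] := deg1P deg_l; have [? ? ?] := live_opp live_e.
by split=> //; apply: opp_neq.
Qed.

Lemma leaf_edge f : (f < m)%N -> inc N f l -> A (opp N f l) -> f = e.
Proof.
move=> lt_f inc_f Ao; have [_ Al _ _] := leaf_inc.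
by have [_ _ eq_e] := deg1P deg_l; apply: eq_e => //; apply: live_intro.
Qed.

Lemma live_remove f v : v != l -> (f < m)%N ->
  live N remove f v = live N A f v && (f != e).
Proof.
move=> neq_v lt_f; have [inc_e Al Ap neq_p] := leaf_inc.
apply/idP/andP => [live_f|[live_f neq_f]].
  have /and3P[inc_f /andP[Aa na] /andP[Ab nb]] := live_f.
  split; first by apply/and3P.
  by apply/eqP => E; move: inc_e; rewrite -E /inc (negbTE na) (negbTE nb).
have [inc_f Av Ao] := live_opp live_f.
apply: live_intro => //; rewrite /remove ?Av ?Ao //=.
apply/eqP => E; case/eqP: neq_f; apply: leaf_edge => //.
  by rewrite -E inc_opp.
by rewrite -E oppK.
Qed.

Lemma live_leaf v : v != l -> live N A e v = (v == p).
Proof.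
move=> neq_v; have [inc_e Al Ap neq_p] := leaf_inc.
apply/idP/eqP => [/live_opp[inc_v _ _]|->].
  by case: (inc_eq inc_e inc_v) => // E; rewrite E eqxx in neq_v.
by apply: live_intro; rewrite ?inc_opp ?oppK.
Qed.

Lemma deg_remove v : v != l -> deg N A v = (deg N remove v + (v == p))%N.
Proof.
move=> neq_v; rewrite /deg /deg_upto -(live_leaf neq_v) addnC.
have lt_e := leaf_lt; have [live_e|nlive_e] := boolP (live N A e v).
  by apply: (sum_remove (fun=> 1%N) lt_e) => // f; apply: live_remove.
rewrite big_nat_cond [in RHS]big_nat_cond; apply: eq_bigl => f /=.
case: (ltnP f m) => //= lt_f; rewrite live_remove //.
by case: eqP => [->|_]; rewrite ?andbT // (negbTE nlive_e).
Qed.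

Lemma ids_remove v : v != l -> ids N A v = (ids N remove v + (if v == p then e else 0))%N.
Proof.
move=> neq_v; rewrite {1 2}/ids /ids_upto -(live_leaf neq_v) addnC.
have lt_e := leaf_lt; have [live_e|nlive_e] := boolP (live N A e v).
  by apply: (sum_remove (fun i => i) lt_e) => // f; apply: live_remove.
rewrite big_nat_cond [in RHS]big_nat_cond; apply: eq_bigl => f /=.
case: (ltnP f m) => //= lt_f; rewrite live_remove //.
by case: eqP => [->|_]; rewrite ?andbT // (negbTE nlive_e).
Qed.

Lemma deg_dead B v : ~~ B v -> deg N B v = 0%N.
Proof.
move=> nB; rewrite /deg /deg_upto big1 // => f live_f.
by case: (live_opp live_f) => _ Bv; rewrite Bv in nB.
Qed.

Lemma nalive_remove : (l < n)%N -> nalive A = (nalive remove).+1.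
Proof.
by move=> lt_l; rewrite -add1n; apply: (sum_remove (fun=> 1%N) lt_l); case: leaf_inc.
Qed.

Lemma nlive_remove : nlive A = (nlive remove).+1.
Proof.
have [inc_e Al Ap neq_p] := leaf_inc.
rewrite -add1n; apply: (sum_remove (fun=> 1%N) leaf_lt).
  by have [_ /and3P[_ -> ->]] := deg1P deg_l.
move=> f lt_f; have [-> |neq_f] := eqVneq f e.
  rewrite andbF; apply/negP => /andP[/andP[_ na] /andP[_ nb]].
  by move: inc_e; rewrite /inc (negbTE na) (negbTE nb).
rewrite andbT; apply/idP/idP => [/andP[/andP[-> _] /andP[-> _]] //|/andP[Aa Ab]].
rewrite /remove Aa Ab /=; apply/andP; split; apply/eqP => E.
  case/eqP: neq_f; have [_ _] := deg1P deg_l; apply=> //.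
  by apply/and3P; split=> //; rewrite /inc E eqxx.
case/eqP: neq_f; have [_ _] := deg1P deg_l; apply=> //.
by apply/and3P; split=> //; rewrite /inc E eqxx orbT.
Qed.

(** A detour into the leaf traverses its edge twice. *)
Lemma walk_remove u v c : walk N A u v c -> v <> l ->
  exists2 c', walk N remove (if u == l then p else u) v c' &
    (if u == l then len N e else 0) + c' <= c.
Proof.
have [inc_e Al Ap neq_p] := leaf_inc.
have len_e := len_ge0 leaf_lt.
elim=> {u v c} [u Au neq_u|u f v c Au lt_f inc_f H IH /IH {IH}[c' Hc' le_c']].
  rewrite (negbTE (introN eqP neq_u)); exists 0; last by rewrite addr0.
  by apply: walk_nil; rewrite /remove Au; apply/eqP.
have [Ao _] := walk_ends H; have [Eu|neq_u] := eqVneq u l.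
  move: Hc' le_c'; rewrite Eu in inc_f Ao *; rewrite (leaf_edge lt_f inc_f Ao).
  rewrite (negbTE (introN eqP neq_p)) => Hc' le_c'.
  by exists c' => //; lra.
have len_f := len_ge0 lt_f; move: Hc' le_c'.
have [Eo|neq_o] := eqVneq (opp N f u) l => Hc' le_c'.
  have Ef : f = e.
    apply: leaf_edge; rewrite -?Eo ?inc_opp ?oppK //.
  by rewrite -Ef -Eo oppK // in Hc'; exists c' => //; lra.
exists (len N f + c'); last by lra.
by apply: walk_cons => //; rewrite /remove Au.
Qed.

Lemma geodesic_remove : geodesic A -> geodesic remove.
Proof.
move=> [A_lt geo]; split=> [v /andP[/A_lt] //|u v /andP[Au nu] /andP[Av /eqP nv]].
have [c H le_c] := geo u v Au Av.
have [c' H' le_c'] := walk_remove H nv; rewrite (negbTE nu) in H' le_c'.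
by exists c' => //; lra.
Qed.

(** A walk that leaves [l] for good has to use its unique edge; the remainder, freed of detours,
    joins [p] to [v]. *)
Lemma metric_leaf v : geodesic A -> A v -> v <> l -> d l v = len N e + d p v.
Proof.
move=> [A_lt geo] Av nv; have [inc_e Al Ap neq_p] := leaf_inc.
have [c H le_c] := geo l v Al Av.
have [c' H' le_c'] := walk_remove H nv; rewrite eqxx in H' le_c'.
have le_p : d p v <= c'.
  by apply: (metric_le dM); apply: walk_sub H' => w /andP[/A_lt].
apply/eqP; rewrite eq_le; apply/andP; split; last by lra.
apply: (metric_le dM); apply: walk_cons => //; rewrite ?leaf_lt //.
  exact: A_lt.
by apply: (metric_walk dM); apply: A_lt.
Qed.

End RemoveLeaf.

(** [h v] is the depth of the trees pruned at [v], and [D] the greatest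
    distance between two vertices of a same pruned tree. *)
Record pruned A (h : nat -> R) (D : R) : Prop := Pruned {
  pr_h : forall v, A v -> 0 <= h v;
  pr_D : 0 <= D;
  pr_ub : forall x, (forall u v, (u < n)%N -> (v < n)%N -> d u v <= x) <->
    D <= x /\ forall a b, A a -> A b -> a <> b -> h a + h b + d a b <= x
}.

(** By [metric_leaf], the pair of [l] and any [v] other than [p] weighs as much as the pair of [p]
    and [v] in which [p] is given the depth of [l] extended by the edge. Only the pair of [l] and
    [p] is lost, and the new [D] records it. *)
Lemma pruned_remove A h D l h' :
  geodesic A -> pruned A h D -> deg N A l = 1%N ->
  let e := ids N A l in let p := opp N e l in
  (forall v, h' v = if v == p then Num.max (h p) (h l + len N e) else h v) ->
  pruned (remove A l) h' (Num.max D (h p + (h l + len N e))).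
Proof.
move=> geo [h0 D0 ub] deg_l e p h'E; have [inc_e Al Ap neq_p] := leaf_inc deg_l.
have len_e := len_ge0 (leaf_lt deg_l); have A_lt := geo.1.
split=> [v /andP[Av _]||x].
- by rewrite h'E; case: eqP => _; rewrite ?le_max h0.
- by rewrite le_max D0.
have dlp : d l p = len N e.
  by rewrite (metric_leaf deg_l geo) // -/e -/p metricxx ?addr0 ?A_lt.
have dpl : d p l = len N e by rewrite metric_sym // A_lt.
rewrite ub ge_max; split=> [[leD le_x]|[/andP[leD le_s] le_x]].
  have le_s : h p + (h l + len N e) <= x.
    by have := le_x p l Ap Al neq_p; rewrite dpl; lra.
  split=> [|a b /andP[Aa /eqP na] /andP[Ab /eqP nb] neq_ab]; first by rewrite leD.
  have le_l v : A v -> v <> l -> v <> p -> h l + len N e + h v + d p v <= x.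
    move=> Av nv nvp; have := le_x l v Al Av (nesym nv).
    by rewrite (metric_leaf deg_l geo) //; rewrite -/e -/p; lra.
  rewrite !h'E; case: eqP => [Ea|nap]; case: eqP => [Eb|nbp].
  - by case: neq_ab; rewrite Ea Eb.
  - rewrite Ea -addrA -lerBrDr ge_max !lerBrDr addrA; apply/andP; split.
      by apply: le_x => // E; case: nbp.
    by have := le_l b Ab nb nbp; lra.
  - rewrite Eb [_ + Num.max _ _]addrC -addrA -lerBrDr ge_max !lerBrDr.
    have -> : d a p = d p a by rewrite metric_sym ?A_lt.
    apply/andP; split; last by have := le_l a Aa na nap; lra.
    by have := le_x p a Ap Aa (nesym nap); lra.
  - exact: le_x.
have le_h v : A v -> h v <= h' v by rewrite h'E; case: eqP => [->|_]; rewrite ?le_max lexx.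
have le_l v : A v -> v <> l -> h l + h v + d l v <= x.
  move=> Av nv; have [->|nvp] := eqVneq v p; first by rewrite dlp; lra.
  rewrite (metric_leaf deg_l geo) // -/e -/p.
  have := le_x p v; rewrite /remove Ap Av /= => H.
  have {H} := H (introN eqP neq_p) (introN eqP nv) (fun E => negP nvp (introT eqP (esym E))).
  have : h l + len N e <= h' p by rewrite h'E eqxx le_max lexx orbT.
  by have := le_h v Av; lra.
split=> // a b Aa Ab neq_ab.
have [Ea|na] := eqVneq a l; first by rewrite Ea; apply: le_l => // E; case: neq_ab; rewrite E.
have [Eb|nb] := eqVneq b l.
  rewrite Eb metric_sym ?A_lt //; have := le_l a Aa (fun E => negP na (introT eqP E)).
  by lra.
have := le_x a b; rewrite /remove Aa Ab => /(_ na nb neq_ab).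
by have := le_h a Aa; have := le_h b Ab; lra.
Qed.

(** [ps_count] says that as many vertices as edges have been lost, so the core keeps the original
    surplus of edges over vertices. *)
Record pstate A (st : state R) : Prop := Pstate {
  ps_input : input N st;
  ps_dead : forall v, (v < n)%N -> A v = (iarr st aDead v == 0%N);
  ps_deg : forall v, (v < n)%N -> iarr st aDeg v = deg N A v;
  ps_ids : forall v, A v -> iarr st aEs v = ids N A v;
  ps_pruned : pruned A (rarr st rH) (rvar st xD);
  ps_geo : geodesic A;
  ps_count : (nlive A + n = nalive A + m)%N;
  ps_ne : exists v, A v
}.

(** * Correctness and cost of the pruning program *)

Section PruneProgram.
Variable w : nat.
Hypothesis fit : fits N w.
Implicit Types (st : state R) (Q : state R -> nat -> Prop).
Local Open Scope nat_scope.

Lemma wp_prune_leaf A st r Q :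
  pstate A st -> ivar st vW < n -> deg N A (ivar st vW) = 1 -> 150 <= r ->
  (forall st' r', frame prune_leaf st st' -> ivar st' vW < n ->
     pstate (remove A (ivar st vW)) st' ->
     (forall v, v < n -> v != ivar st' vW ->
        deg N (remove A (ivar st vW)) v = 1 -> v != ivar st vW /\ deg N A v = 1) ->
     r <= r' + 150 -> Q st' r') ->
  wp w prune_leaf st r Q.
Proof.
move=> [inp dead degE' idsE' prn geo cnt _] lt_l deg_l le_r HQ.
have [n2 fn fnn fm fmm] := fit; have [i0 i1 i2 i3 i4] := inp.
set l := ivar st vW in lt_l deg_l HQ *.
have [inc_e Al Ap neq_p] := leaf_inc deg_l; have lt_e := leaf_lt deg_l.
have El := idsE' l Al.
set e := ids N A l in inc_e Ap neq_p lt_e El *; set p := opp N e l in Ap neq_p *.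
have lt_p : p < n by apply: geo.1.
have Ep := idsE' p Ap; have Dp := degE' p lt_p.
have idp := ids_upto_le N A p m; have dgp := deg_upto_le N A p m.
rewrite -/(ids N A p) in idp; rewrite -/(deg N A p) in dgp.
apply: wp_frame; cmd_step; rewrite -/l ?El; try by nat_lia.
cmd_step; rewrite -/l ?i2 ?i3 -/(opp N e l) -/p; try by nat_lia.
cmd_step; rewrite -/l ?i4.
apply: wp_seq; apply: wp_maximize; cmd_simpl; first by nat_lia.
move=> rv1 r1 rv1E rv1F le_r1.
cmd_step.
apply: wp_seq; apply: wp_maximize; cmd_simpl; first by nat_lia.
move=> rv2 r2 rv2E rv2F le_r2; rewrite rv1F //= upd_same in rv2E.
have neq_pl : (p == l) = false by apply/eqP.
have deg1 := deg_remove deg_l; have ids1 := ids_remove deg_l.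
have degp : deg N A p = (deg N (remove A l) p).+1.
  by rewrite deg1 ?neq_pl // eqxx addn1.
have idsp : ids N A p = ids N (remove A l) p + e.
  by rewrite ids1 ?neq_pl // eqxx.
do 6 (cmd_step; rewrite -/l ?(upd_neq _ _ neq_pl) ?Ep ?Dp; try by nat_lia).
have dead_l : remove A l l = false by rewrite /remove eqxx andbF.
move=> F; apply: HQ; rewrite //=; upd_simpl; last by nat_lia.
- split=> /=; upd_simpl.
  + by [].
  + move=> v lt_v; rewrite /remove /upd; case: eqP => [->|_]; last first.
      by rewrite andbT dead.
    by rewrite andbF.
  + move=> v lt_v; rewrite /upd; case: eqP => [->|/eqP nvp]; first by rewrite degp subn1.
    case: eqP => [->|/eqP nvl]; first by rewrite deg_dead ?dead_l.
    by rewrite degE' // deg1 // (negbTE nvp) addn0.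
  + move=> v /andP[Av nvl]; rewrite /upd; case: eqP => [->|/eqP nvp].
      by rewrite idsp addnK.
    by rewrite idsE' // ids1 // (negbTE nvp) addn0.
  + rewrite (rv2F 0) //; upd_simpl; rewrite rv1E.
    apply: (pruned_remove geo prn deg_l) => v; rewrite /upd rv2E.
    by [].
  + exact: geodesic_remove.
  + by have := nalive_remove deg_l lt_l; have := nlive_remove deg_l; nat_lia.
  + by exists p; rewrite /remove Ap neq_pl.
- move=> v lt_v nvp; have [->|nvl] := eqVneq v l; first by rewrite deg_dead ?dead_l.
  by rewrite deg1 // (negbTE nvp) addn0.
Qed.

Lemma wp_prune st r Q :
  pstate (verts N) st -> 300 * n + 100 <= r ->
  (forall A st' r', frame prune st st' -> pstate A st' ->
     (forall v, v < n -> deg N A v <> 1) ->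
     r <= r' + 300 * n + 100 -> Q st' r') ->
  wp w prune st r Q.
Proof.
move=> ps0 le_r HQ; have [n2 fn fnn fm fmm] := fit.
have alive_n : nalive (verts N) = n.
  rewrite /nalive big_nat_cond (eq_bigl (fun v => (0 <= v < n) && true)); last first.
    by move=> v; rewrite /verts; nat_lia.
  by rewrite -big_nat_cond sum_nat_const_nat; nat_lia.
(* A removal is paid for by the 200 credits of the vertex that leaves [A], in whichever round it
   happens. *)
apply: (wp_for (b := n) (I := fun i st' r' => exists A, [/\ pstate A st',
   (forall v, v < i -> deg N A v <> 1) &
   r + 200 * nalive A <= r' + 200 * n + 50 * i + (9 * n + 7)])) => //.
- exact: inp_n (ps_input ps0).
- by nat_lia.
- by nat_lia.
- move=> i st' r' lt_i Ei En [A [ps degi le_r']].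
  cmd_step; rewrite Ei; try by nat_lia.
  (* Apart from the vertex in [vW], no vertex up to [i] is a leaf; the failing test at the exit
     settles that one too. *)
  apply: (wp_while (I := fun st2 r2 => ivar st2 vW < n /\ exists A, [/\ pstate A st2,
     (forall v, v < i.+1 -> v != ivar st2 vW -> deg N A v <> 1) &
     r + 200 * nalive A <= r2 + 200 * n + 50 * i + 20 + (9 * n + 7)])).
  + move=> st2 r2 [_ [B [_ _ ?]]].
    by cmd_simpl; nat_lia.
  + move=> st2 r2 r3 [lt_W [B [psB degB le_r2]]] leaf Er3.
    have deg_W : deg N B (ivar st2 vW) = 1.
      by rewrite -(ps_deg psB) //; move: leaf => /= /andP[]; nat_lia.
    have nB := nalive_remove deg_W lt_W.
    have Er3' : r2 = r3 + 10 by rewrite Er3.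
    apply: (wp_prune_leaf psB lt_W deg_W); first by nat_lia.
    move=> st4 r4 F lt_W4 psB4 degB4 le_r4; split=> //.
    exists (remove B (ivar st2 vW)); split=> // [v lt_v nv dv|]; last by nat_lia.
    have [|nvW] := degB4 v _ nv dv; first by nat_lia.
    exact: degB.
  + move=> st2 r2 r3 [lt_W [B [psB degB le_r2]]] leaf Er3.
    have Er3' : r2 = r3 + 10 by rewrite Er3.
    exists B; split; [| | by nat_lia].
    * by case: psB => [[? ? ? ? ?] ? ? ? ? ? ? ?]; split=> //; split.
    * move=> v lt_v; have [->|nv] := eqVneq v (ivar st2 vW); last exact: degB.
      by rewrite -(ps_deg psB) //; move: leaf => /=; nat_lia.
  + cmd_simpl; split=> //; exists A; split; last by nat_lia.
      by case: ps => [[? ? ? ? ?] ? ? ? ? ? ? ?]; split=> //; split.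
    by move=> v lt_v nv; apply: degi; nat_lia.
- move=> st' r' _ F [A [ps degA le_r']]; apply: (HQ A) => //; nat_lia.
- exists (verts N); split=> //; last by nat_lia.
  by case: ps0 => [[? ? ? ? ?] ? ? ? ? ? ? ?]; split=> //; split.
Qed.

End PruneProgram.

End Metric.

(** * Arcs of the core *)

Section Arcs.
Variables (R : realFieldType) (N : net R) (d : nat -> nat -> R).
Variables (A por : nat -> bool).
Hypothesis dM : metric N d.
Hypothesis geo : geodesic N d A.
Hypothesis porA : forall v, por v -> A v.
Hypothesis deg2 : forall v, A v -> ~~ por v -> deg N A v = 2%N.
Local Notation n := (nv N).
Local Notation m := (ne N).

(** The walk that enters an arc of the core at [c] through the edge [e0] and
    goes straight on at each vertex of degree 2: [av i] is its [i]-th vertex,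
    [ae i] the edge it takes from there, and [alen i] its length up to there. *)
Fixpoint arc c e0 i : nat * nat :=
  if i is i'.+1 then
    let e := (ids N A (arc c e0 i').1 - (arc c e0 i').2)%N in
    (opp N e (arc c e0 i').1, e)
  else (opp N e0 c, e0).
Definition ae c e0 i := (arc c e0 i).2.
Definition av c e0 i := if i is i'.+1 then (arc c e0 i').1 else c.
Fixpoint alen c e0 i : R :=
  if i is i'.+1 then alen c e0 i' + len N (ae c e0 i') else 0.

Lemma avS c e0 i : av c e0 i.+1 = opp N (ae c e0 i) (av c e0 i).
Proof. by case: i. Qed.

Lemma alen0 c e0 : alen c e0 0 = 0.
Proof. by []. Qed.

Lemma alenS c e0 i : alen c e0 i.+1 = alen c e0 i + len N (ae c e0 i).
Proof. by []. Qed.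

Lemma aeS c e0 i : ae c e0 i.+1 = (ids N A (av c e0 i.+1) - ae c e0 i)%N.
Proof. by []. Qed.

Section OneArc.
Variables (c e0 l : nat).
Hypothesis por_c : por c.
Hypothesis lt_e0 : (e0 < m)%N.
Hypothesis live_e0 : live N A e0 c.
Hypothesis free : forall i, (0 < i <= l)%N -> ~~ por (av c e0 i).
Local Notation q := (av c e0).
Local Notation e := (ae c e0).
Local Notation x := (alen c e0).

Lemma arc_edge i : (i <= l)%N ->
  [/\ (e i < m)%N, live N A (e i) (q i) & (0 < i)%N -> e i <> e i.-1 /\
      forall f, (f < m)%N -> live N A f (q i) -> f = e i.-1 \/ f = e i].
Proof.
elim: i => [|i IH] le_i; first by split.
have [lt_ei live_ei _] := IH (ltnW le_i).
have [inc_i Aq Aq'] := live_opp live_ei; rewrite -avS in Aq'.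
have live' : live N A (e i) (q i.+1).
  by rewrite avS; apply: live_intro; rewrite ?inc_opp ?oppK -?avS.
have dq : deg N A (q i.+1) = 2%N by apply: deg2 => //; apply: free.
by have [] := deg2P dq lt_ei live'; rewrite -aeS.
Qed.

Lemma arc_core i : (i <= l.+1)%N -> A (q i).
Proof.
case: i => [|i] le_i; first exact: porA.
by have [_ /live_opp[_ _]] := arc_edge le_i; rewrite avS.
Qed.

Lemma arc_lt i : (i <= l.+1)%N -> (q i < n)%N.
Proof. by move=> /arc_core; apply: geo.1. Qed.

Lemma arc_inc i : (i <= l)%N -> inc N (e i) (q i) /\ inc N (e i) (q i.+1).
Proof.
move=> le_i; have [_ /live_opp[inc_i _ _] _] := arc_edge le_i.
by rewrite avS inc_opp.
Qed.

Lemma arc_back i : (i <= l)%N -> opp N (e i) (q i.+1) = q i.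
Proof. by move=> le_i; rewrite avS oppK //; case: (arc_inc le_i). Qed.

Lemma arc_back_pred i : (0 < i <= l.+1)%N -> opp N (e i.-1) (q i) = q i.-1.
Proof. by move=> /andP[i_gt0 le_i]; rewrite -{2}(prednK i_gt0) arc_back //; nat_lia. Qed.

(** The edge by which the arc arrives at a repeated vertex is one of the only two edges there, so
    the vertex before it is a neighbour of the first occurrence on the arc, and an earlier
    repetition arises. The exceptions are a return to the portal [c], a loop and an immediate
    reversal, all of them impossible. *)
Lemma arc_inj i j : (0 < i < j)%N -> (j <= l)%N -> q i <> q j.
Proof.
elim: j {-2}j (leqnn j) i => [|J IH] j le_jJ i; first by nat_lia.
case: j le_jJ => [|j] le_jJ ij le_jl E; first by nat_lia.
have [lt_ej live_ej _] := arc_edge (ltnW le_jl).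
have [inc_i inc_i'] := arc_inc (ltnW le_jl).
have Aj := @arc_core j ltac:(nat_lia); have Aj' := @arc_core j.+1 ltac:(nat_lia).
have live' : live N A (e j) (q i).
  by rewrite E; apply: live_intro => //; rewrite arc_back // ltnW.
have le_il : (i <= l)%N by nat_lia.
have i_gt0 : (0 < i)%N by nat_lia.
have [lt_ei live_ei /(_ i_gt0)[ne_ei two]] := arc_edge le_il.
case: (two _ lt_ej live') => Ej.
  have Eq : q j = q i.-1.
    by rewrite -(arc_back (ltnW le_jl)) -E Ej arc_back_pred //; nat_lia.
  have [i1|i_neq1] := eqVneq i 1%N.
    have /negP := @free j ltac:(nat_lia); apply.
    by rewrite Eq i1.
  by apply: (IH j _ i.-1 _ _ (esym Eq)); nat_lia.
have Eq : q j = q i.+1 by rewrite -(arc_back (ltnW le_jl)) -E Ej avS.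
have [Eij|neq_ij] := eqVneq i j.
  have := opp_neq lt_ei (arc_inc le_il).1; apply.
  by rewrite -avS -Eq Eij.
have [Eij|neq_ij'] := eqVneq i.+1 j.
  have [_ _ /(_ isT)[ne _]] := @arc_edge i.+1 ltac:(nat_lia).
  by case: ne; rewrite -Ej -Eij.
by apply: (IH j _ i.+1 _ _ (esym Eq)); nat_lia.
Qed.

Lemma alen_le i j : (i <= j <= l.+1)%N -> x i <= x j.
Proof.
elim: j => [|j IH] /andP[le_ij le_jl]; first by move: le_ij; rewrite leqn0 => /eqP->.
have [->//|neq] := eqVneq i j.+1.
have [lt_e _ _] := @arc_edge j ltac:(nat_lia); have := len_ge0 lt_e.
by have := IH ltac:(nat_lia); rewrite /=; lra.
Qed.

Lemma arc_metric i j : (i <= j <= l.+1)%N -> d (q i) (q j) <= x j - x i.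
Proof.
elim: j => [|j IH] /andP[le_ij le_jl].
  move: le_ij; rewrite leqn0 => /eqP->.
  by rewrite (metricxx dM) ?subrr // arc_lt.
have [->|neq] := eqVneq i j.+1; first by rewrite (metricxx dM) ?subrr // arc_lt.
have [lt_e live_e _] := @arc_edge j ltac:(nat_lia); have le_d := IH ltac:(nat_lia).
have [inc_e _ _] := live_opp live_e.
have le_e : d (q j) (q j.+1) <= len N (e j).
  apply: (metric_le dM); rewrite avS; apply: walk_edge => //.
    by apply: arc_lt; nat_lia.
  by rewrite -avS; apply: arc_lt; nat_lia.
have := metric_triangle dM (@arc_lt i ltac:(nat_lia)) (@arc_lt j ltac:(nat_lia)) (@arc_lt j.+1 ltac:(nat_lia)).
by rewrite /=; lra.
Qed.

(** A walk from an inner vertex of the arc leaves it at one of the ends, or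
    at the vertex number [lo] where its length is bounded by assumption. *)
Lemma arc_lower_bound u lo al i v a :
  (lo <= i <= l.+1)%N -> (lo <= l)%N -> A u ->
  (forall b, walk N A (q lo) u b -> al + x lo <= b) ->
  (forall j, (lo < j <= l)%N -> q j <> u) ->
  walk N A v u a -> v = q i ->
  al + x i <= a \/ d (q l.+1) u + (x l.+1 - x i) <= a.
Proof.
move=> + le_lo Au at_lo noq H; move: (noq) (at_lo).
elim: H i => {v u a Au at_lo noq} [u Au|v f u a Av lt_f inc_f H IH] i noq at_lo i_bd Ev.
  have [Ei|neq_lo] := eqVneq i lo.
    by left; rewrite Ei; apply: at_lo; rewrite -Ei -Ev; apply: walk_nil.
  have [Ei|neq_l] := eqVneq i l.+1.
    by right; rewrite Ei -Ei -Ev (metricxx dM) ?geo.1 // subrr addr0.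
  by case: (noq i) => //; nat_lia.
have Hfull : walk N A (q i) u (len N f + a) by rewrite -Ev; apply: walk_cons.
have [Ei|neq_lo] := eqVneq i lo; first by left; rewrite Ei; apply: at_lo; rewrite -Ei.
have [Ei|neq_l] := eqVneq i l.+1.
  right; rewrite Ei subrr addr0; rewrite Ei in Hfull; apply: (metric_le dM).
  by apply: walk_sub Hfull; apply: geo.1.
have i_gt0 : (0 < i)%N by nat_lia.
have [|lt_ei live_ei /(_ i_gt0)[_ two]] := @arc_edge i; first by nat_lia.
have [Ao _] := walk_ends H.
have [|Ef|Ef] := two f lt_f.
- by rewrite -Ev; apply: live_intro.
- have Eo : opp N f v = q i.-1.
    by rewrite Ef Ev arc_back_pred //; nat_lia.
  have := IH i.-1 noq at_lo ltac:(nat_lia) Eo.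
  have : x i = x i.-1 + len N f by rewrite Ef -{1}(prednK i_gt0).
  by have := len_ge0 lt_f => ? ->; case=> *; [left | right]; lra.
- have Eo : opp N f v = q i.+1 by rewrite Ef Ev avS.
  have := IH i.+1 noq at_lo ltac:(nat_lia) Eo.
  have : x i.+1 = x i + len N f by rewrite Ef.
  by have := len_ge0 lt_f => ? ->; case=> *; [left | right]; lra.
Qed.

(** The vertices [q 0 .. q l] are distinct: [arc_inj] separates the inner ones, and [q 0] is a
    portal while they are not. *)
Lemma arc_free_lt : (l < n)%N.
Proof.
have uq : uniq (map q (iota 0 l.+1)).
  rewrite map_inj_in_uniq ?iota_uniq // => i j; rewrite !mem_iota add0n => i_bd j_bd.
  wlog le_ij : i j i_bd j_bd / (i <= j)%N => [H E|E].
    by have [/H ->|/ltnW/H ->] := leqP i j.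
  have [//|neq_ij] := eqVneq i j; have [i0|i_gt0] := posnP i.
    by have /negP[] := @free j ltac:(nat_lia); rewrite -E i0.
  by case: (@arc_inj i j ltac:(nat_lia) ltac:(nat_lia)).
have := @uniq_leq_size _ _ (iota 0 n) uq; rewrite size_map !size_iota; apply.
move=> y /mapP[i]; rewrite mem_iota => i_bd ->.
by rewrite mem_iota add0n /=; apply: arc_lt; nat_lia.
Qed.

(** The index 0 encodes that [u] is not an inner vertex of the arc; being portals, both ends fall
    under it. *)
Definition on_arc u j :=
  (j <= l)%N /\ if j == 0%N then forall i, (0 < i <= l)%N -> q i <> u else q j = u.

Definition arc_offset u j := if j == 0%N then d c u else - x j.

(** From [j] on this is [arc_lower_bound] with [lo = j]; before [j] the first term is at most 0,
    hence below any distance. *)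
Lemma arc_lower u j i : A u -> on_arc u j -> (0 < i <= l)%N ->
  arc_offset u j + x i <= d u (q i) \/
  d (q l.+1) u + (x l.+1 - x i) <= d u (q i).
Proof.
move=> Au [le_j ju] i_bd; have Aq : A (q i) by apply: arc_core; nat_lia.
have lt_u := geo.1 _ Au; have lt_q := geo.1 _ Aq.
have [lt_ij|le_ji] := ltnP i j.
  left; rewrite /arc_offset; case: eqP => [|_]; first by lia.
  have := metric_ge0 dM lt_u lt_q; have := @alen_le i j ltac:(nat_lia).
  by lra.
have [a H le_a] := geo.2 _ _ Aq Au.
have at_j b : walk N A (q j) u b -> arc_offset u j + x j <= b.
  rewrite /arc_offset; case: eqP => [->|_] Hb.
    by rewrite addr0; apply: (metric_le dM); apply: walk_sub Hb; apply: geo.1.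
  by rewrite addNr (walk_ge0 Hb).
have noq k : (j < k <= l)%N -> q k <> u.
  move=> k_bd; move: ju; case: eqP => [_|/eqP]; first by apply; nat_lia.
  by rewrite -lt0n => j_gt0 <-; apply/nesym/arc_inj; nat_lia.
rewrite (metric_sym dM lt_u lt_q).
by case: (arc_lower_bound _ _ Au at_j noq H erefl) => // [|? |?];
  [nat_lia | left; lra | right; lra].
Qed.

(** Beyond [j], each term bounds the length of a route from [u], one route for each side from which
    the vertex can be entered. *)
Lemma arc_upper u j i : A u -> on_arc u j -> (j < i <= l)%N ->
  d u (q i) <= arc_offset u j + x i /\
  d u (q i) <= d (q l.+1) u + (x l.+1 - x i).
Proof.
move=> Au [le_j ju] i_bd; have lt_u := geo.1 _ Au.
have lt_qi := @arc_lt i ltac:(nat_lia); have lt_ql := @arc_lt l.+1 (leqnn _).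
have := @arc_metric i l.+1 ltac:(nat_lia).
have := metric_triangle dM lt_u lt_ql lt_qi.
rewrite (metric_sym dM lt_u lt_ql) (metric_sym dM lt_ql lt_qi) => ? ?.
split; last by lra.
rewrite /arc_offset; move: ju; case: eqP => [_ _|_ <-].
  have lt_c := @arc_lt 0 isT.
  have := @arc_metric 0 i ltac:(nat_lia); have := metric_triangle dM lt_u lt_c lt_qi.
  by rewrite (metric_sym dM lt_u lt_c) /=; lra.
by have := @arc_metric j i ltac:(nat_lia); lra.
Qed.

End OneArc.
Definition arc_free c e0 l := forall i, (0 < i <= l)%N -> ~~ por (av c e0 i).

(** [arc_free_lt] rules out [n] inner vertices without a portal, so the search for the end of an arc
    stops. *)
Lemma arc_end c e0 : por c -> (e0 < m)%N -> live N A e0 c ->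
  exists2 l, arc_free c e0 l & por (av c e0 l.+1).
Proof.
move=> por_c lt_e live_e.
have [//|fr] : (exists2 l, arc_free c e0 l & por (av c e0 l.+1)) \/ arc_free c e0 n.
  elim: n => [|k [|IH]]; [by right; case | by left |].
  have [pk|npk] := boolP (por (av c e0 k.+1)); [by left; exists k | right].
  by move=> i i_bd; have [->//|ne] := eqVneq i k.+1; apply: IH; nat_lia.
by have := arc_free_lt por_c lt_e live_e fr; rewrite ltnn.
Qed.

(** The core is connected, so follow a walk from the portal [z]. Each edge of it reaches a portal,
    starts an arc, or moves one step forwards or backwards on the current arc; being covered is thus
    passed on. *)
Lemma arcs_cover z v : por z -> A v ->
  por v \/ exists c e0 l i, [/\ por c, (e0 < m)%N, live N A e0 c,
    arc_free c e0 l /\ por (av c e0 l.+1) & (0 < i <= l)%N /\ v = av c e0 i].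
Proof.
move=> por_z Av; have [a H _] := geo.2 _ _ (porA por_z) Av.
have : por z \/ exists c e0 l i, [/\ por c, (e0 < m)%N, live N A e0 c,
    arc_free c e0 l /\ por (av c e0 l.+1) & (0 < i <= l)%N /\ z = av c e0 i] by left.
elim: H {por_z Av} => {v a} {}z // f v a Av lt_f inc_f H IH Wv; apply: IH.
have [Ao _] := walk_ends H; have live_f := live_intro inc_f Av Ao.
have [po|npo] := boolP (por (opp N f z)); [by left | right].
case: Wv => [pz|[c [e0 [l [i [pc lt_e live_e [fr pl] [i_bd Ez]]]]]]].
  have [l fr pl] := arc_end pz lt_f live_f.
  exists z, f, l, 1%N; split=> //; split=> //.
  by case: l fr pl => [_|//]; rewrite /= (negbTE npo).
exists c, e0, l; have i_gt0 : (0 < i)%N by nat_lia.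
have [|_ _ /(_ i_gt0)[_ two]] := arc_edge lt_e live_e fr (i := i); first by nat_lia.
rewrite -Ez in two; case: (two f lt_f live_f) => Ef.
- have Eo : opp N f z = av c e0 i.-1.
    by rewrite Ef Ez (arc_back_pred lt_e live_e fr) //; nat_lia.
  exists i.-1; split=> //; split=> //.
  case: i i_gt0 i_bd Eo {Ez two Ef} => // -[|i] _ i_bd Eo; last by nat_lia.
  by move: npo; rewrite Eo /= pc.
- have Eo : opp N f z = av c e0 i.+1 by rewrite avS Ef Ez.
  exists i.+1; split=> //; split=> //.
  have [Ei|] := eqVneq i l; last by nat_lia.
  by move: npo; rewrite Eo Ei pl.
Qed.

(** Two inner vertices of one arc can be exchanged by symmetry, which is why [Harc] is only required
    for [j < i]; a vertex [a] off the arc of [b] falls under [j = 0]. *)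
Lemma cover_bound (h : nat -> R) D z a b :
  por z ->
  (forall s u, por s -> A u -> u <> s -> h s + h u + d s u <= D) ->
  (forall c e0 l u j i, por c -> (e0 < m)%N -> live N A e0 c ->
     arc_free c e0 l -> por (av c e0 l.+1) -> A u -> on_arc c e0 l u j ->
     (j < i <= l)%N -> h u + h (av c e0 i) + d u (av c e0 i) <= D) ->
  A a -> A b -> a <> b -> h a + h b + d a b <= D.
Proof.
move=> por_z Hpor Harc Aa Ab neq_ab; have lt_a := geo.1 _ Aa; have lt_b := geo.1 _ Ab.
case: (arcs_cover por_z Ab) => [pb|[c [e0 [l [i [pc lt_e live_e [fr pl] [i_bd Eb]]]]]]].
  by have := Hpor b a pb Aa neq_ab; rewrite (metric_sym dM lt_a lt_b); lra.
have [|hasN] := boolP (has (fun j => av c e0 j == a) (iota 1 l)); last first.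
  rewrite Eb; apply: (Harc c e0 l a 0%N i) => //; split=> //= k k_bd Ek.
  by case/hasP: hasN; exists k; rewrite ?mem_iota ?Ek //; nat_lia.
case/hasP=> j; rewrite mem_iota => j_bd /eqP Ea.
have [lt_ji|lt_ij|Eij] := ltngtP j i.
- rewrite Eb; apply: (Harc c e0 l a j i) => //; last by nat_lia.
  by split; [nat_lia | case: eqP; [nat_lia | ]].
- have := Harc c e0 l b i j pc lt_e live_e fr pl Ab.
  rewrite Ea (metric_sym dM lt_a lt_b) => H.
  have : on_arc c e0 l b i by split; [nat_lia | case: eqP; [nat_lia | ]].
  by move=> /H; have -> : (i < j <= l)%N by [nat_lia]; move=> /(_ isT); lra.
- by case: neq_ab; rewrite -Ea Eb Eij.
Qed.

End Arcs.

Arguments arc : simpl never.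
Arguments av : simpl never.
Arguments ae : simpl never.
Arguments alen : simpl never.

(** * Queries on an arc *)

Definition arc_walk :=
  (ISet vY (ISub (IAdd (IGet aEA (IVar vK)) (IGet aEB (IVar vK))) (IVar vP)) ;;
   ISet vE (IVar vK) ;;
   RSet xX (RGet rC (IVar vK)) ;;
   ISet vLen (IConst 0) ;;
   While (BLeI (IGet aPor (IVar vY)) (IConst 0))
     (ISet vLen (IAdd (IVar vLen) (IConst 1)) ;;
      IPut aQ (IVar vLen) (IVar vY) ;;
      IPut aPos (IVar vY) (IVar vLen) ;;
      RPut rX (IVar vLen) (RVar xX) ;;
      ISet vE (ISub (IGet aEs (IVar vY)) (IVar vE)) ;;
      ISet vY (ISub (IAdd (IGet aEA (IVar vE)) (IGet aEB (IVar vE))) (IVar vY)) ;;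
      RSet xX (RAdd (RVar xX) (RGet rC (IVar vE)))))%cmd.

Definition next_j := IAdd (IVar vJ) (IConst 1).

Definition arc_prefix :=
  (IPut aArg (IConst 0) (IConst 0) ;;
   RPut rTop (IConst 0) RZero ;;
   RPut rSnd (IConst 0) RZero ;;
   For vJ vLen
     (RSet xL (RAdd (RGet rX next_j) (RGet rH (IGet aQ next_j))) ;;
      If (BLeR (RVar xL) (RGet rTop (IVar vJ)))
        (RPut rTop next_j (RGet rTop (IVar vJ)) ;;
         IPut aArg next_j (IGet aArg (IVar vJ)) ;;
         RSet xM (RGet rSnd (IVar vJ)) ;;
         maximize xM (RVar xL) ;;
         RPut rSnd next_j (RVar xM))
        (RPut rTop next_j (RVar xL) ;;
         IPut aArg next_j next_j ;;
         RPut rSnd next_j (RGet rTop (IVar vJ)))))%cmd.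

Definition arc_suffix :=
  (RPut rSuf (IAdd (IVar vLen) (IConst 1)) RZero ;;
   For vJ vLen
     (ISet vI (ISub (IVar vLen) (IVar vJ)) ;;
      RSet xL (RAdd (RSub (RVar xX) (RGet rX (IVar vI))) (RGet rH (IGet aQ (IVar vI)))) ;;
      RSet xM (RGet rSuf (IAdd (IVar vI) (IConst 1))) ;;
      maximize xM (RVar xL) ;;
      RPut rSuf (IVar vI) (RVar xM)))%cmd.

Definition BEqI e f := BAnd (BLeI e f) (BLeI f e).

(** The positions 0 and [vLen + 1] are sentinels: the comparison is never evaluated there. *)
Definition arc_split :=
  (ISet vLo (IConst 0) ;;
   ISet vHi (IAdd (IVar vLen) (IConst 1)) ;;
   While (BLeI (IAdd (IVar vLo) (IConst 2)) (IVar vHi))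
     (ISet vMid (IDiv (IAdd (IVar vLo) (IVar vHi)) (IConst 2)) ;;
      If (BLeR (RAdd (RVar xA) (RGet rX (IVar vMid)))
               (RAdd (RVar xB) (RSub (RVar xX) (RGet rX (IVar vMid)))))
        (ISet vLo (IVar vMid)) (ISet vHi (IVar vMid))))%cmd.

(** [aPos] and [aQ] are not cleared between arcs. An index is accepted only if it is in range and
    the current arc points back to [u], which discards stale entries. *)
Definition arc_query :=
  (If (BAnd (BLeI (IConst 1) (IGet aPos (IVar vU)))
         (BAnd (BLeI (IGet aPos (IVar vU)) (IVar vLen))
            (BEqI (IGet aQ (IGet aPos (IVar vU))) (IVar vU))))
     (ISet vIn (IGet aPos (IVar vU)) ;;
      RSet xA (RSub RZero (RGet rX (IVar vIn))))
     (ISet vIn (IConst 0) ;;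
      RSet xA (RGet rDT (IAdd (IMul (IVar vP) (IVar vN)) (IVar vU)))) ;;
   RSet xB (RGet rDT (IAdd (IMul (IVar vY) (IVar vN)) (IVar vU))) ;;
   arc_split ;;
   If (BEqI (IGet aArg (IVar vLo)) (IVar vIn))
     (RSet xM (RGet rSnd (IVar vLo))) (RSet xM (RGet rTop (IVar vLo))) ;;
   maximize xD (RAdd (RGet rH (IVar vU)) (RAdd (RVar xA) (RVar xM))) ;;
   maximize xD (RAdd (RGet rH (IVar vU)) (RAdd (RVar xB) (RGet rSuf (IVar vHi)))))%cmd.

Definition arc_body :=
  If (BAnd (BLeI (IConst 1) (IGet aPor (IVar vP)))
        (BAnd (BLeI (IGet aDead (IGet aEA (IVar vK))) (IConst 0))
           (BLeI (IGet aDead (IGet aEB (IVar vK))) (IConst 0))))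
    (arc_walk ;; arc_prefix ;; arc_suffix ;;
     For vU vN (If (BLeI (IGet aDead (IVar vU)) (IConst 0)) arc_query Skip))%cmd
    Skip.

Definition arcs :=
  For vK vM
    (ISet vP (IGet aEA (IVar vK)) ;; arc_body ;;
     ISet vP (IGet aEB (IVar vK)) ;; arc_body)%cmd.

(** The value [0] of [m2] may stand for the absence of a second candidate: in a
    query it yields a valid lower bound on the diameter anyway. *)
Record top_two (R : realFieldType) (y : nat -> R) (t a : nat) (m1 m2 : R) : Prop :=
  TopTwo {
    tt_arg : (a <= t)%N;
    tt_top : m1 = y a;
    tt_max : forall i, (i <= t)%N -> y i <= m1;
    tt_snd : forall i, (i <= t)%N -> i <> a -> y i <= m2;
    tt_att : m2 = 0 \/ exists2 i, (0 < i <= t)%N & i <> a /\ m2 = y i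
  }.

Lemma top_two_keep (R : realFieldType) (y : nat -> R) t a m1 m2 :
  top_two y t a m1 m2 -> y t.+1 <= m1 ->
  top_two y t.+1 a m1 (Num.max m2 (y t.+1)).
Proof.
move=> [le_a top mx snd att] le_y; split=> //; first by nat_lia.
- by move=> i; rewrite leq_eqVlt ltnS => /orP[/eqP-> //|/mx].
- move=> i; rewrite leq_eqVlt ltnS le_max => /orP[/eqP->|le_i ne_i].
    by rewrite lexx orbT.
  by rewrite snd.
- case: (leP m2 (y t.+1)) => _.
    by right; exists t.+1; [nat_lia | split=> //; nat_lia].
  case: att => [->|[i i_bd [ne_i ->]]]; [by left | right].
  by exists i => //; nat_lia.
Qed.

(** The former top becomes the second. If it was the entry at position 0, its value 0 is the
    permitted substitute, whence the premise on [y 0]. *)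
Lemma top_two_new (R : realFieldType) (y : nat -> R) t a m1 m2 :
  y 0%N = 0 -> top_two y t a m1 m2 -> m1 < y t.+1 ->
  top_two y t.+1 t.+1 (y t.+1) m1.
Proof.
move=> y0 [le_a top mx snd att] lt_y; split=> //.
- move=> i; rewrite leq_eqVlt ltnS => /orP[/eqP-> //|/mx le_i].
  by rewrite (le_trans le_i) // ltW.
- by move=> i; rewrite leq_eqVlt ltnS => /orP[/eqP-> //|/mx].
- have [a0|a_gt0] := posnP a; first by left; rewrite top a0.
  by right; exists a; [nat_lia | split=> //; nat_lia].
Qed.

(** The substitute value 0 turns into the candidate made of [h u] and the distance to the end
    portal, which [sentinel] shows to be harmless. *)
Definition suffix_max (R : realFieldType) (z : nat -> R) (l i : nat) (s : R) :=
  (forall k, (i <= k <= l)%N -> z k <= s) /\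
  (s = 0 \/ exists2 k, (i <= k <= l)%N & s = z k).

Lemma suffix_max_cons (R : realFieldType) (z : nat -> R) l i s :
  (i <= l)%N -> suffix_max z l i.+1 s -> suffix_max z l i (Num.max s (z i)).
Proof.
move=> le_i [mx att]; split=> [k k_bd|].
  rewrite le_max; have [->|ne_k] := eqVneq k i; first by rewrite lexx orbT.
  by rewrite mx //; nat_lia.
case: (leP s (z i)) => _; first by right; exists i => //; nat_lia.
case: att => [->|[k k_bd ->]]; [by left | right].
by exists k => //; nat_lia.
Qed.

Ltac keep H :=
  case: H; intros; subst; 
  match goal with
  | H : input _ _ |- _ => case: H; intros; split=> //; split=> //
  | _ => split=> //
  end.

(** * Correctness and cost of the queries on the arcs *)

Section ArcProgram.
Variables (R : realFieldType) (N : net R) (d : nat -> nat -> R) (w lam : nat).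
Variables (A por : nat -> bool) (h : nat -> R) (D0 : R).
Hypothesis fit : fits N w.
Hypothesis lt_lam : (nv N < 2 ^ lam)%N.
Hypothesis dM : metric N d.
Hypothesis geo : geodesic N d A.
Hypothesis porA : forall v, por v -> A v.
Hypothesis deg2 : forall v, A v -> ~~ por v -> deg N A v = 2%N.
Hypothesis prn : pruned N d A h D0.
Hypothesis two_alive : forall u, A u -> exists2 b, A b & u <> b.
Implicit Types (st : state R) (Q : state R -> nat -> Prop).
Local Open Scope nat_scope.
Local Notation n := (nv N).
Local Notation m := (ne N).
Local Notation av := (av N A).
Local Notation ae := (ae N A).
Local Notation alen := (alen N A).

Record core st : Prop := Core {
  co_input : input N st;
  co_dead : forall v, v < n -> A v = (iarr st aDead v == 0);
  co_por : forall v, v < n -> por v = (0 < iarr st aPor v);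
  co_ids : forall v, A v -> iarr st aEs v = ids N A v;
  co_rows : forall s v, por s -> v < n -> rarr st rDT (s * n + v) = d s v;
  co_h : rarr st rH = h
}.

Lemma core_frame c st st' :
  frame c st st' -> core st ->
  all [predC mem (ivars c)] [:: vN; vM] ->
  all [predC mem (iarrs c)] [:: aEA; aEB; aEs; aDead; aPor] ->
  all [predC mem (rarrs c)] [:: rC; rDT; rH] -> core st'.
Proof.
move=> F [inp dead prt idE row hE] /= /and3P[a1 a2 _].
move=> /and5P[b1 b2 b3 b4 /andP[b5 _]] /and4P[c1 c2 c3 _].
have [fi fa _ fr] := F; split; rewrite ?fa ?fr //.
by apply: (input_frame _ _ _ F) => //; rewrite ?a1 ?b1.
Qed.

Record arc_data c e0 l st : Prop := ArcData {
  ad_len : ivar st vLen = l;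
  ad_y : ivar st vY = av c e0 l.+1;
  ad_x : rvar st xX = alen c e0 l.+1;
  ad_q : forall i, 0 < i <= l ->
    [/\ iarr st aQ i = av c e0 i, iarr st aPos (av c e0 i) = i &
        rarr st rX i = alen c e0 i]
}.

Definition bounds X := forall u v, u < n -> v < n -> (d u v <= X)%R.

Lemma pruned_bound X u v : bounds X -> A u -> A v -> u <> v ->
  (h u + h v + d u v <= X)%R.
Proof. by move=> /(pr_ub prn X) [_]; apply. Qed.

(** Depths are nonnegative, so the one at [v] may be dropped; for [u = v], a second vertex of the
    core supplies the bound on [h u]. *)
Lemma sentinel X u v : bounds X -> A u -> A v -> (h u + d u v <= X)%R.
Proof.
move=> UB Au Av; have [<-|/eqP ne] := eqVneq u v.
  have [b Ab ne_ub] := two_alive Au; have := pruned_bound UB Au Ab ne_ub.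
  have := pr_h prn Ab; have := metric_ge0 dM (geo.1 _ Au) (geo.1 _ Ab).
  by rewrite (metricxx dM) ?(geo.1 _ Au) //; lra.
by have := pruned_bound UB Au Av ne; have := pr_h prn Av; lra.
Qed.

Section OneArc.
Variables (c e0 l : nat).
Hypothesis por_c : por c.
Hypothesis lt_e0 : e0 < m.
Hypothesis live_e0 : live N A e0 c.
Hypothesis free : arc_free N A por c e0 l.
Hypothesis por_end : por (av c e0 l.+1).
Local Notation q := (av c e0).
Local Notation e := (ae c e0).
Local Notation x := (alen c e0).

Lemma wp_arc_walk st r Q :
  core st -> ivar st vP = c -> ivar st vK = e0 -> 60 * l + 100 <= r ->
  (forall st' r', frame arc_walk st st' -> arc_data c e0 l st' ->
     r <= r' + 60 * l + 100 -> Q st' r') ->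
  wp w arc_walk st r Q.
Proof.
move=> co Ec Ee le_r HQ; have [n2 fn fnn fm fmm] := fit.
have [[i0 i1 i2 i3 i4] dead prt idE row hE] := co.
have lt_l : l < n := arc_free_lt geo porA deg2 por_c lt_e0 live_e0 free.
have lt_q : forall i, i <= l.+1 -> q i < n := arc_lt geo porA deg2 por_c lt_e0 live_e0 free.
have edge i : i <= l -> e i < m.
  by move=> /(arc_edge deg2 lt_e0 live_e0 free)[].
have E1 : opp N e0 c = q 1 by [].
have lt_q1 := lt_q 1 isT.
apply: wp_frame; cmd_step; rewrite ?Ee ?Ec ?i2 ?i3 -/(opp N e0 c) ?E1; try by nat_lia.
cmd_step; rewrite ?Ee; try by nat_lia.
cmd_step; rewrite ?Ee ?i4.
cmd_step.
apply: (wp_while (I := fun st' r' => core st' /\ exists j,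
  [/\ ivar st' vLen = j /\ j <= l, ivar st' vY = q j.+1, ivar st' vE = e j,
      rvar st' xX = x j.+1 /\ (forall i, 0 < i <= j ->
    [/\ iarr st' aQ i = q i, iarr st' aPos (q i) = i & rarr st' rX i = x i]) &
      r <= r' + 60 * j + 30])).
- by move=> st' r' [_ [j [[_ ?] _ _ _ ?]]] /=; nat_lia.
- move=> st' r1 r2 [co' [j [[El le_j] Ey Ee' [Ex data] le_r']]].
  have [[j0 j1 j2 j3 j4] dead' prt' idE' row' hE'] := co'.
  have lt_q' := lt_q j.+1 le_j; have lt_ej := edge j le_j.
  cmd_simpl; rewrite Ey leqn0 => /eqP npor Er.
  have {}npor : ~~ por (q j.+1) by rewrite prt' // npor.
  have lt_jl : j < l.
    by rewrite ltn_neqAle le_j andbT; apply/eqP => Ej; rewrite Ej por_end in npor.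
  have Aq : A (q j.+1) by apply: (arc_core porA deg2 por_c lt_e0 live_e0 free); nat_lia.
  have lt_ej' := edge j.+1 lt_jl; have lt_q2 := lt_q j.+2 ltac:(nat_lia).
  have Hids := idE' _ Aq.
  do 4 (cmd_step; rewrite ?El ?Ey ?addn1 ?Ex; try by nat_lia).
  cmd_step; rewrite ?Ey ?Hids ?Ee' -?aeS; try by nat_lia.
  cmd_step; rewrite ?j2 ?j3 ?Ey -?/(opp N (e j.+1) (q j.+1)) -?avS; try by nat_lia.
  cmd_step.
  split.
    by case: co' => [[? ? ? ? ?] ? ? ? ? ?]; split=> //; split.
  exists j.+1; split; cmd_simpl => //.
  - rewrite Ex j4 ?Hids ?Ee' -?aeS -alenS; split=> // i i_bd.
    have [->|ne_i] := eqVneq i j.+1; first by rewrite !upd_same.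
    have [|qi pi xi] := data i; first by nat_lia.
    (* The vertices of the arc are distinct, so the new entry of [aPos] overwrites none of this
       arc. *)
    have nq : (q i == q j.+1) = false.
      apply/eqP; apply: (arc_inj porA deg2 por_c lt_e0 live_e0 free); nat_lia.
    by rewrite !upd_neq // (negbTE ne_i).
  - by nat_lia.
- move=> st' r1 r2 [co' [j [[El le_j] Ey Ee' [Ex data] le_r']]].
  have [inp' dead' prt' idE' row' hE'] := co'.
  cmd_simpl; rewrite Ey -ltnNge => por_q Er F.
  have {}por_q : por (q j.+1) by rewrite prt' // lt_q.
  have Ej : j = l.
    apply/eqP; rewrite eqn_leq le_j leqNgt; apply/negP => lt_jl.
    by have := free (i := j.+1) lt_jl; rewrite por_q.
  apply: HQ => //; last by nat_lia.
  by rewrite -Ej; split.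
- split; first by split=> //; split.
  by exists 0; split; cmd_simpl; rewrite ?alenS ?add0r //; [split=> // i; nat_lia | nat_lia].
Qed.

(** Position 0 is a neutral entry and not the portal [c], whose pairs are treated with the rows of
    the portals. *)
Definition yval i := if i is 0 then 0%R else (x i + h (q i))%R.
Definition zval i := (x l.+1 - x i + h (q i))%R.

Definition prefixes st := forall t, t <= l ->
  top_two yval t (iarr st aArg t) (rarr st rTop t) (rarr st rSnd t).

Definition suffixes st := forall i, 0 < i <= l.+1 ->
  suffix_max zval l i (rarr st rSuf i).

Lemma wp_arc_prefix st r Q :
  core st -> arc_data c e0 l st -> 120 * l + 100 <= r ->
  (forall st' r', frame arc_prefix st st' -> prefixes st' ->
     r <= r' + 120 * l + 100 -> Q st' r') ->
  wp w arc_prefix st r Q.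
Proof.
move=> co ad le_r HQ; have [n2 fn fnn fm fmm] := fit.
have lt_l : l < n := arc_free_lt geo porA deg2 por_c lt_e0 live_e0 free.
apply: wp_frame; do 3 cmd_step.
apply: (wp_for (b := l) (I := fun j st' r' => [/\ core st', arc_data c e0 l st',
  (forall t, t <= j -> top_two yval t (iarr st' aArg t) (rarr st' rTop t) (rarr st' rSnd t)) &
  rc1 <= r' + 110 * j + (9 * l + 7)])) => //.
- exact: ad_len ad.
- by nat_lia.
- by nat_lia.
- move=> j st' r' lt_jl Ej El [co' ad' tops le_r'].
  have [aqE _ rXE] := ad_q ad' (i := j.+1) ltac:(nat_lia); have hE := co_h co'.
  have tj := tops j (leqnn j); have le_arg := tt_arg tj.
  cmd_step; rewrite ?Ej !addn1 rXE aqE hE.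
  apply: wp_if; cmd_simpl; first by nat_lia.
  + rewrite Ej => le_top r2 Er2.
    do 2 (cmd_step; rewrite ?Ej ?addn1; try by nat_lia).
    cmd_step; rewrite ?Ej.
    apply: wp_seq; apply: wp_maximize; cmd_simpl; first by nat_lia.
    move=> rv r3 rvE rvF le_r3.
    cmd_step; rewrite ?Ej ?addn1; try by nat_lia.
    split; cmd_simpl; [by keep co' | | | by nat_lia].
      by keep ad'; cmd_simpl; rewrite rvF.
    move=> t le_t; have [->|ne_t] := eqVneq t j.+1.
      rewrite !upd_same rvE; upd_simpl.
      exact: top_two_keep tj le_top.
    by rewrite !upd_neq ?(negbTE ne_t) //; apply: tops; nat_lia.
  + rewrite Ej -ltNge => lt_top r2 Er2.
    do 3 (cmd_step; rewrite ?Ej ?addn1; try by nat_lia).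
    split; cmd_simpl; [by keep co' | by keep ad' | | by nat_lia].
    move=> t le_t; have [->|ne_t] := eqVneq t j.+1.
      have nj : (j == j.+1) = false by nat_lia.
      rewrite !upd_same (upd_neq _ _ nj).
      apply: (@top_two_new _ yval _ (iarr st' 12 j) (rarr st' 5 j) (rarr st' 6 j)) => //.
    by rewrite !upd_neq ?(negbTE ne_t) //; apply: tops; nat_lia.
- move=> st' r' Ej F' [co' ad' tops le_r'] F.
  by apply: HQ => //; nat_lia.
- split; cmd_simpl; [by keep co | by keep ad | | by nat_lia].
  move=> t; rewrite leqn0 => /eqP->; rewrite !upd_same; split=> // [i|i|].
  + by rewrite leqn0 => /eqP->.
  + by rewrite leqn0 => /eqP->.
  + by left.
Qed.

Lemma wp_arc_suffix st r Q :
  core st -> arc_data c e0 l st -> 120 * l + 100 <= r ->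
  (forall st' r', frame arc_suffix st st' -> suffixes st' ->
     r <= r' + 120 * l + 100 -> Q st' r') ->
  wp w arc_suffix st r Q.
Proof.
move=> co ad le_r HQ; have [n2 fn fnn fm fmm] := fit.
have lt_l : l < n := arc_free_lt geo porA deg2 por_c lt_e0 live_e0 free.
have El := ad_len ad.
apply: wp_frame; cmd_step; rewrite ?El; try by nat_lia.
apply: (wp_for (b := l) (I := fun j st' r' => [/\ core st', arc_data c e0 l st',
  (forall i, l - j < i <= l.+1 -> suffix_max zval l i (rarr st' rSuf i)) &
  rc <= r' + 110 * j + (9 * l + 7)])) => //.
- by nat_lia.
- by nat_lia.
- move=> j st' r' lt_jl Ej El' [co' ad' sufs le_r'].
  have [aqE _ rXE] := ad_q ad' (i := l - j) ltac:(nat_lia); have hE := co_h co'.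
  have Ex := ad_x ad'.
  cmd_step; rewrite ?Ej ?El'; try by nat_lia.
  cmd_step; rewrite ?Ex rXE aqE hE.
  cmd_step.
  apply: wp_seq; apply: wp_maximize; cmd_simpl; first by nat_lia.
  move=> rv r3 rvE rvF le_r3.
  cmd_step; try by nat_lia.
  split; cmd_simpl; [by keep co' | | | by nat_lia].
    by keep ad'; cmd_simpl; rewrite rvF.
  move=> i i_bd; have [Ei|ne_i] := eqVneq i (l - j).
    rewrite Ei upd_same rvE; upd_simpl.
    by apply: suffix_max_cons; [nat_lia | rewrite addn1; apply: sufs; nat_lia].
  by rewrite !upd_neq ?(negbTE ne_i) //; apply: sufs; nat_lia.
- move=> st' r' Ej F' [co' ad' sufs le_r'] F.
  by apply: HQ => //; [move=> i i_bd; apply: sufs; nat_lia | nat_lia].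
- split; cmd_simpl; [by keep co | by keep ad | | by nat_lia].
  move=> i i_bd; have -> : i = l + 1 by nat_lia.
  by rewrite upd_same; split=> [k|]; [nat_lia | left].
Qed.

Lemma on_arc_inj u j k : on_arc N A c e0 l u j -> on_arc N A c e0 l u k -> j = k.
Proof.
move=> [le_j ju] [le_k ku]; move: ju ku; case: eqP => [->|nj]; case: eqP => [->|nk] //.
- by move=> H Ek; case: (H k) => //; nat_lia.
- by move=> Ej H; case: (H j) => //; nat_lia.
move=> Ej Ek; apply/eqP; apply: contraT => ne_jk.
have inj := arc_inj porA deg2 por_c lt_e0 live_e0 free.
have [lt_jk|le_kj] := ltnP j k.
  by case: (inj j k) => //; [nat_lia | rewrite Ej].
by case: (inj k j) => //; [nat_lia | rewrite Ej].
Qed.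

Lemma on_arc_other u j i : on_arc N A c e0 l u j -> 0 < i <= l -> i <> j -> u <> q i.
Proof.
move=> ju i_bd ne_ij Eu; case: ne_ij; apply: (@on_arc_inj u) => //.
by split; [nat_lia | case: eqP; [nat_lia | ]].
Qed.

Section Query.
Variables (u j lo : nat) (top snd suf : R) (arg : nat).
Hypothesis Au : A u.
Hypothesis uj : on_arc N A c e0 l u j.
Local Notation al := (arc_offset N d A c e0 u j).
Local Notation be := (d (q l.+1) u).
Local Notation hi := lo.+1.
Hypothesis le_lo : lo <= l.
Hypothesis lo_ok : 0 < lo -> (al + x lo <= be + (x l.+1 - x lo))%R.
Hypothesis hi_ok : hi <= l -> (be + (x l.+1 - x hi) < al + x hi)%R.
Hypothesis tops : top_two yval lo arg top snd.
Hypothesis sufs : suffix_max zval l hi suf.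

(** Positions increase, so the comparison that holds at [lo] holds before it, and either branch of
    [arc_lower] puts [al + x i] below the distance. The entry of [u] is avoided because [h u + h u]
    is the weight of no pair. *)
Lemma query_prefix_sound X : bounds X ->
  (h u + (al + (if arg == j then snd else top)) <= X)%R.
Proof.
move=> UB; have Aq := arc_core porA deg2 por_c lt_e0 live_e0 free.
have [sent0 sent] : (h u <= X)%R /\ (h u + d c u <= X)%R.
  have := @sentinel X u c UB Au (porA por_c).
  have := metric_ge0 dM (geo.1 _ Au) (geo.1 _ (porA por_c)).
  by rewrite (metric_sym dM (geo.1 _ Au) (geo.1 _ (porA por_c))); split; lra.
(* No second candidate: for [j = 0] this is the distance to the portal [c]; otherwise the offset
   [- x j] is not positive and [h u] alone is below the bound. *)
have none : (h u + (al + 0) <= X)%R.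
  rewrite addr0 /arc_offset; case: eqP => // _.
  have [le_j _] := uj.
  by have := alen_le deg2 lt_e0 live_e0 free (i := 0) (j := j) ltac:(nat_lia); rewrite alen0; lra.
have some i : 0 < i <= lo -> i <> j -> (h u + (al + yval i) <= X)%R.
  move=> i_bd ne_ij; have i_bdl : 0 < i <= l by nat_lia.
  have := arc_lower dM geo porA deg2 por_c lt_e0 live_e0 free Au uj i_bdl.
  have := lo_ok ltac:(nat_lia).
  have := alen_le deg2 lt_e0 live_e0 free (i := i) (j := lo) ltac:(nat_lia).
  have := pruned_bound UB Au (Aq i ltac:(nat_lia)) (on_arc_other uj i_bdl ne_ij).
  case: i i_bd ne_ij i_bdl => // i _ _ _; rewrite /yval.
  by move=> ? ? ? [?|?]; lra.
have y0 : yval 0 = 0%R by [].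
case: eqP => [Ea|ne_arg].
  by case: (tt_att tops) => [->|[i i_bd [ne_i ->]]]; [exact: none | apply: some; rewrite // -Ea].
rewrite (tt_top tops); have [a0|a_gt0] := posnP arg; first by rewrite a0 y0.
by apply: some => //; have := tt_arg tops; nat_lia.
Qed.

Lemma query_suffix_sound X : bounds X -> (h u + (be + suf) <= X)%R.
Proof.
move=> UB; have Aq := arc_core porA deg2 por_c lt_e0 live_e0 free.
have At := porA por_end; have lt_u := geo.1 _ Au; have lt_t := geo.1 _ At.
case: sufs => _ [->|[k k_bd ->]].
  by rewrite addr0 (metric_sym dM lt_t lt_u); apply: sentinel.
have k_bdl : 0 < k <= l by nat_lia.
have mono_k := alen_le deg2 lt_e0 live_e0 free (i := hi) (j := k) ltac:(nat_lia).
have mono_l := alen_le deg2 lt_e0 live_e0 free (i := k) (j := l.+1) ltac:(nat_lia).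
have hi_lt := hi_ok ltac:(nat_lia).
(* The vertex [u] is never in the suffix: there [al + x hi] would be at most 0, while [hi_ok] makes
   it exceed a nonnegative quantity. Hence the suffix maxima keep a single value. *)
have ne_kj : k <> j.
  move=> Ekj; have := metric_ge0 dM lt_t lt_u.
  by move: hi_lt; rewrite /arc_offset -Ekj; case: eqP; [nat_lia | lra].
have := arc_lower dM geo porA deg2 por_c lt_e0 live_e0 free Au uj k_bdl.
have := pruned_bound UB Au (Aq k ltac:(nat_lia)) (on_arc_other uj k_bdl ne_kj).
by rewrite /zval => ? [?|?]; lra.
Qed.

(** Both terms bound the distance from above, so it does not matter on which side of the split [i]
    falls; being different from [j], it survives the exclusion of [u]. *)
Lemma query_complete i : j < i <= l ->
  (h u + h (q i) + d u (q i) <=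
   Num.max (h u + (al + (if arg == j then snd else top))) (h u + (be + suf)))%R.
Proof.
move=> i_bd; have [le_al le_be] := arc_upper dM geo porA deg2 por_c lt_e0 live_e0 free Au uj i_bd.
rewrite le_max; apply/orP; have [le_i|lt_i] := leqP i lo.
  left; suff : (yval i <= if arg == j then snd else top)%R.
    case: i i_bd le_al {le_be le_i} => [|i] i_bd; first by nat_lia.
    by rewrite /yval; lra.
  case: eqP => [Ea|_]; last exact: (tt_max tops).
  by apply: (tt_snd tops) => //; nat_lia.
right; have := sufs.1 i ltac:(nat_lia); rewrite /zval; lra.
Qed.

End Query.

Lemma wp_arc_split st r Q :
  core st -> arc_data c e0 l st -> 80 * lam + 100 <= r ->
  (forall st' r' lo, frame arc_split st st' ->
     ivar st' vLo = lo -> ivar st' vHi = lo.+1 -> lo <= l ->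
     (0 < lo -> (rvar st xA + x lo <= rvar st xB + (x l.+1 - x lo))%R) ->
     (lo.+1 <= l -> (rvar st xB + (x l.+1 - x lo.+1) < rvar st xA + x lo.+1)%R) ->
     r <= r' + 80 * lam + 100 -> Q st' r') ->
  wp w arc_split st r Q.
Proof.
move=> co ad le_r HQ; have [n2 fn fnn fm fmm] := fit.
have lt_l : l < n := arc_free_lt geo porA deg2 por_c lt_e0 live_e0 free.
have El := ad_len ad.
apply: wp_frame; cmd_step.
cmd_step; rewrite ?El; try by nat_lia.
apply: (wp_while (I := fun st' r' => [/\ core st', arc_data c e0 l st',
  rvar st' xA = rvar st xA /\ rvar st' xB = rvar st xB &
  exists lo hi p, [/\ ivar st' vLo = lo /\ ivar st' vHi = hi, lo < hi <= l.+1,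
    (0 < lo -> (rvar st xA + x lo <= rvar st xB + (x l.+1 - x lo))%R),
    (hi <= l -> (rvar st xB + (x l.+1 - x hi) < rvar st xA + x hi)%R) &
    hi - lo <= 2 ^ p /\ r + 80 * p <= r' + 80 * lam + 30]])).
- by move=> st' r' [_ _ _ [lo [hi [p [_ _ _ _ [_ ?]]]]]] /=; nat_lia.
- move=> st' r1 r2 [co' ad' [EA EB] [lo [hi [p [[Elo Ehi] bd lo_ok hi_ok [le_p le_r']]]]]].
  cmd_simpl; rewrite Elo Ehi => gap Er.
  case: p le_p le_r' => [|p] le_p le_r'; first by nat_lia.
  rewrite expnS in le_p.
  cmd_step; rewrite ?Elo ?Ehi; try by nat_lia.
  set mid := (lo + hi) %/ 2.
  have mid_bd : lo < mid < hi by rewrite /mid; nat_lia.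
  have [_ _ rXE] := ad_q ad' (i := mid) ltac:(nat_lia).
  apply: wp_if; cmd_simpl; first by nat_lia.
  + rewrite rXE EA EB (ad_x ad') => le_mid r3 Er3.
    cmd_step; try by nat_lia.
    split; cmd_simpl; [by keep co' | by keep ad' | by [] |].
    exists mid, hi, p; split=> //; first by nat_lia.
    by rewrite /mid; nat_lia.
  + rewrite rXE EA EB (ad_x ad') -ltNge => lt_mid r3 Er3.
    cmd_step; try by nat_lia.
    split; cmd_simpl; [by keep co' | by keep ad' | by [] |].
    exists lo, mid, p; split=> //; first by nat_lia.
    by rewrite /mid; nat_lia.
- move=> st' r1 r2 [co' ad' [EA EB] [lo [hi [p [[Elo Ehi] bd lo_ok hi_ok [le_p le_r']]]]]].
  cmd_simpl; rewrite Elo Ehi -ltnNge => gap Er F.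
  have Ehi' : hi = lo.+1 by nat_lia.
  rewrite Ehi' in hi_ok Ehi.
  by apply: (HQ _ _ lo) => //; nat_lia.
- split; cmd_simpl; [by keep co | by keep ad | by [] |].
  (* The initial gap is at most [n], which is below [2 ^ lam], so [lam] halvings are enough. *)
  exists 0, (l + 1), lam; split=> //; try nat_lia.
Qed.

Lemma wp_arc_query u st r Q :
  core st -> arc_data c e0 l st -> prefixes st -> suffixes st ->
  ivar st vU = u -> A u -> ivar st vP = c ->
  (forall X, bounds X -> (rvar st xD <= X)%R) -> 80 * lam + 400 <= r ->
  (forall st' r', frame arc_query st st' ->
     (forall X, bounds X -> (rvar st' xD <= X)%R) ->
     (rvar st xD <= rvar st' xD)%R ->
     (forall j i, on_arc N A c e0 l u j -> j < i <= l ->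
        (h u + h (q i) + d u (q i) <= rvar st' xD)%R) ->
     r <= r' + 80 * lam + 400 -> Q st' r') ->
  wp w arc_query st r Q.
Proof.
move=> co ad pre suf Eu Au Ec below le_r HQ; have [n2 fn fnn fm fmm] := fit.
have lt_l : l < n := arc_free_lt geo porA deg2 por_c lt_e0 live_e0 free.
have lt_u := geo.1 _ Au; have E0 := inp_n (co_input co).
have El := ad_len ad.
apply: wp_frame; apply: wp_seq.
apply: (wp_weaken (Q := fun st1 r1 => [/\ core st1, arc_data c e0 l st1,
   [/\ prefixes st1, suffixes st1, ivar st1 vU = u & rvar st1 xD = rvar st xD],
   (exists j, [/\ on_arc N A c e0 l u j, ivar st1 vIn = j &
      rvar st1 xA = arc_offset N d A c e0 u j]) & r <= r1 + 60])).
  move=> st1 r1 [co1 ad1 [pre1 suf1 Eu1 ED1] [j [uj Ej Eal]] le_r1].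
  have por_t := por_end; have lt_t := geo.1 _ (porA por_t).
  cmd_step; rewrite (inp_n (co_input co1)) Eu1 (ad_y ad1) (co_rows co1) //.
  apply: wp_seq; apply: wp_arc_split; cmd_simpl; [by keep co1 | by keep ad1 | by nat_lia |].
  move=> st2 r2 lo F2 Elo Ehi le_lo lo_ok hi_ok le_r2.
  have [fi2 fa2 frv2 fra2] := F2.
  have Ej2 : ivar st2 vIn = j by rewrite fi2.
  have Eu2 : ivar st2 vU = u by rewrite fi2.
  have EA2 : rvar st2 xA = arc_offset N d A c e0 u j by rewrite frv2.
  have EB2 : rvar st2 xB = d (q l.+1) u by rewrite frv2.
  have EH2 : rarr st2 rH = h by rewrite fra2 //= (co_h co1).
  have ED2 : rvar st2 xD = rvar st xD by rewrite frv2.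
  have tops : top_two yval lo (iarr st2 aArg lo) (rarr st2 rTop lo) (rarr st2 rSnd lo).
    by rewrite fa2 // !fra2 //; apply: pre1.
  have sufs : suffix_max zval l lo.+1 (rarr st2 rSuf lo.+1).
    by rewrite fra2 //; apply: suf1; nat_lia.
  move: lo_ok hi_ok; cmd_simpl; rewrite Eal => lo_ok hi_ok.
  apply: wp_seq; apply: (wp_weaken (Q := fun st3 r3 => [/\ 
     st3 = State (ivar st2) (iarr st2) (upd (rvar st2) xM (if iarr st2 aArg lo == j
       then rarr st2 rSnd lo else rarr st2 rTop lo)) (rarr st2) & r2 <= r3 + 20])); last first.
    apply: wp_if; cmd_simpl; rewrite ?Elo ?Ej2; first by nat_lia.
    - move=> Ea r3 Er3; cmd_step; rewrite Elo; split; last by nat_lia.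
      by rewrite (_ : _ == j) //; nat_lia.
    - move=> Ea r3 Er3; cmd_step; rewrite Elo; split; last by nat_lia.
      by rewrite (_ : (_ == j) = false) //; nat_lia.
  move=> st3 r3 [-> le_r3].
  apply: wp_seq; apply: wp_maximize; cmd_simpl; first by nat_lia.
  rewrite Eu2 EH2 EA2 ED2 => rv4 r4 rv4E rv4F le_r4.
  apply: wp_maximize; cmd_simpl; first by nat_lia.
  rewrite Eu2 EH2 Ehi (rv4F xB) //; upd_simpl; rewrite EB2.
  move=> rv5 r5 rv5E rv5F le_r5 F.
  apply: HQ => //; cmd_simpl; rewrite ?rv5E ?rv4E.
  - move=> X UB; rewrite !ge_max below //=.
    by rewrite (query_prefix_sound Au uj le_lo lo_ok hi_ok tops) //
         (query_suffix_sound Au uj le_lo lo_ok hi_ok sufs).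
  - by rewrite !le_max lexx.
  - move=> k i uk i_bd; rewrite -maxA le_max.
    rewrite (query_complete Au uj le_lo lo_ok hi_ok tops sufs) ?orbT //.
    by rewrite (on_arc_inj uj uk).
  - by nat_lia.
have row_c : rarr st rDT (c * n + u) = d c u by apply: (co_rows co).
apply: wp_if; cmd_simpl; rewrite ?Eu ?El; first by nat_lia.
- case/and3P=> p_gt0 le_p /andP[q1 q2] r1 Er1.
  cmd_step; rewrite ?Eu; try by nat_lia.
  cmd_step.
  have [qE pE xE] := ad_q ad (i := iarr st aPos u) ltac:(nat_lia).
  have Eq : q (iarr st aPos u) = u by rewrite -qE; nat_lia.
  split; cmd_simpl; [by keep co | by keep ad | by [] | | by nat_lia].
  exists (iarr st aPos u); split=> //.
    by split=> //; case: eqP => //; nat_lia.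
  by rewrite xE sub0r /arc_offset; case: eqP => //; nat_lia.
- move=> off r1 Er1; cmd_step.
  cmd_step; rewrite ?E0 ?Eu ?Ec.
  split; cmd_simpl; [by keep co | by keep ad | by [] | | by nat_lia].
  (* Were [u] the inner vertex [q i], its entry in [aPos] would be [i] and the test would have
     succeeded. *)
  exists 0; split=> //; split=> //= i i_bd Ei.
  have [qE pE xE] := ad_q ad i_bd; rewrite Ei in pE.
  by move: off; rewrite pE qE Ei; nat_lia.
Qed.

Lemma arc_data_frame cmd st st' :
  frame cmd st st' -> arc_data c e0 l st ->
  all [predC mem (ivars cmd)] [:: vLen; vY] -> xX \notin rvars cmd ->
  all [predC mem (iarrs cmd)] [:: aQ; aPos] -> rX \notin rarrs cmd ->
  arc_data c e0 l st'.
Proof.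
move=> [fi fa frv fra] [El Ey Ex Eq] /= /and3P[a1 a2 _] b1 /and3P[c1 c2 _] e1.
by split; rewrite ?fi ?frv ?fa ?fra.
Qed.

Lemma wp_arc_queries st r Q :
  core st -> arc_data c e0 l st -> prefixes st -> suffixes st -> ivar st vP = c ->
  (forall X, bounds X -> (rvar st xD <= X)%R) -> n * (80 * lam + 450) + 100 <= r ->
  (forall st' r', core st' ->
     (forall X, bounds X -> (rvar st' xD <= X)%R) ->
     (rvar st xD <= rvar st' xD)%R ->
     (forall u j i, A u -> on_arc N A c e0 l u j -> j < i <= l ->
        (h u + h (q i) + d u (q i) <= rvar st' xD)%R) ->
     r <= r' + n * (80 * lam + 450) + 100 -> Q st' r') ->
  wp w (For vU vN (If (BLeI (IGet aDead (IVar vU)) (IConst 0)) arc_query Skip)) st r Q.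
Proof.
move=> co ad pre suf Ec below le_r HQ; have [n2 fn fnn fm fmm] := fit.
apply: (wp_for (b := n) (I := fun k st' r' =>
  [/\ core st' /\ arc_data c e0 l st', prefixes st' /\ suffixes st',
      ivar st' vP = c /\ (forall X, bounds X -> (rvar st' xD <= X)%R),
      (rvar st xD <= rvar st' xD)%R /\ (forall u j i, u < k -> A u ->
        on_arc N A c e0 l u j -> j < i <= l ->
        (h u + h (q i) + d u (q i) <= rvar st' xD)%R) &
      r <= r' + k * (80 * lam + 420) + (9 * n + 7)])) => //.
- exact: inp_n (co_input co).
- by nat_lia.
- by nia.
- move=> k st' r' lt_k Ek En [[co' ad'] [pre' suf'] [Ec' below'] [le_D done] le_r'].
  have le_k : k.+1 * (80 * lam + 420) <= n * (80 * lam + 420) by rewrite leq_mul2r lt_k orbT.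
  have cost : n * (80 * lam + 450) = n * (80 * lam + 420) + 30 * n by nia.
  have kS : k.+1 * (80 * lam + 420) = k * (80 * lam + 420) + (80 * lam + 420) by nia.
  have deadE := co_dead co' lt_k.
  apply: wp_if; cmd_simpl; first by nat_lia.
  + rewrite Ek leqn0 -deadE => Ak r1 Er1; apply: wp_frame.
    apply: (wp_arc_query co' ad' pre' suf' Ek Ak Ec' below'); first by nat_lia.
    move=> st2 r2 F below2 le_D2 done2 le_r2 _.
    have co2 : core st2 by apply: (core_frame F co').
    have ad2 : arc_data c e0 l st2 by apply: (arc_data_frame F ad').
    have [fi fa _ fra] := F.
    split; cmd_simpl.
    * by split; [keep co2 | keep ad2].
    * by split=> i i_bd; rewrite /= ?fa ?fra //; [apply: pre' | apply: suf'].
    * by rewrite fi.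
    * split; first exact: le_trans le_D2.
      move=> u j i; rewrite ltnS leq_eqVlt => /orP[/eqP->|lt_u] Au uj i_bd.
        exact: (done2 j).
      by apply: le_trans le_D2; apply: (done u j).
    * by nat_lia.
  + rewrite Ek -ltnNge lt0n -deadE => nAk r1 Er1; cmd_step.
    split; cmd_simpl.
    * by split; [keep co' | keep ad'].
    * by [].
    * by [].
    * split=> // u j i; rewrite ltnS leq_eqVlt => /orP[/eqP->|lt_u] Au.
        by rewrite Au in nAk.
      exact: (done u j).
    * by nat_lia.
- move=> st' r' En F [[co' ad'] _ [_ below'] [le_D done] le_r'].
  apply: HQ => //; last by nia.
  by move=> u j i Au; apply: (done u j) => //; apply: geo.1.
- split; cmd_simpl => //; last by nat_lia.
  by split; [keep co | keep ad].
Qed.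

End OneArc.
Definition arc_done D c e0 := forall l u j i,
  arc_free N A por c e0 l -> por (av c e0 l.+1) -> A u ->
  on_arc N A c e0 l u j -> j < i <= l ->
  (h u + h (av c e0 i) + d u (av c e0 i) <= D)%R.

Definition arc_cost := n * (80 * lam + 800) + 500.

Lemma wp_arc_body c e0 st r Q :
  core st -> ivar st vP = c -> ivar st vK = e0 -> e0 < m -> inc N e0 c ->
  (forall X, bounds X -> (rvar st xD <= X)%R) ->
  (por c && live N A e0 c) * arc_cost + 50 <= r ->
  (forall st' r', frame arc_body st st' -> core st' ->
     (forall X, bounds X -> (rvar st' xD <= X)%R) ->
     (rvar st xD <= rvar st' xD)%R ->
     (por c -> live N A e0 c -> arc_done (rvar st' xD) c e0) ->
     r <= r' + (por c && live N A e0 c) * arc_cost + 50 -> Q st' r') ->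
  wp w arc_body st r Q.
Proof.
move=> co Ec Ee lt_e inc_c below le_r HQ.
have [[i0 i1 i2 i3 i4] dead prt idE row hE] := co.
have lt_c := inc_lt lt_e inc_c; have lt_a := ea_lt lt_e; have lt_b := eb_lt lt_e.
have testE : por c && live N A e0 c =
    [&& 0 < iarr st aPor c, iarr st aDead (ea N e0) <= 0 & iarr st aDead (eb N e0) <= 0].
  by rewrite /live inc_c -prt // !leqn0 -!dead.
apply: wp_frame; apply: wp_if; cmd_simpl; rewrite ?Ec ?Ee ?i2 ?i3 -?testE.
- by nat_lia.
- move=> test r1 Er1; rewrite test mul1n /arc_cost in le_r HQ.
  have /andP[por_c live_c] := test.
  have [l free por_l] := arc_end geo porA deg2 por_c lt_e live_c.
  have lt_l : l < n := arc_free_lt geo porA deg2 por_c lt_e live_c free.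
  have cost : n * (80 * lam + 800) = n * (80 * lam + 450) + 350 * n by nia.
  apply: wp_seq; apply: (wp_arc_walk por_c lt_e live_c free por_l co Ec Ee).
    by nat_lia.
  move=> st2 r2 F2 ad2 le_r2; have co2 : core st2 by apply: (core_frame F2 co).
  apply: wp_seq; apply: (wp_arc_prefix por_c lt_e live_c free co2 ad2).
    by nat_lia.
  move=> st3 r3 F3 pre3 le_r3; have co3 : core st3 by apply: (core_frame F3 co2).
  have ad3 : arc_data c e0 l st3 by apply: (arc_data_frame F3 ad2).
  apply: wp_seq; apply: (wp_arc_suffix por_c lt_e live_c free co3 ad3).
    by nat_lia.
  move=> st4 r4 F4 suf4 le_r4; have co4 : core st4 by apply: (core_frame F4 co3).
  have ad4 : arc_data c e0 l st4 by apply: (arc_data_frame F4 ad3).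
  have pre4 : prefixes c e0 l st4.
    by case: F4 => _ fa _ fra t le_t; rewrite fa // !fra //; apply: pre3.
  have ED4 : rvar st4 xD = rvar st xD.
    by case: F2 F3 F4 => [_ _ f2 _] [_ _ f3 _] [_ _ f4 _]; rewrite f4 // f3 // f2.
  apply: (wp_arc_queries por_c lt_e live_c free por_l co4 ad4 pre4 suf4).
  + case: F2 F3 F4 => [f2 _ _ _] [f3 _ _ _] [f4 _ _ _].
    by rewrite f4 // f3 // f2.
  + by rewrite ED4.
  + by nat_lia.
  rewrite ED4 => st5 r5 co5 below5 le_D done le_r5 F.
  apply: HQ => //; last by nat_lia.
  move=> _ _ l' u j i fr' por' Au uj i_bd.
  (* Both numbers locate the first portal met along the arc. *)
  have El : l' = l.
    have [lt_l'|lt_l'|//] := ltngtP l' l.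
      by have /negP[] := free l'.+1 ltac:(nat_lia).
    by have /negP[] := fr' l.+1 ltac:(nat_lia).
  by rewrite El in uj i_bd; apply: (done u j i).
- move=> test r1 Er1; cmd_step; move=> F.
  rewrite (negbTE test) in le_r HQ.
  apply: HQ => //; last by nat_lia.
  by move=> por_c live_c; rewrite por_c live_c in test.
Qed.

Definition narcs k :=
  \sum_(0 <= f < k) ((por (ea N f) && live N A f (ea N f)) +
                     (por (eb N f) && live N A f (eb N f))).

Lemma wp_arcs st r Q :
  core st -> (forall X, bounds X -> (rvar st xD <= X)%R) ->
  narcs m * arc_cost + 200 * m + 200 <= r ->
  (forall st' r', core st' -> (forall X, bounds X -> (rvar st' xD <= X)%R) ->
     (rvar st xD <= rvar st' xD)%R ->
     (forall c f, por c -> f < m -> live N A f c -> arc_done (rvar st' xD) c f) ->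
     r <= r' + narcs m * arc_cost + 200 * m + 200 -> Q st' r') ->
  wp w arcs st r Q.
Proof.
move=> co below le_r HQ; have [n2 fn fnn fm fmm] := fit.
apply: (wp_for (b := m) (I := fun k st' r' =>
  [/\ core st', (forall X, bounds X -> (rvar st' xD <= X)%R),
     (rvar st xD <= rvar st' xD)%R,
     (forall c f, por c -> f < k -> live N A f c -> arc_done (rvar st' xD) c f) &
     r <= r' + narcs k * arc_cost + 120 * k + (9 * m + 7)])) => //.
- exact: inp_m (co_input co).
- by nat_lia.
- by nat_lia.
- move=> k st' r' lt_k Ek Em [co' below' le_D done le_r'].
  have narcsS : narcs k.+1 = narcs k +
      ((por (ea N k) && live N A k (ea N k)) + (por (eb N k) && live N A k (eb N k))).
    by rewrite /narcs big_nat_recr.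
  have le_narcs : narcs k.+1 * arc_cost <= narcs m * arc_cost.
    rewrite leq_mul2r /narcs (@big_cat_nat _ _ _ k.+1 0 m) //=.
    by rewrite leq_addr orbT.
  rewrite narcsS !mulnDl in le_narcs *.
  have [ia ib] : inc N k (ea N k) /\ inc N k (eb N k) by rewrite /inc !eqxx orbT.
  have lt_a := ea_lt lt_k; have lt_b := eb_lt lt_k.
  cmd_step; rewrite ?Ek ?(inp_ea (co_input co')); try by nat_lia.
  apply: wp_seq; apply: (wp_arc_body (c := ea N k) (e0 := k)) => //=; upd_simpl => //.
  + by keep co'.
  + by nat_lia.
  move=> st2 r2 F2 co2 below2 le_D2 done2 le_r2.
  have Ek2 : ivar st2 vK = k by case: F2 => [fi _ _ _]; rewrite fi.
  cmd_step; rewrite ?Ek2 ?(inp_eb (co_input co2)); try by nat_lia.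
  apply: (wp_arc_body (c := eb N k) (e0 := k)) => //=; upd_simpl => //.
  + by keep co2.
  + by nat_lia.
  move=> st3 r3 F3 co3 below3 le_D3 done3 le_r3.
  have weak D D' c f : (D <= D')%R -> arc_done D c f -> arc_done D' c f.
    by move=> le_DD H l u j i *; apply: le_trans le_DD; apply: (H l u j i).
  split; cmd_simpl => //.
  + by keep co3.
  + by rewrite (le_trans le_D) // (le_trans le_D2).
  + move=> c f por_c; rewrite ltnS leq_eqVlt => /orP[/eqP->|lt_f] live_f; last first.
      by apply: weak (done c f por_c lt_f live_f); apply: le_trans le_D3.
    have [/orP[/eqP E|/eqP E] _ _] := live_opp live_f; rewrite -E in por_c live_f *.
      by apply: weak (done2 por_c live_f).
    exact: done3.
  + by nat_lia.
- move=> st' r' Em F [co' below' le_D done le_r'].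
  by apply: HQ => //; nat_lia.
- split; cmd_simpl => //; last by nat_lia.
  by keep co.
Qed.

End ArcProgram.

(** * Portals *)

Section Counting.
Variables (R : realFieldType) (N : net R) (d : nat -> nat -> R).
Variables (A : nat -> bool) (z k : nat).
Hypothesis geo : geodesic N d A.
Hypothesis no_leaf : forall v, (v < nv N)%N -> deg N A v <> 1%N.
Hypothesis count : (nlive N A + nv N = nalive N A + ne N)%N.
Hypothesis k_gt0 : (0 < k)%N.
Hypothesis edge_count : ne N = (nv N + k - 1)%N.
Hypothesis Az : A z.
Local Open Scope nat_scope.
Local Notation n := (nv N).
Local Notation m := (ne N).

(** A weighted handshake lemma: weight 1 gives the sum of the degrees, and the indicator of the
    portals gives the number of arcs. *)
Lemma sum_deg_weight (F : nat -> nat) :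
  \sum_(v < n) F v * deg N A v =
  \sum_(0 <= f < m | A (ea N f) && A (eb N f)) (F (ea N f) + F (eb N f)).
Proof.
transitivity (\sum_(v < n) \sum_(0 <= f < m | A (ea N f) && A (eb N f))
    F v * inc N f v).
  apply: eq_bigr => v _; rewrite /deg /deg_upto big_distrr /=.
  rewrite big_mkcond [RHS]big_mkcond; apply: eq_bigr => f _; rewrite /live.
  by case: (inc N f v); case: (A _ && A _); rewrite //= muln0.
rewrite exchange_big /= big_nat_cond [RHS]big_nat_cond.
apply: eq_bigr => f /andP[lt_f _].
have lt_a := ea_lt lt_f; have lt_b := eb_lt lt_f; have ne := ends_neq lt_f.
have ne' : Ordinal lt_b != Ordinal lt_a by apply/eqP => -[] /esym.
rewrite (bigD1 (Ordinal lt_a)) //= (bigD1 (Ordinal lt_b)) //=.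
rewrite /inc !eqxx orbT !muln1 big1 ?addn0 // => v /andP[nva nvb].
move: nva nvb; rewrite -!val_eqE /= ![v == _ :> nat]eq_sym => /negbTE-> /negbTE->.
by rewrite muln0.
Qed.

Lemma nalive_gt0 v : A v -> 0 < nalive N A.
Proof.
move=> Av; have lt_v := geo.1 _ Av; rewrite /nalive big_mkord.
by rewrite (bigD1 (Ordinal lt_v)).
Qed.

Lemma deg_gt0 v f : f < m -> live N A f v -> 0 < deg N A v.
Proof.
move=> lt_f live_f; rewrite degE.
have : f \in live_edges N A v by rewrite mem_live_edges lt_f.
by case: (live_edges N A v).
Qed.

(** In a connected core a vertex of degree 0 is alone, so no edge is live; this contradicts [count],
    as the net has at least as many edges as vertices. *)
Lemma deg_ge2 v : A v -> 2 <= deg N A v.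
Proof.
move=> Av; have lt_v := geo.1 _ Av; have := no_leaf lt_v.
suff : 0 < deg N A v by nat_lia.
rewrite lt0n; apply/negP => /eqP deg0.
have only u : A u -> u = v.
  move=> Au; have [a H _] := geo.2 _ _ Av Au.
  case: H deg0 => {u Au} // v' f u b Av' lt_f inc_f H deg0.
  have [Ao _] := walk_ends H.
  by have := deg_gt0 lt_f (live_intro inc_f Av' Ao); rewrite deg0.
have nlive0 : nlive N A = 0.
  rewrite /nlive big_nat_cond big1 // => f /andP[lt_f /andP[Aa Ab]].
  by case: (ends_neq (e := f) lt_f); rewrite (only _ Aa) (only _ Ab).
by have := nalive_gt0 Av; nat_lia.
Qed.

Lemma alive_neighbor u : A u -> exists2 b, A b & u <> b.
Proof.
move=> Au; have := deg_ge2 Au; rewrite degE.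
have := mem_live_edges N A u; case: (live_edges N A u) => [|f L] // mem _.
have := mem f; rewrite mem_head => /esym/andP[lt_f /live_opp[inc_f _ Ao]].
by exists (opp N f u) => //; apply/nesym/opp_neq.
Qed.

Lemma sum_deg : \sum_(v < n) deg N A v = 2 * nlive N A.
Proof.
under eq_bigr => v _ do rewrite -[deg N A v]mul1n.
rewrite (sum_deg_weight (fun=> 1)) /nlive big_distrr /=.
by apply: eq_bigr.
Qed.

Definition portal v := A v && ((3 <= deg N A v) || (v == z)).

Lemma portal_alive v : portal v -> A v. Proof. by case/andP. Qed.

Lemma portal_z : portal z. Proof. by rewrite /portal Az eqxx orbT. Qed.

Lemma portal_deg2 v : A v -> ~~ portal v -> deg N A v = 2.
Proof. by move=> Av; have := deg_ge2 Av; rewrite /portal Av /=; nat_lia. Qed.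

Lemma nalive_ord : nalive N A = \sum_(v < n) A v.
Proof. by rewrite /nalive big_mkord big_mkcond; apply: eq_bigr => v _; case: (A v). Qed.

Lemma sum_double (F : nat -> bool) : \sum_(v < n) 2 * F v = 2 * \sum_(v < n) F v.
Proof. by rewrite big_distrr. Qed.

Definition nportals i := \sum_(0 <= v < i) portal v.

(** The excess of the degree over 2 pays for a portal; [z], which may have degree 2, gets one unit
    of its own. *)
Lemma deg_split v : v < n -> 2 * A v + portal v <= deg N A v + (v == z).
Proof.
move=> lt_v; rewrite /portal; have [Av|nAv] := boolP (A v); last by [].
by have ge2 := deg_ge2 Av; case: (eqVneq (v : nat) z); case: (ltnP 2 (deg N A v)) => /=; nat_lia.
Qed.

(** Summing [deg_split]: the excess over the core is [2 * (k - 1)], and [z] adds one unit. *)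
Lemma nportals_le : nportals n <= 2 * k.
Proof.
have : \sum_(v < n) (2 * A v + portal v) <= \sum_(v < n) (deg N A v + (v == z :> nat)).
  by apply: leq_sum => v _; apply: deg_split.
rewrite big_split /= (sum_double A) big_split /= -nalive_ord sum_deg /nportals big_mkord.
have -> : \sum_(v < n) (v == z :> nat) = 1.
  rewrite (bigD1 (Ordinal (geo.1 _ Az))) //= eqxx big1 // => v.
  by rewrite -val_eqE /= => /negbTE->.
move: count edge_count k_gt0; move: (\sum_(i < n) _) => p; nat_lia.
Qed.

Lemma nportals_n : nportals n <= n.
Proof.
rewrite /nportals big_mkord -[X in _ <= X]card_ord -sum1_card.
by apply: leq_sum => v _; case: portal.
Qed.

(** A portal starts 2 arcs plus its excess of degree, so there are at most twice [2 * k] arcs plus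
    the total excess [2 * (k - 1)]. *)
Lemma narcs_le : narcs N A portal m <= 6 * k.
Proof.
have -> : narcs N A portal m = \sum_(v < n) portal v * deg N A v.
  apply/esym; rewrite (sum_deg_weight portal); apply/esym.
  rewrite [RHS]big_mkcond /narcs big_nat_cond [RHS]big_nat_cond.
  apply: eq_bigr => f /andP[lt_f _]; rewrite /live /inc !eqxx orbT /=.
  by case: (A _ && A _); rewrite ?andbT ?andbF.
have : \sum_(v < n) (portal v * deg N A v + 2 * A v) <=
    \sum_(v < n) (deg N A v + 2 * portal v).
  apply: leq_sum => v _; rewrite /portal; have [Av|nAv] := boolP (A v); last by [].
  by have ge2 := deg_ge2 Av; case: (eqVneq (v : nat) z); case: (ltnP 2 (deg N A v)) => /=; nat_lia.
rewrite big_split /= (sum_double A) big_split /= (sum_double portal) -nalive_ord sum_deg.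
have := nportals_le; rewrite /nportals big_mkord.
move: count edge_count k_gt0; move: (\sum_(i < n) portal i) => p; nat_lia.
Qed.

End Counting.

Definition portals :=
  (For vU vN
     (If (BLeI (IGet aDead (IVar vU)) (IConst 0))
        (ISet vZ (IVar vU) ;;
         If (BLeI (IConst 3) (IGet aDeg (IVar vU))) (IPut aPor (IVar vU) (IConst 1)) Skip)
        Skip) ;;
   IPut aPor (IVar vZ) (IConst 1))%cmd.

Definition portal_pair :=
  If (BAnd (BLeI (IGet aDead (IVar vJ)) (IConst 0)) (BNot (BEqI (IVar vJ) (IVar vU))))
    (maximize xD (RAdd (RAdd (RGet rH (IVar vU)) (RGet rH (IVar vJ)))
       (RGet rDT (IAdd (IVar vB) (IVar vJ)))))
    Skip.

(** Pruning leaves the adjacency lists alone, so each run covers the whole graph and yields its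
    distances, pruned vertices included. *)
Definition portal_rows :=
  For vU vN
    (If (BLeI (IConst 1) (IGet aPor (IVar vU)))
       (ISet vS (IVar vU) ;; dijkstra ;; For vJ vN portal_pair)%cmd
       Skip).

Section PortalProgram.
Variables (R : realFieldType) (N : net R) (d : nat -> nat -> R) (w : nat).
Variables (A : nat -> bool).
Hypothesis fit : fits N w.
Implicit Types (st : state R) (Q : state R -> nat -> Prop).
Local Open Scope nat_scope.
Local Notation n := (nv N).
Local Notation m := (ne N).

Lemma wp_portals st r Q :
  pstate N d A st -> (forall v, iarr st aPor v = 0) -> 50 * n + 100 <= r ->
  (forall z st' r', frame portals st st' -> A z ->
     (forall v, v < n -> portal N A z v = (0 < iarr st' aPor v)) ->
     r <= r' + 50 * n + 100 -> Q st' r') ->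
  wp w portals st r Q.
Proof.
move=> ps por0 le_r HQ; have [n2 fn fnn fm fmm] := fit.
have [inp dead degE' _ _ geo _ [a Aa]] := ps.
apply: wp_frame; apply: wp_seq; apply: (wp_for (b := n) (I := fun k st' r' =>
  [/\ iarr st' aDead = iarr st aDead, iarr st' aDeg = iarr st aDeg,
      forall v, iarr st' aPor v = (v < k) && (A v && (2 < deg N A v)),
      (exists2 v, v < k & A v) -> A (ivar st' vZ) &
      r <= r' + 30 * k + (9 * n + 7)])) => //.
- exact: inp_n inp.
- by nat_lia.
- by nat_lia.
- move=> k st' r' lt_k Ek En [Ed Eg porE AZ le_r'].
  apply: wp_if; cmd_simpl; rewrite ?Ek ?Ed; first by nat_lia.
  + rewrite leqn0 -dead // => Ak r1 Er1.
    cmd_step; rewrite ?Ek; try by nat_lia.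
    apply: wp_if; cmd_simpl; rewrite ?Ek ?Eg ?degE' //; first by nat_lia.
    * move=> deg3 r2 Er2; cmd_step; rewrite ?Ek; try by nat_lia.
      split; cmd_simpl => //; last by nat_lia.
      move=> v; rewrite /upd; have [->|ne_v] := eqVneq v k.
        by rewrite ltnSn Ak deg3.
      by rewrite porE ltnS [v <= k]leq_eqVlt (negbTE ne_v).
    * rewrite -ltnNge => deg2 r2 Er2; cmd_step.
      split; cmd_simpl => //; last by nat_lia.
      move=> v; rewrite porE ltnS [v <= k]leq_eqVlt; case: (eqVneq v k) => [->|//] /=.
      by rewrite ltnn (leqNgt 3) deg2 andbF.
  + rewrite -ltnNge lt0n -dead // => nAk r1 Er1; cmd_step.
    split; cmd_simpl => //; last by nat_lia.
    * move=> v; rewrite porE ltnS [v <= k]leq_eqVlt; case: (eqVneq v k) => [->|//] /=.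
      by rewrite ltnn (negbTE nAk).
    * move=> [v lt_v Av]; apply: AZ; exists v => //.
      move: lt_v; rewrite ltnS leq_eqVlt => /orP[/eqP Ev|//].
      by rewrite -Ev Av in nAk.
- move=> st2 r2 En F [Ed Eg porE AZ le_r2].
  have Az : A (ivar st2 vZ) by apply: AZ; exists a => //; apply: geo.1.
  have lt_z := geo.1 _ Az.
  cmd_step; try by nat_lia.
  move=> F'; apply: (HQ (ivar st2 vZ)) => //; last by nat_lia.
  move=> v lt_v; cmd_simpl; rewrite /upd /portal; case: (eqVneq v (ivar st2 vZ)) => [->|_].
    by rewrite Az orbT.
  by rewrite porE lt_v orbF; case: (A v && _).
- split; cmd_simpl => //; [|by nat_lia].
  by case.
Qed.

Hypothesis dM : metric N d.

Lemma distances_metric s v st : distances N s st -> s < n -> v < n ->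
  rarr st rDT (s * n + v) = d s v.
Proof.
move=> [unr wk mn] lt_s lt_v; have Hw := metric_walk dM lt_s lt_v.
apply/eqP; rewrite eq_le (mn _ _ Hw) (metric_le dM) //; apply: wk => //.
by rewrite lt0n; apply/negP => /eqP E; apply: (unr v lt_v E) Hw.
Qed.

Variable lam : nat.
Hypothesis lt_lam : n < 2 ^ lam.
Variables (z : nat) (h : nat -> R) (D0 : R).
Hypothesis geo : geodesic N d A.
Hypothesis prn : pruned N d A h D0.
Local Notation por := (portal N A z).

Record precore st : Prop := Precore {
  pc_input : input N st;
  pc_adj : adjacency N st;
  pc_dead : forall v, v < n -> A v = (iarr st aDead v == 0);
  pc_por : forall v, v < n -> por v = (0 < iarr st aPor v);
  pc_ids : forall v, A v -> iarr st aEs v = ids N A v;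
  pc_h : rarr st rH = h
}.

Lemma precore_frame c st st' :
  frame c st st' -> precore st ->
  all [predC mem (ivars c)] [:: vN; vM] ->
  all [predC mem (iarrs c)] [:: aEA; aEB; aHead; aNext; aEs; aDead; aPor] ->
  all [predC mem (rarrs c)] [:: rC; rH] -> precore st'.
Proof.
move=> F [inp [hd nx] dead prt idE hE] /= /and3P[a1 a2 _].
move=> /and5P[b1 b2 b3 b4 /and4P[b5 b6 b7 _]] /and3P[c1 c2 _].
have [fi fa _ fr] := F; split; rewrite ?fa ?fr //.
  by apply: (input_frame _ _ _ F) => //; rewrite ?a1 ?b1.
by split=> *; rewrite fa // ?hd ?nx.
Qed.

Definition row_cost := (100 * lam + 600) * (2 * n + 2 * m + 4) + 200 * n + 100.

Lemma wp_portal_rows st r Q :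
  precore st -> rvar st xD = D0 ->
  nportals N A z n * row_cost + 50 * n + 100 <= r ->
  (forall st' r', precore st' ->
     (forall s v, por s -> v < n -> rarr st' rDT (s * n + v) = d s v) ->
     (forall X, bounds N d X -> (rvar st' xD <= X)%R) ->
     (D0 <= rvar st' xD)%R ->
     (forall s u, por s -> A u -> u <> s -> (h s + h u + d s u <= rvar st' xD)%R) ->
     r <= r' + nportals N A z n * row_cost + 50 * n + 100 -> Q st' r') ->
  wp w portal_rows st r Q.
Proof.
move=> pc ED le_r HQ; have [n2 fn fnn fm fmm] := fit.
have below0 X : bounds N d X -> (D0 <= X)%R by move=> /(pr_ub prn X) [].
apply: (wp_for (b := n) (I := fun k st' r' =>
  [/\ precore st', (forall s v, s < k -> por s -> v < n -> rarr st' rDT (s * n + v) = d s v),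
     (forall X, bounds N d X -> (rvar st' xD <= X)%R) /\ (D0 <= rvar st' xD)%R,
     (forall s u, s < k -> por s -> A u -> u <> s -> (h s + h u + d s u <= rvar st' xD)%R) &
     r <= r' + nportals N A z k * row_cost + 20 * k + (9 * n + 7)])) => //.
- exact: inp_n (pc_input pc).
- by nat_lia.
- by nat_lia.
- move=> k st' r' lt_k Ek En [pc' rows [below le_D] pairs le_r'].
  have nportS : nportals N A z k.+1 = nportals N A z k + por k.
    by rewrite /nportals big_nat_recr.
  have le_nport : nportals N A z k.+1 * row_cost <= nportals N A z n * row_cost.
    rewrite leq_mul2r /nportals (@big_cat_nat _ _ _ k.+1 0 n) //=.
    by rewrite leq_addr orbT.
  rewrite nportS mulnDl in le_nport *.
  set ca := nportals N A z k * row_cost in le_nport le_r' *.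
  apply: wp_if; cmd_simpl; rewrite ?Ek -?(pc_por pc') //; first by nat_lia.
  + move=> por_k r1 Er1; rewrite por_k mul1n in le_nport *.
    have rcE : row_cost = (100 * lam + 600) * (2 * n + 2 * m + 4) + 200 * n + 100 by [].
    cmd_step; rewrite ?Ek; try by nat_lia.
    have Ak : A k by apply: portal_alive por_k.
    set st1 := State _ _ _ _.
    have pc1 : precore st1 by case: pc' => [[? ? ? ? ?] [? ?] ? ? ? ?]; do 2 split=> //.
    apply: wp_seq; apply: (wp_dijkstra fit lt_lam lt_k (pc_input pc1) (pc_adj pc1)) => //.
      by nat_lia.
    move=> st2 r2 F2 dist2 EB2 rows2 le_r2.
    have pc2 : precore st2 by apply: (precore_frame F2 pc1).
    have row_k v : v < n -> rarr st2 rDT (k * n + v) = d k v.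
      by move=> lt_v; apply: distances_metric.
    have old_rows s v : s < k -> por s -> v < n -> rarr st2 rDT (s * n + v) = d s v.
      (* Row [s] ends before row [k] begins, so the run from [k] leaves it intact. *)
      move=> lt_s por_s lt_v; have le_row : s.+1 * n <= k * n by rewrite leq_mul2r lt_s orbT.
      by rewrite rows2 ?rows //; left; rewrite mulSn in le_row; nat_lia.
    have [fi2 _ frv2 _] := F2.
    have Ek2 : ivar st2 vU = k by rewrite fi2.
    have ED2 : rvar st2 xD = rvar st' xD by rewrite frv2.
    apply: (wp_for (b := n) (I := fun j st3 r3 => [/\ iarr st3 = iarr st2, rarr st3 = rarr st2,
      (forall x, x != vJ -> ivar st3 x = ivar st2 x),
      [/\ forall X, bounds N d X -> (rvar st3 xD <= X)%R, (rvar st' xD <= rvar st3 xD)%R &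
        forall u, u < j -> A u -> u <> k -> (h k + h u + d k u <= rvar st3 xD)%R] &
      r2 <= r3 + 60 * j + (9 * n + 7)])) => //.
    * exact: inp_n (pc_input pc2).
    * by nat_lia.
    * by nat_lia.
    * move=> j st3 r3 lt_j Ej En3 [Ei Er Eiv [below3 le_D3 pairs3] le_r3].
      have Ek3 : ivar st3 vU = k by rewrite Eiv.
      apply: wp_if; cmd_simpl; rewrite ?Ej ?Ek3 ?Ei ?Er; first by nat_lia.
      - rewrite leqn0 -(pc_dead pc2) // => /andP[Aj ne_jk] r4 Er4.
        apply: wp_maximize; cmd_simpl; first by nat_lia.
        rewrite Ej Ek3 Er Eiv // EB2 row_k // (pc_h pc2) => rv5 r5 rv5E rv5F le_r5.
        have neq_kj : k <> j by move: ne_jk; nat_lia.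
        split; cmd_simpl => //; last by nat_lia.
          by move=> x ne_x; rewrite upd_neq ?Eiv // (negbTE ne_x).
        split.
        + move=> X UB; rewrite rv5E ge_max below3 //=.
          exact: (pruned_bound prn UB Ak Aj).
        + by rewrite rv5E le_max le_D3.
        + move=> u; rewrite ltnS leq_eqVlt rv5E le_max => /orP[/eqP->|lt_u] Au ne_u.
            by rewrite lexx orbT.
          by rewrite pairs3.
      - rewrite leqn0 -(pc_dead pc2) // => skip r4 Er4; cmd_step.
        split; cmd_simpl => //; last by nat_lia.
          by move=> x ne_x; rewrite upd_neq ?Eiv // (negbTE ne_x).
        split=> // u; rewrite ltnS leq_eqVlt => /orP[/eqP->|lt_u] Au ne_u.
          by move: skip; rewrite Au /=; nat_lia.
        exact: pairs3.
    * move=> st3 r3 Ej F3 [Ei Er Eiv [below3 le_D3 pairs3] le_r3].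
      have pc3 : precore st3 by apply: (precore_frame F3 pc2).
      split; cmd_simpl.
      - by case: pc3 => [[? ? ? ? ?] [? ?] ? ? ? ?]; do 2 split=> //.
      - move=> s v; rewrite ltnS leq_eqVlt Er => /orP[/eqP->|lt_s] por_s lt_v.
          exact: row_k.
        exact: old_rows.
      - by split=> //; apply: le_trans le_D3.
      - move=> s u; rewrite ltnS leq_eqVlt => /orP[/eqP->|lt_s] por_s Au ne_u.
          by apply: pairs3 => //; apply: geo.1.
        by apply: le_trans le_D3; apply: pairs.
      - by nat_lia.
    * split; cmd_simpl => //; last by nat_lia.
        by move=> x ne_x; rewrite upd_neq // (negbTE ne_x).
      by rewrite ED2; split.
  + move=> npor r1 Er1; cmd_step.
    split; cmd_simpl => //.
    - by case: pc' => [[? ? ? ? ?] [? ?] ? ? ? ?]; do 2 split=> //.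
    - move=> s v; rewrite ltnS leq_eqVlt => /orP[/eqP->|lt_s] por_s lt_v.
        by rewrite por_s in npor.
      exact: rows.
    - move=> s u; rewrite ltnS leq_eqVlt => /orP[/eqP->|lt_s] por_s Au ne_u.
        by rewrite por_s in npor.
      exact: pairs.
    - by nat_lia.
- move=> st' r' En F [pc' rows [below le_D] pairs le_r'].
  apply: HQ => //; last by nat_lia.
  + by move=> s v por_s; apply: rows => //; apply: geo.1; apply: portal_alive por_s.
  + by move=> s u por_s; apply: pairs => //; apply: geo.1; apply: portal_alive por_s.
- split; cmd_simpl => //; last by nat_lia.
  + by case: pc => [[? ? ? ? ?] [? ?] ? ? ? ?]; do 2 split=> //.
  + by rewrite ED.
Qed.
End PortalProgram.

(** * The complete program *)

Definition unreached :=
  For vJ vN (If (BLeI (IGet aSeen (IVar vJ)) (IConst 0)) (ISet vZ (IConst 1)) Skip).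

(** The run from vertex 0 decides connectivity, without which there is no finite metric. [vN] is
    integer variable 0, so at the end it doubles as the flag for [+oo]. *)
Definition diameter :=
  (build ;; ISet vS (IConst 0) ;; dijkstra ;;
   ISet vZ (IConst 0) ;; unreached ;;
   If (BLeI (IConst 1) (IVar vZ)) (ISet vN (IConst 1))
     (prune ;; portals ;; portal_rows ;; arcs ;; ISet vN (IConst 0)))%cmd.

Section DiameterProgram.
Variables (R : realFieldType) (N : net R) (d : nat -> nat -> R) (w lam k : nat).
Hypothesis fit : fits N w.
Hypothesis lt_lam : (nv N < 2 ^ lam)%N.
Hypothesis k_gt0 : (0 < k)%N.
Hypothesis edge_count : ne N = (nv N + k - 1)%N.
Implicit Types (st : state R) (Q : state R -> nat -> Prop).
Local Open Scope nat_scope.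
Local Notation n := (nv N).
Local Notation m := (ne N).
Hypothesis dM : (forall u v, u < n -> v < n -> exists c, walk N (verts N) u v c) ->
  metric N d.

Lemma pruned_verts (h : nat -> R) : (forall v, h v = 0%R) -> metric N d ->
  pruned N d (verts N) h 0%R.
Proof.
move=> h0 mt; have [n2 _ _ _ _] := fit.
split=> [v _||x]; rewrite ?h0 //; split=> [ub|[x0 le_x] u v lt_u lt_v].
  split=> [|a b lt_a lt_b _]; last by rewrite !h0 !add0r; apply: ub.
  by have := ub 0 0 ltac:(nat_lia) ltac:(nat_lia); rewrite (metricxx mt) //; nat_lia.
have [->|/eqP ne] := eqVneq u v; first by rewrite (metricxx mt).
by have := le_x u v lt_u lt_v ne; rewrite !h0 !add0r.
Qed.

Lemma nlive_verts : nlive N (verts N) = m.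
Proof.
rewrite /nlive -[RHS]subn0 -[RHS]muln1 -sum_nat_const_nat.
rewrite big_nat_cond [RHS]big_nat_cond; apply: eq_bigl => f.
by case: (ltnP f m) => //= lt_f; rewrite /verts ea_lt ?eb_lt.
Qed.

Lemma nalive_verts : nalive N (verts N) = n.
Proof.
rewrite /nalive -[RHS]subn0 -[RHS]muln1 -sum_nat_const_nat.
by rewrite big_nat_cond [RHS]big_nat_cond; apply: eq_bigl => v; rewrite /verts; nat_lia.
Qed.

Lemma geodesic_verts : metric N d -> geodesic N d (verts N).
Proof.
move=> mt; split=> // u v lt_u lt_v; exists (d u v) => //.
exact: (metric_walk mt).
Qed.

Definition total_cost :=
  minn n (2 * k) * row_cost N lam + 6 * k * arc_cost N lam +
  (100 * lam + 600) * (2 * n + 2 * m + 4) + 1000 * n + 500 * m + 2000.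

Lemma wp_diameter st r Q :
  input N st -> (forall a i, 1 < a -> iarr st a i = 0) ->
  (forall x, rvar st x = 0%R) -> (forall i, rarr st rH i = 0%R) ->
  total_cost <= r ->
  (forall st' r',
     (ivar st' 0 = 1 /\ exists2 v, v < n & forall c, ~ walk N (verts N) 0 v c) \/
     [/\ ivar st' 0 = 0, metric N d, bounds N d (rvar st' 0) &
        forall X, bounds N d X -> (rvar st' 0 <= X)%R] ->
     Q st' r') ->
  wp w diameter st r Q.
Proof.
move=> inp zero rv0 rH0 le_r HQ; have [n2 fn fnn fm fmm] := fit.
rewrite /total_cost in le_r; set cost := _ * (_ + 4) in le_r.
set rc := _ * row_cost _ _ in le_r; set ac := _ * arc_cost _ _ in le_r.
apply: wp_seq; apply: (wp_build fit inp).
- by move=> a; rewrite !inE => a_in i; apply: zero; move: a_in; nat_lia.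
- by nat_lia.
move=> st1 r1 F1 adj1 deg1 ids1 le_r1.
have [fi1 fa1 frv1 fra1] := F1.
have inp1 : input N st1 by apply: (input_frame _ _ _ F1 inp).
cmd_step; try by nat_lia.
set st2 := State _ _ _ _.
have inp2 : input N st2 by keep inp1.
have adj2 : adjacency N st2 by case: adj1 => hd nx; split.
apply: wp_seq; apply: (wp_dijkstra fit lt_lam (s := 0) _ inp2 adj2) => //.
- by nat_lia.
- by rewrite -/cost; nat_lia.
move=> st3 r3 F3 dist3 EB3 _ le_r3; rewrite -/cost in le_r3.
have [fi3 fa3 frv3 fra3] := F3.
have inp3 : input N st3 by apply: (input_frame _ _ _ F3 inp2).
cmd_step; try by nat_lia.
apply: wp_seq; apply: (wp_for (b := n) (I := fun j st' r' =>
  [/\ iarr st' = iarr st3, rarr st' = rarr st3, rvar st' = rvar st3,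
      (forall x, x != vZ -> x != vJ -> ivar st' x = ivar st3 x) /\
      (if ivar st' vZ == 0 then forall v, v < j -> 0 < iarr st3 aSeen v
       else exists2 v, v < n & iarr st3 aSeen v = 0) &
      r3 <= r' + 20 * j + (9 * n + 7) + 10])) => //.
- exact: inp_n inp3.
- by nat_lia.
- by nat_lia.
- move=> j st' r' lt_j Ej En [Ei Er Erv [Eiv flag] le_r'].
  apply: wp_if; cmd_simpl; rewrite ?Ej ?Ei; first by nat_lia.
  + rewrite leqn0 => /eqP seen0 r4 Er4; cmd_step; try by nat_lia.
    split; cmd_simpl => //; last by nat_lia.
    split=> [x nx nx'|]; last by exists j.
    by rewrite !upd_neq ?Eiv // ?(negbTE nx) ?(negbTE nx').
  + rewrite -ltnNge => seen r4 Er4; cmd_step.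
    split; cmd_simpl => //; last by nat_lia.
    split=> [x nx nx'|].
      by rewrite !upd_neq ?Eiv // ?(negbTE nx) ?(negbTE nx').
    move: flag; case: eqP => // _ flag v; rewrite ltnS leq_eqVlt.
    by case/orP=> [/eqP->//|/flag].
- move=> st4 r4 Ej F4 [Ei Er Erv [Eiv flag] le_r4].
  have inp4 : input N st4 by apply: (input_frame _ _ _ F4); [| | | keep inp3].
  apply: wp_if; cmd_simpl; first by nat_lia.
  + move=> flag1 r5 Er5; cmd_step; try by nat_lia.
    apply: HQ; left; cmd_simpl; split=> //.
    move: flag; rewrite -leqn0 leqNgt flag1 /= => -[v lt_v seen0].
    by exists v => // c; apply: (dist_unreached dist3).
  rewrite -leqNgt leqn0 => flag0 r5 Er5; rewrite flag0 in flag.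
  have mt : metric N d.
    apply: dM => u v lt_u lt_v.
    have Hu := dist_walk dist3 lt_u (flag u lt_u).
    have Hv := dist_walk dist3 lt_v (flag v lt_v).
    by eexists; apply: (walk_cat (walk_sym Hu) Hv).
  have E_ia a : a \notin [:: aHead; aNext; aSeen; aT; aDeg; aEs] -> 1 < a ->
      forall i, iarr st4 a i = 0.
    by rewrite !inE => a_out a_gt1 i; rewrite Ei fa3 ?fa1 ?zero // !inE; nat_lia.
  have ps : pstate N d (verts N) st4.
    split.
    * exact: inp4.
    * by move=> v lt_v; rewrite E_ia.
    * by move=> v lt_v; rewrite Ei fa3 // deg1.
    * by move=> v lt_v; rewrite Ei fa3 // ids1.
    * by rewrite Er fra3 // fra1 // Erv frv3 // frv1 // rv0; apply: pruned_verts.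
    * exact: geodesic_verts.
    * by rewrite nlive_verts nalive_verts addnC.
    * by exists 0; rewrite /verts; nat_lia.
  apply: wp_seq; apply: (wp_prune mt fit ps); first by nat_lia.
  move=> A st5 r6 F5 ps5 no_leaf le_r6.
  have [fi5 fa5 frv5 fra5] := F5.
  apply: wp_seq; apply: (wp_portals fit ps5).
  + by move=> v; rewrite fa5 // E_ia.
  + by nat_lia.
  move=> z st6 r7 F6 Az porE le_r7.
  have [fi6 fa6 frv6 fra6] := F6; have [inp5 dead5 deg5 ids5 prn5 geo5 cnt5 _] := ps5.
  have inp6 : input N st6 by apply: (input_frame _ _ _ F6 inp5).
  have pc6 : precore N A z (rarr st5 rH) st6.
    split=> //.
    * by case: adj1 => hd nx; split=> *; rewrite fa6 // fa5 // Ei fa3 //= ?hd ?nx.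
    * by move=> v lt_v; rewrite fa6 // dead5.
    * by move=> v Av; rewrite fa6 // ids5.
    * by rewrite fra6.
  have le_np := nportals_le geo5 no_leaf cnt5 k_gt0 edge_count Az.
  have le_npn := nportals_n N A z.
  have le_na := narcs_le geo5 no_leaf cnt5 k_gt0 edge_count Az.
  have le_rc : nportals N A z n * row_cost N lam <= rc.
    by rewrite leq_mul2r leq_min le_npn le_np orbT.
  have le_ac : narcs N A (portal N A z) m * arc_cost N lam <= ac.
    by rewrite leq_mul2r le_na orbT.
  apply: wp_seq; apply: (wp_portal_rows fit mt lt_lam geo5 prn5 pc6).
  + by rewrite frv6.
  + by nat_lia.
  move=> st7 r8 pc7 rows7 below7 le_D7 pairs7 le_r8.
  have co7 : core N d A (portal N A z) (rarr st5 rH) st7 by case: pc7.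
  apply: wp_seq; apply: (wp_arcs fit lt_lam mt geo5 _ _ prn5 _ co7 below7).
  + exact: portal_alive.
  + by move=> v; apply: (portal_deg2 geo5 no_leaf cnt5 k_gt0 edge_count).
  + exact: (alive_neighbor geo5 no_leaf cnt5 k_gt0 edge_count).
  + by nat_lia.
  move=> st8 r9 co8 below8 le_D8 done8 le_r9.
  cmd_step; try by nat_lia.
  apply: HQ; right; cmd_simpl; split=> // u v lt_u lt_v.
  have : forall u v, u < n -> v < n -> (d u v <= rvar st8 xD)%R; last by apply.
  (* [pr_ub] reduces all pairs to those of the core weighted with depths, and [cover_bound] reduces
     these to portals and arcs. *)
  apply/(pr_ub prn5); split; first exact: le_trans le_D8.
  move=> a b Aa Ab neq_ab.
  apply: (cover_bound (h := rarr st5 rH) mt geo5 _ _ (portal_z N Az)) => //.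
  + exact: portal_alive.
  + by move=> ?; apply: (portal_deg2 geo5 no_leaf cnt5 k_gt0 edge_count).
  + by move=> s x por_s Ax ne_x; apply: le_trans le_D8; apply: pairs7.
  + by move=> c e0 l x j i *; apply: (done8 c e0 _ _ _ l x j i).
- split; cmd_simpl => //; last by nat_lia.
  by split=> // x nx nx'; rewrite !upd_neq // ?(negbTE nx) ?(negbTE nx').
Qed.

End DiameterProgram.

(** * Distances in the graph *)

Section Graph.
Variables (R : realFieldType) (n : nat) (G : wgraph R n).
Implicit Types (u v : 'I_n) (p q : seq 'I_n).

Lemma card_edges_le : (#|edges G| <= n * n)%N.
Proof.
apply: leq_trans (leq_imset_card _ _) _; apply: leq_trans (max_card _) _.
by rewrite card_prod card_ord.
Qed.

Lemma path_cost_cat u p q :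
  path_cost G u (p ++ q) = path_cost G u p + path_cost G (last u p) q.
Proof. by elim: p u => [|v p IH] u /=; rewrite ?add0r // IH addrA. Qed.

Lemma path_cost_ge0 u p : path (adj G) u p -> 0 <= path_cost G u p.
Proof.
elim: p u => [|v p IH] u //= /andP[uv pv].
by rewrite addr_ge0 ?IH // cost_ge0.
Qed.

(** Induction on the path: if its first vertex recurs in the simple path found for the rest, keep
    only what follows the recurrence; the piece cut off has nonnegative cost. *)
Lemma simple_path_exists u p : path (adj G) u p ->
  exists2 q, simple_path G u (last u p) q & path_cost G u q <= path_cost G u p.
Proof.
elim: p u => [|v p IH] u /=; first by exists [::]; rewrite /simple_path /= ?eqxx.
case/andP=> uv /IH[q /and3P[q_path /eqP q_last q_uniq] q_cost].
have c_ge0 := cost_ge0 uv.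
have [u_q|u_q] := boolP (u \in v :: q); last first.
  exists (v :: q); last by rewrite /= lerD2l.
  by rewrite /simple_path cons_uniq u_q q_uniq /= uv q_path q_last eqxx.
have {}u_q : u \in q.
  by move: u_q; rewrite inE => /orP[/eqP E|//]; rewrite E adj_irr in uv.
move: q_path q_last q_uniq q_cost; case/splitPr: u_q => q1 q2.
rewrite cat_path last_cat path_cost_cat /= => /and3P[q1_path q1_u q2_path].
move=> q_last; rewrite mem_cat cat_uniq /= => /and4P[_ _ _ q2_uniq] le_q.
exists q2; first by rewrite /simple_path q2_path q_last eqxx /=.
have := path_cost_ge0 q1_path; have := cost_ge0 q1_u; lra.
Qed.

Lemma dist_le u p : path (adj G) u p -> (dist G u (last u p) <= (path_cost G u p)%:E)%E.
Proof.
move=> /simple_path_exists[q q_simple le_q].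
have size_q : (size q <= n)%N.
  have /and3P[_ _ /card_uniqP q_card] := q_simple.
  by have := max_card (mem (u :: q)); rewrite q_card card_ord /=; lia.
rewrite /dist; by apply: (bigmin_inf (Bseq size_q)) => //.
Qed.

Lemma dist_attained u v : dist G u v = +oo%E \/
  exists p, [/\ path (adj G) u p, last u p = v & dist G u v = (path_cost G u p)%:E].
Proof.
rewrite /dist; elim/big_ind: _ => [|a b Ha Hb|p /and3P[p_path /eqP p_last _]]; first by left.
  by rewrite minEle; case: ifP.
by right; exists p.
Qed.

Lemma dist_le_diam u v : (dist G u v <= diam G)%E.
Proof.
rewrite /diam; apply: (bigmax_sup u) => //.
by apply: (bigmax_sup v).
Qed.

Lemma diam_le (x : \bar R) : (forall u v, (dist G u v <= x)%E) -> (diam G <= x)%E.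
Proof. by move=> le_x; do 2 (apply: bigmax_le => [|? _]; first exact: leNye). Qed.

Variable s : seq ('I_n * 'I_n).
Hypothesis s_edges : edge_list G s.

Lemma edge_list_adj x : x \in s -> adj G x.1 x.2.
Proof.
move=> x_s; have : [set x.1; x.2] \in [seq [set y.1; y.2] | y <- s].
  by apply: map_f.
rewrite (perm_mem s_edges) mem_enum => /imsetP[y]; rewrite inE => adj_y E.
have : y.1 \in [set x.1; x.2] by rewrite E !inE eqxx.
have : y.2 \in [set x.1; x.2] by rewrite E !inE eqxx orbT.
have : x.1 \in [set y.1; y.2] by rewrite -E !inE eqxx.
have : x.2 \in [set y.1; y.2] by rewrite -E !inE eqxx orbT.
rewrite !inE; case: (eqVneq y.1 y.2) adj_y => [->|ne adj_y]; first by rewrite adj_irr.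
by case/orP=> /eqP-> /orP[]/eqP->; rewrite ?eqxx ?orbT //; 
  rewrite ?[_ == y.1]eq_sym ?(negbTE ne) //= adj_sym.
Qed.

Lemma size_edge_list : size s = #|edges G|.
Proof. by rewrite -(size_map (fun x => [set x.1; x.2])) (perm_size s_edges) -cardE. Qed.

Lemma edge_list_mem u v : adj G u v -> (u, v) \in s \/ (v, u) \in s.
Proof.
move=> uv; have : [set u; v] \in [seq [set y.1; y.2] | y <- s].
  rewrite (perm_mem s_edges) mem_enum; apply/imsetP.
  by exists (u, v); rewrite ?inE.
case/mapP=> -[a b] ab_s /= E.
have neq_uv : u != v by apply: contraTneq uv => ->; rewrite adj_irr.
have : u \in [set a; b] by rewrite -E !inE eqxx.
have : v \in [set a; b] by rewrite -E !inE eqxx orbT.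
rewrite !inE => /orP[]/eqP Ev /orP[]/eqP Eu;
  try (by rewrite Ev Eu eqxx in neq_uv); rewrite Ev Eu; by [right | left].
Qed.

Hypothesis n_gt0 : (0 < n)%N.

Definition vert (i : nat) : 'I_n := insubd (Ordinal n_gt0) i.

Lemma vertK i : (i < n)%N -> vert i = i :> nat.
Proof. by move=> lt_i; rewrite val_insubd lt_i. Qed.

Lemma vert_val u : vert u = u.
Proof. by apply: val_inj; rewrite /= vertK. Qed.

Definition tails i := nth 0%N [seq nat_of_ord x.1 | x <- s] i.
Definition heads i := nth 0%N [seq nat_of_ord x.2 | x <- s] i.
Definition costs i := nth 0 [seq cost G x.1 x.2 | x <- s] i.

Lemma nth_edge i : (i < size s)%N ->
  exists x, [/\ x \in s, tails i = x.1, heads i = x.2 & costs i = cost G x.1 x.2].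
Proof.
move=> lt_i; pose x0 := (Ordinal n_gt0, Ordinal n_gt0).
exists (nth x0 s i); rewrite mem_nth // /tails /heads /costs.
by rewrite !(nth_map x0).
Qed.

Lemma tails_lt i : (i < size s)%N -> (tails i < n)%N.
Proof. by case/nth_edge=> x [_ -> _ _]. Qed.

Lemma heads_lt i : (i < size s)%N -> (heads i < n)%N.
Proof. by case/nth_edge=> x [_ _ -> _]. Qed.

Lemma tails_heads i : (i < size s)%N -> tails i <> heads i.
Proof.
case/nth_edge=> x [/edge_list_adj adj_x -> -> _] /val_inj E.
by rewrite E adj_irr in adj_x.
Qed.

Lemma costs_ge0 i : (i < size s)%N -> 0 <= costs i.
Proof. by case/nth_edge=> x [/edge_list_adj /cost_ge0 ? _ _ ->]. Qed.

Definition graph_net : net R :=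
  @Net R n (size s) tails heads costs tails_lt heads_lt tails_heads costs_ge0.
Local Notation N := graph_net.

Lemma step_net u v : adj G u v ->
  exists e, [/\ (e < ne N)%N, inc N e u, opp N e u = v & len N e = cost G u v].
Proof.
move=> uv; have [x_s|x_s] := edge_list_mem uv.
  exists (index (u, v) s); have lt_i : (index (u, v) s < size s)%N by rewrite index_mem.
  have E : nth (u, v) s (index (u, v) s) = (u, v) by apply: nth_index.
  have [Et Eh Ec] : [/\ tails (index (u, v) s) = u, heads (index (u, v) s) = v &
      costs (index (u, v) s) = cost G u v].
    by rewrite /tails /heads /costs !(nth_map (u, v)) // E.
  by split; rewrite //= /inc /opp /= ?Et ?Eh ?eqxx ?addKn.
exists (index (v, u) s); have lt_i : (index (v, u) s < size s)%N by rewrite index_mem.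
have E : nth (u, v) s (index (v, u) s) = (v, u) by apply: nth_index.
have [Et Eh Ec] : [/\ tails (index (v, u) s) = v, heads (index (v, u) s) = u &
    costs (index (v, u) s) = cost G v u].
  by rewrite /tails /heads /costs !(nth_map (u, v)) // E.
by split; rewrite //= /inc /opp /= ?Et ?Eh ?eqxx ?orbT ?addnK // Ec cost_sym // adj_sym.
Qed.

Lemma net_step e u : (e < ne N)%N -> inc N e u ->
  exists v : 'I_n, [/\ adj G u v, opp N e u = v & len N e = cost G u v].
Proof.
move=> lt_e; have [[a b] [x_s Et Eh Ec]] := nth_edge lt_e.
have adj_ab := edge_list_adj x_s.
rewrite /inc /opp /= Et Eh Ec /= => /orP[]/eqP/val_inj <-.
  by exists b; rewrite addKn.
by exists a; rewrite addnK adj_sym (cost_sym adj_ab).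
Qed.

Lemma walk_of_path u p : path (adj G) u p ->
  walk N (verts N) u (last u p) (path_cost G u p).
Proof.
elim: p u => [|v p IH] u /=; first by move=> _; apply: walk_nil; apply: ltn_ord.
case/andP=> /step_net[e [lt_e inc_e Eo <-]] /IH H.
by apply: walk_cons => //; [apply: ltn_ord | rewrite Eo].
Qed.

Lemma path_of_walk i j c : walk N (verts N) i j c -> forall u v, i = u -> j = v ->
  exists p, [/\ path (adj G) u p, last u p = v & path_cost G u p = c].
Proof.
elim=> {i j c} [i _|i e j c _ lt_e inc_e _ IH] u v Eu Ev.
  by exists [::]; split=> //=; apply: val_inj; rewrite /= -Eu.
rewrite Eu in inc_e IH; have [x [ux Eo Ec]] := net_step lt_e inc_e.
have [p [p_path p_last p_cost]] := IH x v Eo Ev.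
by exists (x :: p); split; rewrite /= ?ux ?p_path ?p_last ?p_cost -?Ec.
Qed.

Lemma dist_le_walk u v c : walk N (verts N) u v c -> (dist G u v <= c%:E)%E.
Proof.
move=> /path_of_walk/(_ u v erefl erefl)[p [p_path <- <-]].
exact: dist_le.
Qed.

(** [fine] sends an infinite distance to 0, so this is the distance only between connected
    vertices. *)
Definition graph_metric i j := fine (dist G (vert i) (vert j)).

Lemma graph_metricP :
  (forall i j, (i < nv N)%N -> (j < nv N)%N -> exists c, walk N (verts N) i j c) ->
  metric N graph_metric /\ forall u v, dist G u v = (graph_metric u v)%:E.
Proof.
move=> conn.
have distE u v : dist G u v = (graph_metric u v)%:E.
  have [c /dist_le_walk] := conn u v (ltn_ord u) (ltn_ord v).
  rewrite /graph_metric !vert_val.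
  by case: (dist_attained u v) => [->|[p [_ _ ->]]].
split=> //; split=> [i j lt_i lt_j|i j c H].
  rewrite /graph_metric -{1}(vertK lt_i) -{1}(vertK lt_j).
  have := distE (vert i) (vert j).
  case: (dist_attained (vert i) (vert j)) => [->//|[p [p_path p_last ->]]] _ /=.
  by rewrite -p_last; apply: walk_of_path.
have [lt_i lt_j] := walk_ends H; rewrite -lee_fin.
have := distE (vert i) (vert j); rewrite !vertK // => <-.
by apply: dist_le_walk; rewrite !vertK.
Qed.

End Graph.

(** A simple graph on one or two vertices has fewer edges than vertices. From three vertices on the
    logarithm is at least 1 and can absorb additive constants. *)
Lemma graph_order_ge3 (R : realFieldType) (n : nat) (G : wgraph R n) :
  (0 < n)%N -> (n <= #|edges G|)%N -> (3 <= n)%N.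
Proof.
case: n G => [|[|[|n]]] // G _ le_n.
  suff E : edges G = set0 by rewrite E cards0 in le_n.
  apply/setP => x; rewrite inE; apply/imsetP => -[[u v]]; rewrite inE /= => uv _.
  by rewrite (ord1 u) (ord1 v) adj_irr in uv.
suff sub : edges G \subset [set setT].
  by have := leq_trans le_n (subset_leq_card sub); rewrite cards1.
apply/subsetP => x /imsetP[[u v]]; rewrite !inE /= => uv ->.
have neq_uv : u != v by apply: contraTneq uv => ->; rewrite adj_irr.
by rewrite eqEcard subsetT /= cardsT card_ord cards2 neq_uv.
Qed.

(** * Word size and the arithmetic of the running time *)

Local Open Scope nat_scope.

(** The largest demand is the square of the number of edges, of order [n ^ 4]; the remaining factor
    [n ^ 2], at least 9, covers the constants. *)
Lemma fits_pow6 (R : realFieldType) (N : net R) w :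
  3 <= nv N -> ne N <= nv N * nv N -> nv N ^ 6 <= 2 ^ w -> fits N w.
Proof.
move=> n3 le_m le_W.
suff [? ? ? ?] : [/\ 2 * nv N < 2 ^ w, nv N * nv N < 2 ^ w, 2 * ne N + 2 < 2 ^ w &
    ne N * ne N + 2 < 2 ^ w] by split; nat_lia.
move: le_W; rewrite !expnS expn0 muln1.
move: (2 ^ w) (nv N) (ne N) n3 le_m => W n m n3 le_m le_W.
have le_np : 3 * n <= n * n by nia.
have {le_W} le_W : (n * n) * (n * n) * (n * n) <= W by move: le_W; rewrite !mulnA.
move: (n * n) le_np le_m le_W => p le_np le_m le_W.
have le_pp : 9 * p <= p * p by nia.
have le_mm : m * m <= p * p by apply: leq_mul.
have : 9 * (p * p) <= p * p * p by nia.
by split; nat_lia.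
Qed.

(** In units of [n * k * t], the first run costs at most 8 * 800, the rows 14 * 800 + 600 and the
    arcs 6 * 960 + 3000; this leaves ample room below 40000 for the linear terms. *)
Lemma total_cost_le (R : realFieldType) (N : net R) k t :
  3 <= nv N -> 1 <= k -> ne N = nv N + k - 1 -> 1 <= t ->
  total_cost N t.+1 k <= 200 * 200 * (nv N * k * t).
Proof.
move=> n3 k1 Em t1; rewrite /total_cost /row_cost /arc_cost Em.
move: (nv N) n3 => n n3.
have lam_le : 100 * t.+1 + 600 <= 800 * t by nat_lia.
have lam_le' : 80 * t.+1 + 800 <= 960 * t by nat_lia.
set x := n * k * t.
have le_nk : n * k <= x by rewrite leq_pmulr.
have le_n : n <= n * k by rewrite leq_pmulr.
have le_k : 3 * k <= n * k by rewrite leq_mul2r n3 orbT.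
have le_nt : n * t <= x by rewrite /x mulnAC leq_pmulr.
have sz : 2 * n + 2 * (n + k - 1) + 4 <= 6 * n + 2 * k by nat_lia.
(* The minimum is bounded by [2 * k] against the term in [n] and by [n] against the term in [k]: 12
   plus 2. *)
have min_le : minn n (2 * k) * (6 * n + 2 * k) <= 14 * (n * k).
  have h1 : minn n (2 * k) * (6 * n) <= 2 * k * (6 * n) by rewrite leq_mul2r geq_minr orbT.
  have h2 : minn n (2 * k) * (2 * k) <= n * (2 * k) by rewrite leq_mul2r geq_minl orbT.
  by rewrite mulnDr; nia.
have min_n : minn n (2 * k) * n <= 2 * (n * k).
  have : minn n (2 * k) * n <= 2 * k * n by rewrite leq_mul2r geq_minr orbT.
  by nia.
have base_le : (100 * t.+1 + 600) * (2 * n + 2 * (n + k - 1) + 4) <= 8 * (800 * x).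
  have : (100 * t.+1 + 600) * (2 * n + 2 * (n + k - 1) + 4) <= 800 * t * (6 * n + 2 * k).
    exact: leq_mul.
  have : 6 * n + 2 * k <= 8 * (n * k) by nat_lia.
  rewrite -(leq_pmul2l (m := 800 * t)) ?muln_gt0 ?t1 // => h1 h2.
  by apply: leq_trans h2 (leq_trans h1 _); rewrite /x; nia.
have row_le : minn n (2 * k) * ((100 * t.+1 + 600) * (2 * n + 2 * (n + k - 1) + 4) + 200 * n + 100)
    <= 14 * (800 * x) + 600 * x.
  have h : minn n (2 * k) * ((100 * t.+1 + 600) * (2 * n + 2 * (n + k - 1) + 4)) <=
      800 * t * (14 * (n * k)).
    rewrite mulnCA; apply: leq_mul => //; apply: leq_trans min_le.
    by apply: leq_mul.
  have hx : 800 * t * (14 * (n * k)) = 14 * (800 * x) by rewrite /x; nia.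
  rewrite hx in h; move: h; move: (_ * (_ + 4)) => Y h.
  have h1 : minn n (2 * k) <= n by rewrite geq_minl.
  have h2 : minn n (2 * k) * (200 * n) = 200 * (minn n (2 * k) * n) by rewrite mulnCA.
  rewrite (mulnDr _ (Y + _)) (mulnDr _ Y) h2.
  move: (minn _ _) (minn _ _ * Y) h h1 min_n => p pY h h1 min_n.
  by nat_lia.
have arc_le : 6 * k * (n * (80 * t.+1 + 800) + 500) <= 6 * (960 * x) + 3000 * x.
  have h : n * (80 * t.+1 + 800) <= n * (960 * t) by rewrite leq_mul2l lam_le' orbT.
  have : 6 * k * (n * (80 * t.+1 + 800)) <= 6 * k * (n * (960 * t)) by rewrite leq_mul2l h orbT.
  have -> : 6 * k * (n * (960 * t)) = 6 * (960 * x) by rewrite /x; nia.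
  by rewrite mulnDr; nat_lia.
by nat_lia.
Qed.

Local Open Scope ring_scope.

Theorem theorem2 :
  exists (P : cmd) (C c : nat),
    forall (R : realFieldType) (n k : nat) (G : wgraph R n)
           (s : seq ('I_n * 'I_n)) (w : nat),
      (1 <= n)%N -> (1 <= k)%N ->
      #|edges G| = (n + k - 1)%N ->
      edge_list G s ->
      (n ^ c <= 2 ^ w)%N ->
      exists (t : nat) (st : state R),
        exec w P (init_state G s) t st /\
        (t <= C * (n * k * trunc_log 2 n))%N /\
        output st = diam G.
Proof.
exists diameter, (200 * 200)%N, 6%N => R n k G s w n_gt0 k_gt0 card_G s_edges le_w.
pose N := graph_net s_edges n_gt0.
have size_s : size s = (n + k - 1)%N by rewrite (size_edge_list s_edges).
have n3 : (3 <= n)%N by apply: (graph_order_ge3 (G := G)) => //; rewrite card_G; lia.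
have fit : fits N w.
  by apply: fits_pow6; rewrite //= size_s -card_G card_edges_le.
have log_gt0 : (1 <= trunc_log 2 n)%N by rewrite trunc_log_gt0 /=; lia.
have lt_log : (nv N < 2 ^ (trunc_log 2 n).+1)%N by apply: trunc_log_ltn.
have conn := graph_metricP (s_edges := s_edges) (n_gt0 := n_gt0).
have cost : (total_cost N (trunc_log 2 n).+1 k <= 200 * 200 * (n * k * trunc_log 2 n))%N.
  by apply: (@total_cost_le _ N).
have [t [st [r [run Er out]]]] : wp w diameter (init_state G s)
    (200 * 200 * (n * k * trunc_log 2 n)) (fun st _ => output st = diam G).
  apply: (wp_diameter (d := graph_metric G n_gt0) fit lt_log k_gt0 size_s (fun H => (conn H).1)) => //=.
  - by case=> [|[|a]] i //= _; rewrite !nth_nil.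
  - by move=> i; rewrite nth_nil.
  - move=> st _ [[st0 [v lt_v no_walk]]|[st0 mt ub lub]].
      rewrite /output st0 /=; apply/eqP; rewrite eq_le leey andbT.
      (* One unreachable vertex makes a distance, and hence the maximum, infinite. *)
      have <- : dist G (Ordinal n_gt0) (Ordinal lt_v) = +oo%E; last exact: dist_le_diam.
      case: (dist_attained G (Ordinal n_gt0) (Ordinal lt_v)) => [//|[p [p_path p_last _]]].
      have := walk_of_path s_edges n_gt0 p_path; rewrite p_last => H.
      by case: (no_walk _ H).
    have dE : forall u v, dist G u v = (graph_metric G n_gt0 u v)%:E.
      by apply: (conn _).2 => i j lt_i lt_j; eexists; apply: (metric_walk mt).
    rewrite /output st0 eqxx; apply/eqP; rewrite eq_le; apply/andP; split; last first.
      by apply: diam_le => u v; rewrite dE lee_fin; apply: ub; apply: ltn_ord.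
    have le_diam u v := dist_le_diam G u v.
    case: (diam G) le_diam => [D| |] le_diam.
    + rewrite lee_fin; apply: lub => i j lt_i lt_j; rewrite -lee_fin.
      by have := le_diam (Ordinal lt_i) (Ordinal lt_j); rewrite dE.
    + exact: leey.
    (* There is a vertex, so the default [-oo] of an empty maximum does not occur. *)
    + by have := le_diam (Ordinal n_gt0) (Ordinal n_gt0); rewrite dE.
exists t, st; split=> //; split=> //; lia.
Qed.
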